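(* Let $x^A=x_1^{\alpha_1}\cdots x_N^{\alpha_N}$ with $\alpha_i\ge0$, $D=N+\sum_i\alpha_i$, $\mathbb{R}^N_*=\{x\in\mathbb{R}^N:x_i>0\text{ whenever }\alpha_i>0\}$. For $u\in S_A$ define $$\delta_A(u)=\left(\int_{\mathbb{R}^N_*}|\nabla u|^2x^A dx\right)^{1/2}\left(\int_{\mathbb{R}^N_*}|u|^2|x|^2x^Adx\right)^{1/2}-\frac D2\int_{\mathbb{R}^N_*}|u|^2x^Adx$$ and $$d_A(u,E_{HUPA})=\inf_{c\in\mathbb{R},\,\lambda\ne0}\left(\int_{\mathbb{R}^N_*}\left|u-ce^{-\frac{|x|^2}{2\lambda^2}}\right|^2x^Adx\right)^{1/2}.$$ Then for all $u\in S_A$, $\delta_A(u)\ge d_A^2(u,E_{HUPA})$. Moreover, if $x^A$ is partial, then equality is attained by some nontrivial $u\notin E_{HUPA}$, where $E_{HUPA}=\{\alpha e^{-\beta|x|^2}:\alpha\in\mathbb{R},\beta>0\}$.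
   Context: $N_*$ is the set of $u\in C_0^\infty(\overline{\mathbb{R}^N_*})$ with $\nabla u\cdot\vec\eta=0$ on $\partial\mathbb{R}^N_*$ ($\vec\eta$ the outer normal). $S_A$ is the completion of $N_*$ under the norm $\left(\int_{\mathbb{R}^N_*}|\nabla u|^2x^Adx\right)^{1/2}+\left(\int_{\mathbb{R}^N_*}|u|^2|x|^2x^Adx\right)^{1/2}$. The monomial weight $x^A$ is full if $\alpha_i>0$ for all $i$, and partial otherwise. *)

(* Defs.v *)
From HB Require Import structures.
From mathcomp Require Import all_boot all_order all_algebra.
From mathcomp Require Import all_classical all_reals all_analysis.
Set Implicit Arguments. Unset Strict Implicit. Unset Printing Implicit Defensive.
Import Order.TTheory GRing.Theory Num.Theory.
Import numFieldNormedType.Exports.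
Local Open Scope classical_set_scope.
Local Open Scope ring_scope.

Section HUPA.
Variable R : realType.

(* conversion tuple -> row vector (tuples carry the product sigma-algebra) *)
Definition row_of_tuple (n : nat) (t : n.-tuple R) : 'rV[R]_n := \row_i tnth t i.

(* N-dimensional Lebesgue integral of a NONNEGATIVE function, defined as the
   iterated one-dimensional Lebesgue integral (equal to the product-measure
   integral by Tonelli). *)
Fixpoint iint (n : nat) : (n.-tuple R -> \bar R) -> \bar R :=
  match n return (n.-tuple R -> \bar R) -> \bar R with
  | 0 => fun f => f [tuple]
  | n'.+1 => fun f =>
      (\int[@lebesgue_measure R]_(t in [set: R]) iint (fun y => f (cons_tuple t y)))%E
  end.

Definition intN (n : nat) (f : 'rV[R]_n -> \bar R) : \bar R :=
  iint (fun t => f (row_of_tuple t)).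

(* Lebesgue-measurability of a function on R^n (product Borel sigma-algebra) *)
Definition measurableN (n : nat) (f : 'rV[R]_n -> R) : Prop :=
  measurable_fun [set: n.-tuple R] (fun t => f (row_of_tuple t)).

Variable N : nat.
Variable alpha : 'I_N -> R.

Definition sqn (x : 'rV[R]_N) : R := \sum_i x 0 i ^+ 2.

Definition Rstar : set 'rV[R]_N := [set x | forall i, 0 < alpha i -> 0 < x 0 i].

Definition Rstar_cl : set 'rV[R]_N := [set x | forall i, 0 < alpha i -> 0 <= x 0 i].

(* monomial weight x^A = prod_i x_i^alpha_i (x_i^0 = 1) *)
Definition wA (x : 'rV[R]_N) : R := \prod_i (x 0 i `^ alpha i).

Definition dimA : R := N%:R + \sum_i alpha i.

Definition wint (f : 'rV[R]_N -> R) : \bar R :=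
  intN (fun x => (\1_Rstar x * (f x * wA x))%:E).

Definition ae_eq_star (u v : 'rV[R]_N -> R) : Prop :=
  intN (fun x => (\1_(Rstar `&` [set y | u y <> v y]) x)%:E) = 0%E.

Definition ej (i : 'I_N) : 'rV[R]_N := delta_mx 0 i.

Fixpoint dpart (s : seq 'I_N) (f : 'rV[R]_N -> R) : 'rV[R]_N -> R :=
  match s with
  | [::] => f
  | i :: s' => 'D_(ej i) (dpart s' f)
  end.

Definition smooth (f : 'rV[R]_N -> R) : Prop :=
  forall s : seq 'I_N, continuous (dpart s f) /\
    forall x i, derivable (dpart s f) x (ej i).

(* N_*: (restrictions to the closure of R^N_* of) C_0^infinity functions with
   vanishing normal derivative on the boundary faces {x_i = 0}, alpha_i > 0 *)
Definition Nstar (v : 'rV[R]_N -> R) : Prop :=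
  [/\ smooth v,
      compact (closure [set x | v x != 0]) &
      forall i, 0 < alpha i -> forall x, Rstar_cl x -> x 0 i = 0 ->
        'D_(ej i) v x = 0].

(* S_A: u together with its (weak) gradient g, obtained as the limit of a
   sequence of N_* functions in the norm of S_A. *)
Definition SA (u : 'rV[R]_N -> R) (g : 'I_N -> 'rV[R]_N -> R) : Prop :=
  [/\ measurableN u, forall i, measurableN (g i) &
      exists v : nat -> 'rV[R]_N -> R,
        [/\ forall k, Nstar (v k),
            (fun k => wint (fun x => \sum_i ('D_(ej i) (v k) x - g i x) ^+ 2))
              @ \oo --> 0%E &
            (fun k => wint (fun x => (v k x - u x) ^+ 2 * sqn x)) @ \oo --> 0%E]].

Local Open Scope ereal_scope.

Definition deltaA (u : 'rV[R]_N -> R) (g : 'I_N -> 'rV[R]_N -> R) : \bar R :=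
  sqrte (wint (fun x => (\sum_i (g i x) ^+ 2)%R)) *
  sqrte (wint (fun x => ((u x) ^+ 2 * sqn x)%R))
  - ((dimA / 2)%:E * wint (fun x => ((u x) ^+ 2)%R)).

Definition dA (u : 'rV[R]_N -> R) : \bar R :=
  ereal_inf [set e | exists (c l : R), l != 0%R /\
    e = sqrte (wint (fun x => ((u x - c * expR (- (sqn x / (2 * l ^+ 2)))) ^+ 2)%R))].

End HUPA.

(* Main.v *)
(** Replacing $u$ by its approximations in $N_*$ and optimizing over the scale
    [b] in [2 sqrt (ac) <= a / b + b c], the inequality reduces to the Poincaré
    inequality with constant [2 b] for the probability proportional to
    $x^A e^{-b|x|^2}$ on $\mathbb{R}^N_*$, applied to $u e^{b|x|^2/2}$: expanding
    $|\nabla (u e^{b|x|^2/2})|^2$ and integrating by parts produces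
    $\frac{D}{2}\int |u|^2 x^A dx$, and the subtracted mean of $u e^{b|x|^2/2}$
    is the constant $c$ of the Gaussian $c e^{-b|x|^2/2}$.
    This probability is a product, so that the Efron–Stein inequality reduces
    the Poincaré inequality to one variable, where it follows from
    $(\varphi' - \varphi/(x - x_0))^2 \ge 0$, with $x_0$ the mode of the density
    and $\varphi = f - f(x_0)$.
    When $\alpha_i = 0$, equality holds for $u = x_i e^{-|x|^2/2}$: it is
    orthogonal to the radial Gaussians, and it is an eigenfunction for the
    second eigenvalue of the harmonic oscillator. *)

Require Import Defs.
From HB Require Import structures.
From mathcomp Require Import all_boot all_order all_algebra.
From mathcomp Require Import all_classical all_reals all_analysis.
From mathcomp Require Import measurable_realfun.
From mathcomp Require Import ring lra.
Import Order.TTheory GRing.Theory Num.Theory.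
Import numFieldNormedType.Exports.
Set Implicit Arguments. Unset Strict Implicit. Unset Printing Implicit Defensive.
Local Open Scope classical_set_scope.
Local Open Scope ring_scope.

(** * Tensorization of the variance *)

(** [wint] is an iterated integral with no calculus of its own. Since $x^A e^{-b|x|^2}$ on
    $\mathbb{R}^N_*$ is a multiple of a product probability, $\int f x^A dx$ is rewritten as an
    integral of a multiple of $f e^{b|x|^2}$ under that probability, from which it inherits
    monotonicity, linearity and Tonelli. Convergence in $S_A$ does not visibly control $\int |u|^2
    x^A dx$, because $|x|^2$ vanishes at the origin. The inequality itself, applied with $b = 1$ to
    $v_k - v_l$, bounds that distance, and a truncation vanishing on a hyperplane through the origin
    identifies the limit with $u$. The limit is then taken at fixed $b$, through $x^2 \le
    (1+\varepsilon) y^2 + (1+\varepsilon^{-1})(x-y)^2$. The one-variable inequalities are proved on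
    segments, where their boundary terms vanish, can be made small, or have a favourable sign. The
    integration by parts is proved in both directions: one for compact supports, the other for every
    $C^1$ function, hence for the extremal function, whose support is not compact. *)

Section density.
Local Open Scope ereal_scope.
Context d (T : measurableType d) (R : realType) (mu : {measure set T -> \bar R}).
Variable r : T -> R.
Hypothesis r_ge0 : forall x, (0 <= r x)%R.
Hypothesis mr : measurable_fun setT r.
Hypothesis r1 : \int[mu]_x (r x)%:E = 1.

Definition with_density (A : set T) := \int[mu]_(x in A) (r x)%:E.

Let with_density0 : with_density set0 = 0.
Proof. exact: integral_set0. Qed.

Let with_density_ge0 A : 0 <= with_density A.
Proof. by apply: integral_ge0 => x _; rewrite lee_fin. Qed.

Let with_density_sigma_additive : semi_sigma_additive with_density.
Proof.
move=> F mF tF mUF; rewrite /with_density ge0_integral_bigcup//.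
- by apply: is_cvg_ereal_nneg_natsum_cond => n _ _; exact: with_density_ge0.
- by apply/measurable_EFinP; exact: measurable_funTS.
- by move=> x _; rewrite lee_fin.
Qed.

HB.instance Definition _ := isMeasure.Build _ _ _ with_density
  with_density0 with_density_ge0 with_density_sigma_additive.

HB.instance Definition _ := @Measure_isProbability.Build _ _ R with_density r1.

Let mrE : measurable_fun setT (EFin \o r).
Proof. exact/measurable_EFinP. Qed.

Import HBNNSimple.

(** The formula is checked on nonnegative simple functions, level set by level set, and reaches [g]
    by monotone convergence along [nnsfun_approx]. *)
Lemma density_probability : exists P : probability T R,
  forall g : T -> \bar R, measurable_fun setT g -> (forall x, 0 <= g x) ->
  \int[P]_x g x = \int[mu]_x (g x * (r x)%:E).
Proof.
exists with_density => g mg g0.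
pose h := nnsfun_approx measurableT mg.
have hE (t : {nnsfun T >-> R}) :
    \int[with_density]_x (t x)%:E = \int[mu]_x ((t x)%:E * (r x)%:E).
  have t0 y x : (0 <= y * \1_(t @^-1` [set y]) x)%R.
    by rewrite -lee_fin EFinM nnfun_muleindic_ge0.
  under [LHS]eq_integral do rewrite fimfunE -fsumEFin//.
  rewrite [LHS]ge0_integral_fsum//; last 2 first.
    by move=> y; apply/measurable_EFinP; exact: measurable_funM.
    by move=> n x _; rewrite lee_fin.
  under [in RHS]eq_integral.
    move=> x _; rewrite fimfunE -fsumEFin// ge0_mule_fsuml; last first.
      by move=> y; rewrite lee_fin.
    over.
  rewrite [RHS]ge0_integral_fsum//; last 2 first.
  - move=> y; apply: emeasurable_funM => //.
    by apply/measurable_EFinP; exact: measurable_funM.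
  - by move=> n x _; rewrite mule_ge0 ?lee_fin.
  apply: eq_fsbigr => y _.
  (* A negative value is never taken by [t]: its level set is empty and both sides vanish. *)
  have [y0|y0] := leP 0%R y; last first.
    by rewrite preimage_nnfun0//; under eq_integral do rewrite indic0 mulr0;
      under [in RHS]eq_integral do rewrite indic0 mulr0 mul0e;
      rewrite !integral0.
  under eq_integral do rewrite EFinM.
  under [in RHS]eq_integral do rewrite EFinM -muleA.
  rewrite [LHS]ge0_integralZl//; last first.
    exact/measurable_EFinP.
  rewrite [RHS]ge0_integralZl//; last 2 first.
    by apply: emeasurable_funM => //; exact/measurable_EFinP.
    by move=> x _; rewrite mule_ge0// lee_fin.
  congr (_ * _); rewrite integral_indic// setIT.
  transitivity (with_density (t @^-1` [set y])) => //.
  rewrite /with_density integral_mkcond; apply: eq_integral => x _.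
  by rewrite patchE indicE; case: ifPn; rewrite ?mul1e ?mul0e.
transitivity (limn (fun n => \int[with_density]_x (h n x)%:E)).
  rewrite -monotone_convergence//.
  - apply: eq_integral => x _; apply/esym/cvg_lim => //.
    exact: cvg_nnsfun_approx.
  - by move=> n; exact/measurable_EFinP.
  - by move=> n x _; rewrite lee_fin.
  - by move=> x _ m n mn; rewrite lee_fin; exact/lefP/nd_nnsfun_approx.
under [X in limn X]eq_fun do rewrite hE.
rewrite -monotone_convergence//.
- apply: eq_integral => x _; apply/cvg_lim => //.
  apply: cvgeZr => //; exact: cvg_nnsfun_approx.
- by move=> n; apply: emeasurable_funM => //; exact/measurable_EFinP.
- by move=> n x _; rewrite mule_ge0 ?lee_fin.
- move=> x _ m n mn; rewrite lee_wpmul2r ?lee_fin//.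
  exact/lefP/nd_nnsfun_approx.
Qed.

End density.

(** * Product probabilities on tuples, integrated one variable at a time *)

Section tuple_product.
Context (R : realType).
Implicit Types (n : nat).

Definition tset n (t : n.-tuple R) (j : 'I_n) (s : R) : n.-tuple R :=
  [tuple (if i == j then s else tnth t i) | i < n].

Lemma tset_cons0 n (x : R) (y : n.-tuple R) s :
  tset (cons_tuple x y) ord0 s = cons_tuple s y.
Proof.
apply: eq_from_tnth => i; rewrite tnth_mktuple.
by case: (unliftP ord0 i) => [j|] ->; rewrite ?eqxx// tnthS [in RHS]tnthS.
Qed.

Lemma tset_consS n (x : R) (y : n.-tuple R) j s :
  tset (cons_tuple x y) (lift ord0 j) s = cons_tuple x (tset y j s).
Proof.
apply: eq_from_tnth => i; rewrite tnth_mktuple.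
case: (unliftP ord0 i) => [k|] ->; last first.
  by rewrite (negbTE (neq_lift _ _)).
by rewrite !tnthS tnth_mktuple (inj_eq lift_inj).
Qed.

Lemma measurable_cons_pair n : measurable_fun [set: R * n.-tuple R]
  (fun z : R * n.-tuple R => cons_tuple z.1 z.2).
Proof.
apply: (@measurable_cons _ _ _ _ fst n snd); exact: measurable_funTS.
Qed.

Lemma measurable_consr n (x : R) : measurable_fun [set: n.-tuple R]
  (fun y : n.-tuple R => cons_tuple x y).
Proof. exact: (@measurable_cons _ _ _ _ (cst x) n id). Qed.

Lemma measurable_consl n (y : n.-tuple R) : measurable_fun [set: R]
  (fun x : R => cons_tuple x y).
Proof. exact: (@measurable_cons _ _ _ _ id n (cst y)). Qed.

(** The image of [P \x Q] under [cons_tuple]. By Tonelli its integral unfolds with the same nesting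
    as [iint]. *)
Lemma tuple_cons_probability n (P : probability R R)
    (Q : probability (n.-tuple R) R) :
  exists S : probability (n.+1.-tuple R) R,
    forall f : n.+1.-tuple R -> \bar R, measurable_fun setT f ->
      (forall t, 0 <= f t)%E ->
      (\int[S]_t f t = \int[P]_x \int[Q]_y f (cons_tuple x y))%E.
Proof.
have mc := @measurable_cons_pair n.
pose X : {mfun (R * n.-tuple R)%type >-> n.+1.-tuple R} :=
  HB.pack (fun z : R * n.-tuple R => cons_tuple z.1 z.2)
    (isMeasurableFun.Build _ _ _ _ _ mc).
exists (distribution (P \x Q)%E X) => f mf f0.
rewrite /distribution ge0_integral_pushforward// preimage_setT.
rewrite fubini_tonelli1//; last by move=> z; exact: f0.
exact: (measurableT_comp mf).
Qed.

Lemma tuple0_probability : exists S : probability (0.-tuple R) R,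
  forall f : 0.-tuple R -> \bar R, measurable_fun setT f ->
    (forall t, 0 <= f t)%E -> (\int[S]_t f t = f [tuple])%E.
Proof.
exists (dirac ([tuple] : 0.-tuple R)) => f mf f0.
by rewrite integral_dirac// diracT mul1e.
Qed.

(** The recursion follows that of [iint]. Each stage is chosen from an existence statement, so that
    the integral formulas below are the whole interface of [tprod]. *)
Fixpoint tprod n : ('I_n -> probability R R) -> probability (n.-tuple R) R :=
  match n with
  | 0 => fun=> sval (cid tuple0_probability)
  | n'.+1 => fun P => sval (cid (tuple_cons_probability (P ord0)
                                  (tprod (fun i => P (lift ord0 i)))))
  end.

Lemma integral_tprod0 (P : 'I_0 -> probability R R) (f : 0.-tuple R -> \bar R) :
  measurable_fun setT f -> (forall t, 0 <= f t)%E ->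
  (\int[tprod P]_t f t = f [tuple])%E.
Proof. exact: (svalP (cid tuple0_probability)). Qed.

Lemma integral_tprodS n (P : 'I_n.+1 -> probability R R)
    (f : n.+1.-tuple R -> \bar R) :
  measurable_fun setT f -> (forall t, 0 <= f t)%E ->
  (\int[tprod P]_t f t =
   \int[P ord0]_x \int[tprod (fun i => P (lift ord0 i))]_y f (cons_tuple x y))%E.
Proof.
exact: (svalP (cid (tuple_cons_probability (P ord0)
                      (tprod (fun i => P (lift ord0 i)))))).
Qed.

Lemma measurable_integral_cons n (Q : probability (n.-tuple R) R)
    (f : n.+1.-tuple R -> \bar R) :
  measurable_fun setT f -> (forall t, 0 <= f t)%E ->
  measurable_fun setT (fun x => \int[Q]_y f (cons_tuple x y))%E.
Proof.
move=> mf f0.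
apply: (@measurable_fun_fubini_tonelli_F _ _ _ _ _ Q
  (fun z : R * n.-tuple R => f (cons_tuple z.1 z.2))) => //.
exact: (measurableT_comp mf (@measurable_cons_pair n)).
Qed.

(** The bridge between [iint] and measure theory: an iterated Lebesgue integral against a product
    density is an integral under one probability, where the usual theorems apply. *)
Lemma integral_tprod n (P : 'I_n -> probability R R) (r : 'I_n -> R -> R) :
  (forall i x, 0 <= r i x) ->
  (forall i (g : R -> \bar R), measurable_fun setT g -> (forall x, 0 <= g x)%E ->
    (\int[P i]_x g x = \int[lebesgue_measure]_x (g x * (r i x)%:E))%E) ->
  forall f : n.-tuple R -> \bar R, measurable_fun setT f ->
    (forall t, 0 <= f t)%E ->
    (\int[tprod P]_t f t = iint (fun t => f t * (\prod_i r i (tnth t i))%:E))%E.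
Proof.
elim: n P r => [|n IH] P r r0 Pr f mf f0.
  by rewrite integral_tprod0//= big_ord0 mule1.
rewrite integral_tprodS// Pr; last 2 first.
- exact: measurable_integral_cons.
- by move=> x; exact: integral_ge0.
rewrite /=; apply: eq_integral => x _.
(* The density in the first variable must enter the inner integrand before the induction hypothesis
   turns it into an [iint], through which constants cannot be moved. *)
rewrite muleC -ge0_integralZl//; last 2 first.
- exact: (measurableT_comp mf (measurable_consr x)).
- by rewrite lee_fin.
rewrite (IH _ (fun i => r (lift ord0 i)))//; last 3 first.
- by move=> i g mg g0; exact: Pr.
- apply: measurable_funeM.
  exact: (measurableT_comp mf (measurable_consr x)).
- by move=> y; rewrite mule_ge0// lee_fin.
congr iint; apply/funext => y.
rewrite big_ord_recl EFinM [((r _ _)%:E * _)%E]muleC -!muleA; congr (_ * _)%E.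
by congr (_ * EFin _)%E; apply: eq_bigr => i _; rewrite tnthS.
Qed.

(* Tonelli in the [j]-th variable: it suffices to compare the two integrals
   along every line parallel to the [j]-th axis. *)
Lemma le_tprod_slice n (P : 'I_n -> probability R R) (j : 'I_n)
    (f g : n.-tuple R -> \bar R) :
  measurable_fun setT f -> (forall t, 0 <= f t)%E ->
  measurable_fun setT g -> (forall t, 0 <= g t)%E ->
  (forall t, \int[P j]_s f (tset t j s) <= \int[P j]_s g (tset t j s))%E ->
  (\int[tprod P]_t f t <= \int[tprod P]_t g t)%E.
Proof.
elim: n P j f g => [P []//|n IH] P j f g mf f0 mg g0 fg.
rewrite !integral_tprodS//.
have mc (h : n.+1.-tuple R -> \bar R) (x : R) : measurable_fun setT h ->
    measurable_fun setT (fun y => h (cons_tuple x y) : \bar R).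
  by move=> mh; exact: (measurableT_comp mh (@measurable_consr n x)).
case: (unliftP ord0 j) => [k|] jE.
  apply: ge0_le_integral => //.
  - by move=> x _; exact: integral_ge0.
  - exact: measurable_integral_cons.
  - exact: measurable_integral_cons.
  - move=> x _; apply: (IH _ k) => //; [exact: mc|exact: mc|].
    move=> t; have := fg (cons_tuple x t); rewrite jE.
    under eq_integral do rewrite tset_consS.
    by under [X in (_ <= X)%E]eq_integral do rewrite tset_consS.
rewrite jE in fg.
pose F h (z : R * n.-tuple R) : \bar R := h (cons_tuple z.1 z.2).
have mF (h : n.+1.-tuple R -> \bar R) : measurable_fun setT h -> measurable_fun setT (F h).
  by move=> mh; exact: (measurableT_comp mh (@measurable_cons_pair n)).
(* The distinguished variable is now the outermost one; exchanging the integrals makes it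
   innermost. *)
rewrite (@fubini_tonelli _ _ _ _ _ (P ord0)
  (tprod (fun i => P (lift ord0 i))) (F f))//; [|exact: mF|by move=> z; exact: f0].
rewrite (@fubini_tonelli _ _ _ _ _ (P ord0)
  (tprod (fun i => P (lift ord0 i))) (F g))//; [|exact: mF|by move=> z; exact: g0].
apply: ge0_le_integral => //.
- by move=> y _; apply: integral_ge0 => x _; exact: f0.
- apply: (@measurable_fun_fubini_tonelli_G _ _ _ _ _ (P ord0) (F f)) => //.
    exact: mF.
  by move=> z; exact: f0.
- apply: (@measurable_fun_fubini_tonelli_G _ _ _ _ _ (P ord0) (F g)) => //.
    exact: mF.
  by move=> z; exact: g0.
(* The head [0] is a placeholder, overwritten by [tset] at [ord0]. *)
- move=> y _; have := fg (cons_tuple 0 y).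
  under eq_integral do rewrite tset_cons0.
  by under [X in (_ <= X)%E]eq_integral do rewrite tset_cons0.
Qed.

End tuple_product.

(** * Variance of bounded functions and the Efron-Stein inequality *)

Section variance.
Context d (T : measurableType d) (R : realType) (P : probability T R).
Implicit Types f : T -> R.

Lemma bounded_integrable f M : measurable_fun setT f ->
  (forall x, `|f x| <= M) -> P.-integrable setT (EFin \o f).
Proof.
move=> mf fM; apply: measurable_bounded_integrable => //.
  by rewrite /= probability_setT ltry.
exists M; split; first exact: num_real.
by move=> x Mx y _; apply: le_trans (fM y) _; exact: ltW.
Qed.

Lemma EFin_Rintegral f M : measurable_fun setT f -> (forall x, `|f x| <= M) ->
  (\int[P]_x (f x)%:E = (\int[P]_x f x)%R%:E)%E.
Proof.
move=> mf fM; rewrite /Rintegral fineK//.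
by apply: integrable_fin_num => //; exact: bounded_integrable fM.
Qed.

Lemma Rintegral_sqrB f M c : measurable_fun setT f -> (forall x, `|f x| <= M) ->
  \int[P]_x (f x - c) ^+ 2 =
  \int[P]_x (f x - \int[P]_y f y) ^+ 2 + (\int[P]_y f y - c) ^+ 2.
Proof.
move=> mf fM.
have i1 : P.-integrable setT (EFin \o f) by exact: bounded_integrable fM.
have i2 : P.-integrable setT (EFin \o (fun x => f x ^+ 2)).
  apply: (@bounded_integrable _ (M ^+ 2)); first exact: measurable_funX.
  move=> x; rewrite normrX lerXn2r// ?nnegrE//.
  by rewrite (le_trans _ (fM x)).
have E a : \int[P]_x (f x - a) ^+ 2 =
    \int[P]_x f x ^+ 2 - (a *+ 2) * \int[P]_x f x + a ^+ 2.
  under eq_Rintegral => x _.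
    rewrite (_ : _ ^+ 2 = f x ^+ 2 - (a *+ 2) * f x + cst (a ^+ 2) x); last first.
      by rewrite /cst/=; ring.
    over.
  have i3 : P.-integrable setT (EFin \o (fun x => (a *+ 2) * f x)).
    exact: (integrableZl _ (a *+ 2) i1).
  have i4 : P.-integrable setT (EFin \o cst (a ^+ 2)).
    exact: finite_measure_integrable_cst.
  rewrite RintegralD//; last exact: (integrableB _ i2 i3).
  rewrite RintegralB// RintegralZl// Rintegral_cst//.
  rewrite [X in fine X](_ : _ = 1%E) ?mulr1//; exact: probability_setT.
by rewrite !E; ring.
Qed.

(** The mean is the best constant in $L^2$. In an upper bound of a variance it may thus be traded
    for a more convenient constant, such as an iterated mean or the value at the mode. *)
Lemma le_variance f M c : measurable_fun setT f -> (forall x, `|f x| <= M) ->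
  (\int[P]_x ((f x - (\int[P]_y f y)%R) ^+ 2)%:E <=
   \int[P]_x ((f x - c) ^+ 2)%:E)%E.
Proof.
move=> mf fM.
have iB a : (\int[P]_x ((f x - a) ^+ 2)%:E = (\int[P]_x (f x - a) ^+ 2)%R%:E)%E.
  apply: (@EFin_Rintegral _ ((M + `|a|) ^+ 2)).
    by apply: measurable_funX; exact: measurable_funB.
  move=> x; rewrite normrX lerXn2r ?nnegrE//.
    by rewrite addr_ge0// (le_trans _ (fM x)).
  by rewrite (le_trans (ler_normB _ _))// lerD2r.
by rewrite !iB lee_fin (Rintegral_sqrB c mf fM) lerDl sqr_ge0.
Qed.

Lemma variance_shift f M c : measurable_fun setT f -> (forall x, `|f x| <= M) ->
  (\int[P]_x ((f x - c) ^+ 2)%:E =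
   \int[P]_x ((f x - (\int[P]_y f y)%R) ^+ 2)%:E
   + (((\int[P]_y f y)%R - c) ^+ 2)%:E)%E.
Proof.
move=> mf fM.
have iB a : (\int[P]_x ((f x - a) ^+ 2)%:E = (\int[P]_x (f x - a) ^+ 2)%R%:E)%E.
  apply: (@EFin_Rintegral _ ((M + `|a|) ^+ 2)).
    by apply: measurable_funX; exact: measurable_funB.
  move=> x; rewrite normrX lerXn2r ?nnegrE//.
    by rewrite addr_ge0// (le_trans _ (fM x)).
  by rewrite (le_trans (ler_normB _ _))// lerD2r.
by rewrite !iB (Rintegral_sqrB c mf fM) EFinD.
Qed.

Lemma normr_Rintegral_le f M : measurable_fun setT f ->
  (forall x, `|f x| <= M) -> `|\int[P]_x f x| <= M.
Proof.
move=> mf fM; have i1 := bounded_integrable mf fM.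
rewrite (le_trans (le_normr_Rintegral _ i1))//.
rewrite -[leRHS]mulr1 -[X in _ <= _ * X](_ : fine (P setT) = 1); last first.
  by rewrite probability_setT.
rewrite -Rintegral_cst//; apply: le_Rintegral => //.
- exact: integrable_norm.
- exact: finite_measure_integrable_cst.
Qed.

(** Jensen's inequality for the square, read off from the nonnegativity of the variance. *)
Lemma sqr_Rintegral_le f M : measurable_fun setT f -> (forall x, `|f x| <= M) ->
  (((\int[P]_x f x)%R ^+ 2)%:E <= \int[P]_x (f x ^+ 2)%:E)%E.
Proof.
move=> mf fM; have := variance_shift 0 mf fM.
rewrite subr0; under eq_integral do rewrite subr0.
move=> ->; rewrite leeDr// integral_ge0// => x _.
by rewrite lee_fin sqr_ge0.
Qed.

End variance.

Section efron_stein.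
Context d d' (X : measurableType d) (Y : measurableType d') (R : realType).
Variables (P : probability X R) (Q : probability Y R).
Variables (F : X * Y -> R) (M : R).
Hypothesis mF : measurable_fun setT F.
Hypothesis FM : forall z, `|F z| <= M.

Let c x := \int[Q]_y F (x, y).
Let e y := \int[P]_x F (x, y).

Let mF1 x : measurable_fun setT (fun y => F (x, y)).
Proof. exact: (measurableT_comp mF (measurable_pair1 x)). Qed.

Let mF2 y : measurable_fun setT (fun x => F (x, y)).
Proof. exact: (measurableT_comp mF (measurable_pair2 y)). Qed.

Let iF : (P \x Q)%E.-integrable setT (EFin \o F).
Proof. exact: (@bounded_integrable _ _ _ (P \x Q)%E _ M). Qed.

Let mc : measurable_fun setT c.
Proof. by apply: measurableT_comp => //; exact: (measurable_fubini_F iF). Qed.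

Let me : measurable_fun setT e.
Proof. by apply: measurableT_comp => //; exact: (measurable_fubini_G iF). Qed.

Let cM x : `|c x| <= M.
Proof. exact: normr_Rintegral_le. Qed.

Let eM y : `|e y| <= M.
Proof. exact: normr_Rintegral_le. Qed.

(* The projections [F -> c] and [F -> e] onto the functions of one variable
   are commuting contractions. *)
Lemma efron_stein :
  (\int[P]_x \int[Q]_y ((F (x, y) - (\int[P]_x c x)%R) ^+ 2)%:E <=
   \int[Q]_y \int[P]_x ((F (x, y) - (\int[P]_x F (x, y))%R) ^+ 2)%:E +
   \int[P]_x \int[Q]_y ((F (x, y) - (\int[Q]_y F (x, y))%R) ^+ 2)%:E)%E.
Proof.
set m := (\int[P]_x c x)%R.
have mG (g : X * Y -> R) : measurable_fun setT g ->
    measurable_fun setT (fun z => ((F z - g z) ^+ 2)%:E).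
  by move=> mg; apply/measurable_EFinP/measurable_funX; exact: measurable_funB.
have G0 (g : X * Y -> R) z : (0 <= ((F z - g z) ^+ 2)%:E)%E.
  by rewrite lee_fin sqr_ge0.
have mc' : measurable_fun setT (fun z : X * Y => c z.1) by exact: measurableT_comp.
have me' : measurable_fun setT (fun z : X * Y => e z.2) by exact: measurableT_comp.
rewrite (@fubini_tonelli _ _ _ _ _ P Q _ (mG (cst m) _) (G0 (cst m)))//=.
rewrite (@fubini_tonelli _ _ _ _ _ P Q _ (mG _ mc') (G0 _))//=.
rewrite -ge0_integralD//=; last 4 first.
- by move=> y _; apply: integral_ge0 => x _; rewrite lee_fin sqr_ge0.
- exact: (@measurable_fun_fubini_tonelli_G _ _ _ _ _ P _ (mG _ me') (G0 _)).
- by move=> y _; apply: integral_ge0 => x _; rewrite lee_fin sqr_ge0.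
- exact: (@measurable_fun_fubini_tonelli_G _ _ _ _ _ P _ (mG _ mc') (G0 _)).
apply: ge0_le_integral => //=.
- by move=> y _; apply: integral_ge0 => x _; rewrite lee_fin sqr_ge0.
- exact: (@measurable_fun_fubini_tonelli_G _ _ _ _ _ P _ (mG (cst m) _) (G0 _)).
- apply: emeasurable_funD.
    exact: (@measurable_fun_fubini_tonelli_G _ _ _ _ _ P _ (mG _ me') (G0 _)).
  exact: (@measurable_fun_fubini_tonelli_G _ _ _ _ _ P _ (mG _ mc') (G0 _)).
move=> y _; rewrite (variance_shift P m (mF2 y) (M := M))//.
rewrite leeD2l//.
have FcM x : `|F (x, y) - c x| <= M + M.
  by rewrite (le_trans (ler_normB _ _))// lerD.
(* At fixed [y], the difference between the partial mean and [m] is the mean over [x] of [F - c], so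
   that Jensen bounds its square by the second term of the right-hand side. *)
rewrite (_ : \int[P]_x F (x, y) - m = \int[P]_x (F (x, y) - c x)).
  apply: (sqr_Rintegral_le P _ FcM); exact: measurable_funB.
rewrite RintegralB//.
- exact: (bounded_integrable P (mF2 y) (M := M)).
- exact: (bounded_integrable P mc cM).
Qed.

End efron_stein.

Section poincare.
Context (R : realType).

(** Bounded test functions have a mean under every probability; nothing bounds [f'], and the
    right-hand side may be infinite. *)
Definition poincare1 (P : probability R R) (C : R) : Prop :=
  forall (f f' : R -> R) (M : R), (forall s, `|f s| <= M) ->
    (forall s, is_derive (s : R) (1 : R) f (f' s)) -> continuous f' ->
    (\int[P]_s ((f s - (\int[P]_t f t)%R) ^+ 2)%:E <=
     C%:E * \int[P]_s (f' s ^+ 2)%:E)%E.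

(** The constant does not grow with [n]: the conditional variance in the first variable is paid by
    the derivative in that variable alone, and the conditional variance in the others by their own
    derivatives, through the induction hypothesis. *)
Lemma tprod_poincare n (P : 'I_n -> probability R R) (C : R) :
  0 <= C -> (forall i, poincare1 (P i) C) ->
  forall (f : n.-tuple R -> R) (df : 'I_n -> n.-tuple R -> R) (M : R),
    measurable_fun setT f -> (forall t, `|f t| <= M) ->
    (forall j, measurable_fun setT (df j)) ->
    (forall j t s, is_derive (s : R) (1 : R) (fun s => f (tset t j s)) (df j (tset t j s))) ->
    (forall j t, continuous (fun s => df j (tset t j s))) ->
  (\int[tprod P]_t ((f t - (\int[tprod P]_t f t)%R) ^+ 2)%:E <=
   C%:E * \int[tprod P]_t (\sum_j df j t ^+ 2)%:E)%E.
Proof.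
move=> C0; elim: n P => [|n IH] P Ppoin f df M mf fM mdf dfE cdf.
  apply: le_trans (le_variance _ (f [tuple]) mf fM) _.
  rewrite [leLHS]integral_tprod0//; last 2 first.
    by apply/measurable_EFinP/measurable_funX; exact: measurable_funB.
    by move=> t; rewrite lee_fin sqr_ge0.
  rewrite subrr expr0n/= mule_ge0 ?lee_fin// integral_ge0// => t _.
  by rewrite lee_fin sumr_ge0// => i _; exact: sqr_ge0.
pose Q := tprod (fun i => P (lift ord0 i)).
pose F (z : R * n.-tuple R) := f (cons_tuple z.1 z.2).
have mF : measurable_fun setT F.
  exact: (measurableT_comp mf (@measurable_cons_pair R n)).
pose m := \int[P ord0]_x \int[Q]_y F (x, y).
have m2 (g : n.+1.-tuple R -> R) : measurable_fun setT g ->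
    measurable_fun setT (fun t => (g t ^+ 2)%:E).
  by move=> mg; apply/measurable_EFinP/measurable_funX.
(* Passing to the iterated mean [m] avoids identifying it with the mean of [f] under [tprod], whose
   integral formula is stated for nonnegative functions. *)
apply: le_trans (le_variance _ m mf fM) _.
rewrite [leLHS]integral_tprodS//; last 2 first.
- by apply: (m2 (fun t => f t - m)); exact: measurable_funB.
- by move=> t; rewrite lee_fin sqr_ge0.
apply: le_trans (efron_stein (P ord0) Q (M := M) mF _) _.
  by move=> z; exact: fM.
have sq0 (g : n.+1.-tuple R -> R) t : (0 <= (g t ^+ 2)%:E)%E.
  by rewrite lee_fin sqr_ge0.
have ms : measurable_fun setT
    (fun t : n.+1.-tuple R => (\sum_(j < n) df (lift ord0 j) t ^+ 2)%:E).
  apply/measurable_EFinP; apply: measurable_sum => j.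
  exact: measurable_funX.
have s0 (t : n.+1.-tuple R) :
    (0 <= (\sum_(j < n) df (lift ord0 j) t ^+ 2)%:E)%E.
  by rewrite lee_fin sumr_ge0// => i _; exact: sqr_ge0.
under [X in (_ <= C%:E * X)%E]eq_integral do rewrite big_ord_recl EFinD.
rewrite [X in (C%:E * X)%E]ge0_integralD//; [|exact: (m2 _ (mdf ord0))].
rewrite ge0_muleDr; last 2 first.
- by apply: integral_ge0 => t _; exact: sq0.
- by apply: integral_ge0 => t _; exact: s0.
rewrite (integral_tprodS P (f := fun x => (df ord0 x ^+ 2)%:E))//; [|exact: (m2 _ (mdf ord0))].
rewrite (integral_tprodS P ms s0).
have mcr (g : n.+1.-tuple R -> R) x : measurable_fun setT g ->
    measurable_fun setT (fun y : n.-tuple R => g (cons_tuple x y)).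
  by move=> mg; exact: (measurableT_comp mg (@measurable_consr R n x)).
have mcl (g : n.+1.-tuple R -> R) y : measurable_fun setT g ->
    measurable_fun setT (fun x : R => g (cons_tuple x y)).
  by move=> mg; exact: (measurableT_comp mg (@measurable_consl R n y)).
have iF : (P ord0 \x Q)%E.-integrable setT (EFin \o F).
  apply: (@bounded_integrable _ _ _ (P ord0 \x Q)%E _ M) => //.
  by move=> z; exact: fM.
have mFE (g : R * n.-tuple R -> R) : measurable_fun setT g ->
    measurable_fun setT (fun z => ((F z - g z) ^+ 2)%:E).
  by move=> mg; apply/measurable_EFinP/measurable_funX; exact: measurable_funB.
have FE0 (g : R * n.-tuple R -> R) z : (0 <= ((F z - g z) ^+ 2)%:E)%E.
  by rewrite lee_fin sqr_ge0.
have mc : measurable_fun setT (fun x : R => \int[Q]_y F (x, y)).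
  by apply: measurableT_comp => //; exact: (measurable_fubini_F iF).
have me : measurable_fun setT (fun y : n.-tuple R => \int[P ord0]_x F (x, y)).
  by apply: measurableT_comp => //; exact: (measurable_fubini_G iF).
pose D0 (z : R * n.-tuple R) := ((df ord0 (cons_tuple z.1 z.2)) ^+ 2)%:E.
have mD0 : measurable_fun setT D0.
  exact: (measurableT_comp (m2 _ (mdf ord0)) (@measurable_cons_pair R n)).
have D00 z : (0 <= D0 z)%E by rewrite lee_fin sqr_ge0.
apply: leeD.
- rewrite (@fubini_tonelli _ _ _ _ _ (P ord0) Q D0 mD0 D00).
  have mG := @measurable_fun_fubini_tonelli_G _ _ _ _ _ (P ord0) D0 mD0 D00.
  have G0 y : (0 <= \int[P ord0]_x D0 (x, y))%E by exact: integral_ge0.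
  rewrite -ge0_integralZl//.
  apply: ge0_le_integral => //=.
  + by move=> y _; apply: integral_ge0 => x _; exact: (FE0 (cst _)).
  + have me' : measurable_fun setT
        (fun z : R * n.-tuple R => \int[P ord0]_x F (x, z.2)).
      exact: (measurableT_comp me).
    exact: (@measurable_fun_fubini_tonelli_G _ _ _ _ _ (P ord0) _ (mFE _ me') (FE0 _)).
  + exact: measurable_funeM.
  + move=> y _.
    apply: (Ppoin ord0 (fun x => f (cons_tuple x y))
      (fun x => df ord0 (cons_tuple x y)) M).
    * by move=> x; exact: fM.
    * move=> s; have := dfE ord0 (cons_tuple 0 y) s.
      by under eq_fun do rewrite tset_cons0; rewrite tset_cons0.
    * have := cdf ord0 (cons_tuple 0 y).
      by under eq_fun do rewrite tset_cons0.
- have mG := measurable_integral_cons Q ms s0.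
  have G0 x : (0 <= \int[Q]_y (\sum_(j < n) df (lift ord0 j) (cons_tuple x y) ^+ 2)%:E)%E.
    by apply: integral_ge0 => y _; exact: s0.
  rewrite -ge0_integralZl//.
  apply: ge0_le_integral => //=.
  + by move=> x _; apply: integral_ge0 => y _; exact: (FE0 (cst _)).
  + have mc' : measurable_fun setT
        (fun z : R * n.-tuple R => \int[Q]_y F (z.1, y)).
      exact: (measurableT_comp mc).
    exact: (@measurable_fun_fubini_tonelli_F _ _ _ _ _ Q _ (mFE _ mc') (FE0 _)).
  + exact: measurable_funeM.
  + move=> x _.
    apply: (IH _ _ (fun y => f (cons_tuple x y))
      (fun j y => df (lift ord0 j) (cons_tuple x y)) M).
    * by move=> i; exact: Ppoin.
    * exact: mcr.
    * by move=> y; exact: fM.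
    * by move=> j; exact: mcr.
    * move=> j t s; have := dfE (lift ord0 j) (cons_tuple x t) s.
      by under eq_fun do rewrite tset_consS; rewrite tset_consS.
    * move=> j t; have := cdf (lift ord0 j) (cons_tuple x t).
      by under eq_fun do rewrite tset_consS.
Qed.

End poincare.

(** * The sharp Poincaré inequality in one variable *)

Section one_variable.
Context (R : realType).
Notation mu := (@lebesgue_measure R).
Implicit Types (p q x : R) (g h f : R -> R).

Lemma is_derive_continuous (F : R -> R) (x dF : R) :
  is_derive (x : R) (1 : R) F dF -> {for x, continuous F}.
Proof.
by move=> [dF1 _]; apply: differentiable_continuous; apply/derivable1_diffP.
Qed.

Lemma at_continuous_within g p q :
  (forall x, x \in `[p, q] -> {for x, continuous g}) ->
  {within `[p, q], continuous g}.
Proof.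
move=> cg; apply: continuous_in_subspaceT => x /[!inE] xpq.
by apply: cg.
Qed.

(** The Poincaré inequality, both integrations by parts and the Gaussian second moment have this
    form: a pointwise inequality containing an exact derivative, integrated over a segment on which
    everything is continuous. *)
Lemma ftc_le g h (B B' : R -> R) p q : p < q ->
  (forall x, x \in `[p, q] -> is_derive (x : R) (1 : R) B (B' x)) ->
  (forall x, x \in `[p, q] -> {for x, continuous B'}) ->
  (forall x, x \in `[p, q] -> {for x, continuous g}) ->
  (forall x, x \in `[p, q] -> {for x, continuous h}) ->
  (forall x, x \in `[p, q] -> h x + B' x <= g x) ->
  (\int[mu]_(x in `[p, q]) (h x)%:E + (B q - B p)%:E <=
   \int[mu]_(x in `[p, q]) (g x)%:E)%E.
Proof.
move=> pq dB cB' cg ch hBg.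
have I (k : R -> R) : (forall x, x \in `[p, q] -> {for x, continuous k}) ->
    mu.-integrable `[p, q] (EFin \o k).
  move=> ck; apply: continuous_compact_integrable; first exact: segment_compact.
  exact: at_continuous_within.
have ftc : (\int[mu]_(x in `[p, q]) (B' x)%:E = (B q)%:E - (B p)%:E)%E.
  apply: continuous_FTC2 => //.
  - exact: at_continuous_within.
  - split.
    + move=> x xpq; have [] := dB x _ => //.
      by apply: subset_itv_oo_cc.
    + apply/cvg_at_right_filter; apply: (is_derive_continuous (dB p _)).
      by rewrite in_itv/= lexx ltW.
    + apply/cvg_at_left_filter; apply: (is_derive_continuous (dB q _)).
      by rewrite in_itv/= lexx ltW.
  - move=> x xpq; rewrite derive1E.
    by have [_ ->] := dB x (subset_itv_oo_cc xpq).
rewrite EFinB -ftc -integralD_EFin//; [|exact: I|exact: I].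
apply: le_integral => //.
- by apply: (I (h \+ B')) => x xpq; apply: cvgD; [exact: ch|exact: cB'].
- exact: I.
- by move=> x /[!inE] xpq; rewrite lee_fin; exact: hBg.
Qed.

(** Monotone convergence along increasing segments. Only bounds on segments inside the domain are
    then to be proved, away from an end where the derivative of $x^a$ may blow up. *)
Lemma le_integral_exhaustion (D : set R) (p q : R^nat) (h : R -> \bar R) (C : \bar R) :
  {homo p : m n / (m <= n)%N >-> n <= m} -> {homo q : m n / (m <= n)%N >-> m <= n} ->
  D = \bigcup_n `[p n, q n]%classic -> measurable_fun setT h ->
  (forall x, D x -> 0 <= h x)%E ->
  (forall n, \int[mu]_(x in `[p n, q n]) h x <= C)%E ->
  (\int[mu]_(x in D) h x <= C)%E.
Proof.
move=> pd qi DE mh h0 hC.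
have cv : (\int[mu]_(x in `[p n, q n]%classic) h x)%E @[n --> \oo] -->
    (\int[mu]_(x in \bigcup_n `[p n, q n]%classic) h x)%E.
  apply: ge0_nondecreasing_set_cvg_integral => //.
  - move=> m n mn; apply/subsetPset => x /=; rewrite !in_itv/= => /andP[a b].
    by rewrite (le_trans (pd _ _ mn) a) (le_trans b (qi _ _ mn)).
  - by move=> i; exact: measurable_funTS.
  - by move=> i x xi; apply: h0; rewrite DE; exists i.
rewrite DE -(cvg_lim _ cv)//; apply: lime_le => //.
  by apply/cvg_ex; eexists; exact: cv.
by near=> n; exact: hC.
Unshelve. all: by end_near. Qed.

Let inv_homo (c : R) : 0 <= c -> {homo (fun n => c / n.+1%:R) : m n / (m <= n)%N >-> n <= m}.
Proof.
by move=> c0 m n mn; rewrite ler_wpM2l// lef_pV2 ?posrE// ler_nat ltnS.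
Qed.

Let small (x : R) : 0 < x -> exists n, n.+1%:R^-1 <= x.
Proof.
move=> x0; exists (Num.truncn x^-1).
rewrite invf_ple ?posrE// ltW// truncnS_gt// ?invr_ge0 ?ltW//.
Qed.

Let large (x : R) : exists n, x <= n%:R.
Proof. by exists (Num.truncn `|x|).+1; rewrite (le_trans (ler_norm _))// ltW// truncnS_gt. Qed.

Lemma le_integral_gt (c : R) (h : R -> \bar R) (C : \bar R) :
  measurable_fun setT h -> (forall x, c < x -> (0 <= h x)%E) ->
  (forall p q, c < p -> p < q -> (\int[mu]_(x in `[p, q]) h x <= C)%E) ->
  (\int[mu]_(x in `]c, +oo[) h x <= C)%E.
Proof.
move=> mh h0 hC.
apply: (@le_integral_exhaustion _ (fun n => c + 1 / n.+1%:R)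
  (fun n => c + n.+2%:R)) => //.
- by move=> m n mn; rewrite lerD2l inv_homo.
- by move=> m n mn; rewrite lerD2l ler_nat !ltnS.
- apply/seteqP; split=> x /=; rewrite in_itv/= andbT.
    move=> cx; have [n nx] : exists n, n.+1%:R^-1 <= x - c.
      by apply: small; rewrite subr_gt0.
    have [m mx] := large (x - c).
    exists (maxn n m) => //=; rewrite in_itv/=; apply/andP; split.
      rewrite -lerBrDl (le_trans _ nx)// div1r.
      by rewrite lef_pV2 ?posrE// ler_nat ltnS leq_maxl.
    rewrite -lerBlDl (le_trans mx)// ler_nat.
    by rewrite (leq_trans (leq_maxr n m))// leqW.
  move=> [n _]/=; rewrite in_itv/= => /andP[+ _]; apply: lt_le_trans.
  by rewrite ltrDl divr_gt0.
- by move=> x /=; rewrite in_itv/= andbT; exact: h0.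
- move=> n; apply: hC; first by rewrite ltrDl divr_gt0.
  rewrite ltrD2l ltr_pdivrMr// -natrM ltr1n.
  by rewrite (@leq_trans n.+2)// leq_pmulr.
Qed.

Lemma le_integral_lt (c : R) (h : R -> \bar R) (C : \bar R) :
  measurable_fun setT h -> (forall x, x < c -> (0 <= h x)%E) ->
  (forall p q, p < q -> q < c -> (\int[mu]_(x in `[p, q]) h x <= C)%E) ->
  (\int[mu]_(x in `]-oo, c[) h x <= C)%E.
Proof.
move=> mh h0 hC.
apply: (@le_integral_exhaustion _ (fun n => c - n.+2%:R)
  (fun n => c - 1 / n.+1%:R)) => //.
- by move=> m n mn; rewrite lerD2l lerN2 ler_nat !ltnS.
- by move=> m n mn; rewrite lerD2l lerN2 inv_homo.
- apply/seteqP; split=> x /=; rewrite in_itv/=.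
    move=> cx; have [n nx] : exists n, n.+1%:R^-1 <= c - x.
      by apply: small; rewrite subr_gt0.
    have [m mx] := large (c - x).
    exists (maxn n m) => //=; rewrite in_itv/=; apply/andP; split.
      rewrite lerBlDl -lerBlDr (le_trans mx)// ler_nat.
      by rewrite (leq_trans (leq_maxr n m))// leqW.
    rewrite lerBrDr -lerBrDl (le_trans _ nx)// div1r.
    by rewrite lef_pV2 ?posrE// ler_nat ltnS leq_maxl.
  move=> [n _]/=; rewrite in_itv/= => /andP[_ +]; move=> /le_lt_trans; apply.
  by rewrite ltrBlDr ltrDl divr_gt0.
- move=> n; apply: hC; last by rewrite ltrBlDr ltrDl divr_gt0.
  rewrite ltrD2l ltrN2 ltr_pdivrMr// -natrM ltr1n.
  by rewrite (@leq_trans n.+2)// leq_pmulr.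
Qed.

Lemma le_integral_oo (c : R) (h : R -> \bar R) (C : \bar R) : 0 < c ->
  measurable_fun setT h -> (forall x, 0 < x -> x < c -> (0 <= h x)%E) ->
  (forall p q, 0 < p -> p < q -> q < c -> (\int[mu]_(x in `[p, q]) h x <= C)%E) ->
  (\int[mu]_(x in `]0%R, c[) h x <= C)%E.
Proof.
move=> c0 mh h0 hC.
(* The shift to [n.+3] puts the two endpoints strictly in order from [n = 0] on, where they are
   [c / 3] and [2 c / 3]. *)
have s3 n : c / n.+3%:R < c - c / n.+3%:R.
  have n2 : (2 : R) < n.+3%:R by rewrite ltr_nat.
  by rewrite ltrBrDr -mulrDl ltr_pdivrMr//; nra.
apply: (@le_integral_exhaustion _ (fun n => c / n.+3%:R)
  (fun n => c - c / n.+3%:R)) => //.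
- by move=> m n mn; rewrite ler_pM2l// lef_pV2 ?posrE// ler_nat !ltnS.
- move=> m n mn; rewrite lerD2l lerN2.
  by rewrite ler_pM2l// lef_pV2 ?posrE// ler_nat !ltnS.
- apply/seteqP; split=> x /=; rewrite in_itv/=.
    move=> /andP[x0 xc]; have [n nx] : exists n, n.+1%:R^-1 <= x / c.
      by apply: small; rewrite divr_gt0.
    have [m mx] : exists n, n.+1%:R^-1 <= (c - x) / c.
      by apply: small; rewrite divr_gt0// subr_gt0.
    exists (maxn n m) => //=; rewrite in_itv/=; apply/andP; split.
      rewrite mulrC -ler_pdivlMr// (le_trans _ nx)//.
      by rewrite lef_pV2 ?posrE// ler_nat !ltnS (leq_trans (leq_maxl n m))// leqW.
    rewrite lerBrDr -lerBrDl mulrC -ler_pdivlMr// (le_trans _ mx)//.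
    by rewrite lef_pV2 ?posrE// ler_nat !ltnS (leq_trans (leq_maxr n m))// leqW.
  move=> [n _]/=; rewrite in_itv/= => /andP[a b]; apply/andP; split.
    by apply: lt_le_trans a; rewrite divr_gt0.
  by apply: le_lt_trans b _; rewrite ltrBlDr ltrDl divr_gt0.
- by move=> x /=; rewrite in_itv/= => /andP[a b]; exact: h0.
- move=> n; apply: hC => //; first by rewrite divr_gt0.
  by rewrite ltrBlDr ltrDl divr_gt0.
Qed.

Lemma le_integralT (h : R -> \bar R) (C : \bar R) :
  measurable_fun setT h -> (forall x, 0 <= h x)%E ->
  (forall p q, p < q -> (\int[mu]_(x in `[p, q]) h x <= C)%E) ->
  (\int[mu]_x h x <= C)%E.
Proof.
move=> mh h0 hC.
apply: (@le_integral_exhaustion _ (fun n => - n.+1%:R) (fun n => n.+1%:R)) => //.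
- by move=> m n mn; rewrite lerN2 ler_nat.
- by move=> m n mn; rewrite ler_nat.
- apply/seteqP; split=> x //= _; have [m mx] := large `|x|.
  exists m => //=; rewrite in_itv/= -ler_norml (le_trans mx)//.
  by rewrite ler_nat.
- by move=> n; apply: hC; rewrite gtrN.
Qed.

End one_variable.

(** * The one-variable density $x^a e^{-b x^2}$ and its spectral gap *)

Section weights.
Context (R : realType).
Notation mu := (@lebesgue_measure R).
Implicit Types (a b x : R).

(** One factor of [Rstar]: the open half-line when [0 < a], the whole line otherwise. With both
    cases under one name, weighted and free coordinates are treated together. *)
Definition dom a : set R := [set x | 0 < a -> 0 < x].

Definition gauss b x : R := expR (- (b * x ^+ 2)).

Definition rho a b x : R := x `^ a * gauss b x.

Lemma measurable_dom a : measurable (dom a).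
Proof.
rewrite /dom; have [a0|a0] := ltP 0 a.
  rewrite (_ : [set _ | _] = `]0, +oo[%classic)//.
  by apply/seteqP; split=> x /=; rewrite in_itv/= andbT => // /(_ isT).
rewrite (_ : [set _ | _] = setT)//.
by apply/seteqP; split.
Qed.

Lemma gauss_gt0 b x : 0 < gauss b x. Proof. exact: expR_gt0. Qed.

Lemma powR_dom_gt0 a x : 0 <= a -> dom a x -> 0 < x `^ a.
Proof.
rewrite le_eqVlt => /predU1P[<- _|a0 /(_ a0)]; first by rewrite powRr0.
exact: powR_gt0.
Qed.

Lemma rho_gt0 a b x : 0 <= a -> dom a x -> 0 < rho a b x.
Proof. by move=> a0 ax; rewrite mulr_gt0 ?gauss_gt0// powR_dom_gt0. Qed.

Lemma rho_ge0 a b x : 0 <= rho a b x.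
Proof. by rewrite mulr_ge0 ?powR_ge0// ltW ?gauss_gt0. Qed.

Lemma is_derive_powR_dom a x : 0 <= a -> dom a x ->
  is_derive (x : R) (1 : R) (@powR R ^~ a) (a / x * x `^ a).
Proof.
rewrite le_eqVlt => /predU1P[<- _|a0 /(_ a0) x0].
  rewrite !mul0r (_ : @powR R ^~ 0 = cst 1); first exact: is_derive_cst.
  by apply/funext => y; rewrite powRr0.
rewrite (_ : _ * _ = a * x `^ (a - 1)); first exact: is_derive1_powR.
rewrite powRB; last by rewrite (gt_eqF x0) implybT.
by rewrite powRr1 ?ltW// mulrA mulrAC.
Qed.

Lemma is_derive_gauss b x :
  is_derive (x : R) (1 : R) (gauss b) (- (2 * b * x) * gauss b x).
Proof.
rewrite /gauss.
have h : is_derive (x : R) (1 : R) (fun x : R => - (b * x ^+ 2)) (- (2 * b * x)).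
  apply: is_derive_eq; rewrite !scaler1 /GRing.scale/=; ring.
have := is_derive1_comp (is_derive_expR _) h.
by rewrite mulrC.
Qed.

Lemma is_derive_rho a b x : 0 <= a -> dom a x ->
  is_derive (x : R) (1 : R) (rho a b) ((a / x - 2 * b * x) * rho a b x).
Proof.
move=> a0 ax; have d1 := is_derive_powR_dom a0 ax.
have d2 := is_derive_gauss b x.
apply: (@is_derive_eq _ _ _ _ _ _ _ _ (is_deriveM d1 d2)).
rewrite /rho /GRing.scale/=; ring.
Qed.

Lemma dom_neq0 a x : 0 < a -> dom a x -> x != 0.
Proof. by move=> a0 /(_ a0) /lt0r_neq0. Qed.

Lemma continuous_adivx a x : 0 <= a -> dom a x ->
  {for x, continuous (fun x : R => a / x)}.
Proof.
rewrite le_eqVlt => /predU1P[<- _|a0 ax].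
  rewrite (_ : (fun x : R => 0 / x) = cst 0); first exact: cst_continuous.
  by apply/funext => y; rewrite mul0r.
apply: cvgM; first exact: cvg_cst.
by apply: cvgV; [exact: dom_neq0 ax|exact: cvg_id].
Qed.

Lemma measurable_rho a b : measurable_fun setT (rho a b).
Proof.
apply: measurable_funM; first exact: measurable_powR.
apply: continuous_measurable_fun => x.
exact: is_derive_continuous (is_derive_gauss b x).
Qed.

Lemma dom_itv a : 0 <= a -> forall p q x, dom a p -> x \in `[p, q] -> dom a x.
Proof.
move=> a0 p q x dp; rewrite in_itv/= => /andP[px _] ap.
exact: lt_le_trans (dp ap) px.
Qed.

Section poincare.
Variables (a b : R) (f f' : R -> R).
Hypotheses (a0 : 0 <= a) (b0 : 0 < b).
Hypothesis df : forall x, is_derive (x : R) (1 : R) f (f' x).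
Hypothesis cf' : continuous f'.

(* the positive zero of the logarithmic derivative of [rho a b] *)
Definition rho_top : R := Num.sqrt (a / (2 * b)).

Let x0 : R := rho_top.
Let phi x := f x - f x0.
Let h x := 2 * b * phi x ^+ 2 * rho a b x.
Let g x := f' x ^+ 2 * rho a b x.
Let B x := phi x ^+ 2 * rho a b x / (x - x0).
Let B' x := (2 * phi x * f' x + phi x ^+ 2 * (a / x - 2 * b * x)
  - phi x ^+ 2 / (x - x0)) * rho a b x / (x - x0).

Let x0E : a = 2 * b * x0 ^+ 2.
Proof.
rewrite /x0 /rho_top sqr_sqrtr; first by field; rewrite gt_eqF.
by rewrite divr_ge0// mulr_ge0// ltW.
Qed.

Let x0_ge0 : 0 <= x0. Proof. exact: sqrtr_ge0. Qed.

Lemma rho_top_dom : dom a x0.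
Proof. by move=> a1; rewrite sqrtr_gt0 divr_gt0// mulr_gt0. Qed.

(** The origin of the constant [2 b]. The logarithmic derivative of the density vanishes at [x0],
    where [a = 2 b x0 ^ 2], and its slope seen from [x0] is exactly [- 2 b (1 + x0 / x)]. *)
Let key x : dom a x -> x != x0 -> (a / x - 2 * b * x) / (x - x0) <= - (2 * b).
Proof.
move=> ax xx0; have xn0 : x != 0.
  move: a0; rewrite le_eqVlt => /predU1P[a00|/dom_neq0]; last exact.
  by move: xx0; rewrite /x0 /rho_top -a00 mul0r sqrtr0.
have -> : (a / x - 2 * b * x) / (x - x0) = - (2 * b) - 2 * b * (x0 / x).
  by rewrite x0E; field; rewrite xn0 subr_eq0 xx0.
have xx : 0 <= x0 / x; last first.
  by rewrite gerBl; apply: mulr_ge0 => //; rewrite mulr_ge0// ltW.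
move: a0; rewrite le_eqVlt => /predU1P[a00|a1].
  by rewrite /x0 /rho_top -a00 mul0r sqrtr0 mul0r.
by rewrite divr_ge0// ltW// ax.
Qed.

Let cf : continuous f.
Proof. by move=> x; exact: is_derive_continuous (df x). Qed.

Let cphi : continuous phi.
Proof. by move=> x; apply: cvgB; [exact: cf|exact: cvg_cst]. Qed.

Let crho x : dom a x -> {for x, continuous (rho a b)}.
Proof. by move=> ax; exact: is_derive_continuous (is_derive_rho b a0 ax). Qed.

(** The defect is the sum of [(f' - phi / (x - x0)) ^ 2] and of [phi ^ 2] times the slack in [key],
    multiplied by the density. *)
Let hB'g x : dom a x -> x != x0 -> h x + B' x <= g x.
Proof.
move=> ax xx0; have := key ax xx0.
rewrite /h /g /B'; set k := (_ - 2 * b * x); set p := x - x0.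
have p0 : p != 0 by rewrite subr_eq0.
move=> kp; rewrite -subr_ge0.
have -> : f' x ^+ 2 * rho a b x - (2 * b * phi x ^+ 2 * rho a b x +
    (2 * phi x * f' x + phi x ^+ 2 * k - phi x ^+ 2 / p) * rho a b x / p) =
  ((f' x - phi x / p) ^+ 2 + phi x ^+ 2 * (- (2 * b) - k / p)) * rho a b x.
  by field.
by rewrite mulr_ge0 ?rho_ge0// addr_ge0 ?sqr_ge0// mulr_ge0 ?sqr_ge0// subr_ge0.
Qed.

Let dB x : dom a x -> x != x0 -> is_derive (x : R) (1 : R) B (B' x).
Proof.
move=> ax xx0; have d1 := is_derive_rho b a0 ax; have d2 := df x.
have p0 : x - x0 != 0 by rewrite subr_eq0.
have d3 : is_derive (x : R) (1 : R) phi (f' x).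
  by apply: is_derive_eq; rewrite subr0.
have d4 : is_derive (x : R) (1 : R) (fun x : R => (x - x0)^-1) (- (x - x0) ^- 2).
  have d5 : is_derive (x : R) (1 : R) (fun x : R => x - x0) 1.
    by apply: is_derive_eq; rewrite subr0.
  have := @is_deriveV _ (fun x : R => x - x0) x 1 1 p0 d5.
  by rewrite /GRing.scale/= mulr1.
rewrite /B; apply: is_derive_eq.
by rewrite /B' /GRing.scale/= /phi; set k := a / x; field.
Qed.

Lemma poincare_segment p q : p < q -> dom a p -> x0 \notin `[p, q] ->
  (\int[mu]_(x in `[p, q]) (h x)%:E + (B q - B p)%:E <=
   \int[mu]_(x in `[p, q]) (g x)%:E)%E.
Proof.
move=> pq ap x0pq.
have N x : x \in `[p, q] -> x != x0.
  by move=> xpq; apply: contraNneq x0pq => <-.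
have D x : x \in `[p, q] -> dom a x by exact: dom_itv.
have C x : x \in `[p, q] -> {for x, continuous (fun x => (x - x0)^-1)}.
  move=> xpq; apply: cvgV; first by rewrite subr_eq0 N.
  by apply: cvgB; [exact: cvg_id|exact: cvg_cst].
have C2 x : {for x, continuous (fun x => phi x ^+ 2)}.
  by apply: (@cvg_comp _ _ _ phi (fun x => x ^+ 2)); [exact: cphi|exact: exprn_continuous].
apply: (@ftc_le R g h B B' p q pq).
- by move=> x xpq; apply: dB; [exact: D|exact: N].
- move=> x xpq; apply: cvgM; last exact: C.
  apply: cvgM; last exact: crho (D x xpq).
  apply: cvgB.
    apply: cvgD.
      apply: cvgM; last exact: cf'.
      by apply: cvgM; [exact: cvg_cst|exact: cphi].
    apply: cvgM; first exact: C2.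
    apply: cvgB; first exact: continuous_adivx (D x xpq).
    by apply: cvgM; [exact: cvg_cst|exact: cvg_id].
  by apply: cvgM; [exact: C2|exact: C].
- move=> x xpq; apply: cvgM; last exact: crho (D x xpq).
  by apply: (@cvg_comp _ _ _ f' (fun x => x ^+ 2)); [exact: cf'|exact: exprn_continuous].
- move=> x xpq; apply: cvgM; last exact: crho (D x xpq).
  by apply: cvgM; [exact: cvg_cst|exact: C2].
- by move=> x xpq; apply: hB'g; [exact: D|exact: N].
Qed.

(** [B] is the product of a difference quotient of [f] at [x0], which converges, of [phi], which
    tends to [0], and of the continuous density. Its singularity at the mode thus leaves no boundary
    term. *)
Let B_small (e : R) : 0 < e -> exists2 d : R, 0 < d &
  forall x, x != x0 -> `|x - x0| < d -> `|B x| <= e.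
Proof.
move=> e0.
have [+ dE] := df x0; rewrite /derivable => cv.
have l1 : (fun t : R => t^-1 *: (f (t *: (1 : R) + x0) - f x0)) @ 0^' --> f' x0.
  by rewrite -dE; exact: cv.
have l0 : (fun t : R => t *: (1 : R) + x0) @ 0^' --> x0.
  have ct : continuous (fun t : R => t *: (1 : R) + x0).
    move=> t; apply: cvgD; last exact: cvg_cst.
    by apply: cvgZr_tmp; exact: cvg_id.
  apply: cvg_within_filter; have := ct 0.
  by rewrite /continuous_at/= scale0r add0r.
have l2 : (fun t : R => f (t *: (1 : R) + x0) - f x0) @ 0^' --> (0 : R).
  rewrite -[X in _ --> X](subrr (f x0)); apply: cvgB; last exact: cvg_cst.
  exact: (cvg_comp _ _ l0 (@cf x0)).
have l3 : (fun t : R => rho a b (t *: (1 : R) + x0)) @ 0^' --> rho a b x0.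
  exact: (cvg_comp _ _ l0 (crho rho_top_dom)).
have l4 : (fun t : R => t^-1 *: (f (t *: (1 : R) + x0) - f x0) *
    (f (t *: (1 : R) + x0) - f x0) * rho a b (t *: (1 : R) + x0)) @ 0^' --> f' x0 * 0 * rho a b x0.
  by apply: cvgM l3; exact: cvgM l1 l2.
rewrite mulr0 mul0r in l4.
have /cvgrPdist_le /(_ e e0) [d /= d0 H] := l4.
exists d => // x xx0 xd.
have := H (x - x0); rewrite /= sub0r normrN => /(_ xd).
rewrite subr_eq0 => /(_ xx0); rewrite sub0r normrN.
rewrite /GRing.scale/= mulr1 subrK; congr (`| _ | <= _).
by rewrite /B -/(phi x); field; rewrite subr_eq0.
Qed.

Let mh : measurable_fun setT (fun x => (h x)%:E).
Proof.
apply/measurable_EFinP; apply: measurable_funM; last exact: measurable_rho.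
apply: measurable_funM => //; apply: measurable_funX.
exact: continuous_measurable_fun.
Qed.

Let mg : measurable_fun setT (fun x => (g x)%:E).
Proof.
apply/measurable_EFinP; apply: measurable_funM; last exact: measurable_rho.
by apply: measurable_funX; exact: continuous_measurable_fun.
Qed.

Let h0 x : (0 <= (h x)%:E)%E.
Proof.
rewrite lee_fin; apply: mulr_ge0; last exact: rho_ge0.
by apply: mulr_ge0; [rewrite mulr_ge0// ltW|exact: sqr_ge0].
Qed.

Let g0 x : (0 <= (g x)%:E)%E.
Proof. by rewrite lee_fin; apply: mulr_ge0; [exact: sqr_ge0|exact: rho_ge0]. Qed.

Let sub_int (k : R -> R) (D E : set R) : measurable D -> measurable E ->
  measurable_fun setT (fun x => (k x)%:E) -> (forall x, (0 <= (k x)%:E)%E) ->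
  D `<=` E -> (\int[mu]_(x in D) (k x)%:E <= \int[mu]_(x in E) (k x)%:E)%E.
Proof. by move=> mD mE mk k0 DE; apply: ge0_subset_integral => //; exact: measurable_funTS. Qed.

(** No decay at infinity is involved: the boundary term at [q] is dropped for its sign, and the one
    near the mode is at most [e] once the segment is extended close to [x0]. *)
Let poincare_right :
  (\int[mu]_(x in `]x0, +oo[) (h x)%:E <= \int[mu]_(x in `]x0, +oo[) (g x)%:E)%E.
Proof.
apply: le_integral_gt => [|x _|p q x0p pq]; [exact: mh|exact: h0|].
apply/lee_addgt0Pr => e e0.
have [d d0 Bd] := B_small e0.
pose p' := Num.min p (x0 + d / 2).
have x0p' : x0 < p' by rewrite lt_min x0p ltrDl divr_gt0.
have p'p : p' <= p by rewrite ge_min lexx.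
have p'q : p' < q by exact: le_lt_trans pq.
have ap' : dom a p' by move=> a1; exact: lt_trans (rho_top_dom a1) x0p'.
have Bp' : `|B p'| <= e.
  apply: Bd; first by rewrite gt_eqF.
  rewrite gtr0_norm ?subr_gt0// ltrBlDl.
  apply: (@le_lt_trans _ _ (x0 + d / 2)); first by rewrite ge_min lexx orbT.
  by rewrite ltrD2l ltr_pdivrMr// ltr_pMr// ltr1n.
have Bq : 0 <= B q.
  apply: mulr_ge0; first by apply: mulr_ge0; [exact: sqr_ge0|exact: rho_ge0].
  by rewrite invr_ge0 subr_ge0 ltW// (lt_trans x0p).
have := poincare_segment p'q ap'; rewrite in_itv/= leNgt x0p'/= => /(_ isT) H.
apply: (@le_trans _ _ (\int[mu]_(x in `[p', q]) (h x)%:E)%E).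
  apply: sub_int => // x /=; rewrite !in_itv/= => /andP[px ->].
  by rewrite (le_trans p'p).
apply: (@le_trans _ _ (\int[mu]_(x in `[p', q]) (h x)%:E + (B q - B p')%:E + e%:E)%E).
  rewrite -addeA leeDl// -EFinD lee_fin.
  by move: Bp'; rewrite ler_norml => /andP[_]; lra.
rewrite leeD2r// (le_trans H)//.
apply: sub_int => // x /=; rewrite !in_itv/= andbT => /andP[+ _].
exact: lt_le_trans.
Qed.

(** The mirror image of the right side, the boundary term at [p] now being nonpositive. [D] is left
    free because the part of the domain below the mode is a half-line or a bounded interval
    according to [a]. *)
Let poincare_left (D : set R) : measurable D -> forall p q, p < q -> dom a p -> q < x0 ->
  (forall x, p <= x -> x < x0 -> D x) ->
  (\int[mu]_(x in `[p, q]) (h x)%:E <= \int[mu]_(x in D) (g x)%:E)%E.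
Proof.
move=> mD p q pq ap qx0 pD; apply/lee_addgt0Pr => e e0.
have [d d0 Bd] := B_small e0.
pose q' := Num.max q (x0 - d / 2).
have q'x0 : q' < x0 by rewrite gt_max qx0 ltrBlDr ltrDl divr_gt0.
have qq' : q <= q' by rewrite le_max lexx.
have pq' : p < q' by exact: lt_le_trans qq'.
have Bq' : `|B q'| <= e.
  apply: Bd; first by rewrite lt_eqF.
  rewrite ltr0_norm ?subr_lt0// opprB ltrBlDl -ltrBlDr.
  apply: (@lt_le_trans _ _ (x0 - d / 2)); last by rewrite le_max lexx orbT.
  by rewrite ltrD2l ltrN2 ltr_pdivrMr// ltr_pMr// ltr1n.
have Bp : B p <= 0.
  apply: mulr_ge0_le0; first by apply: mulr_ge0; [exact: sqr_ge0|exact: rho_ge0].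
  by rewrite invr_le0 subr_le0 ltW// (lt_trans pq).
have := poincare_segment pq' ap; rewrite in_itv/= [x0 <= _]leNgt q'x0 andbF => /(_ isT) H.
apply: (@le_trans _ _ (\int[mu]_(x in `[p, q']) (h x)%:E)%E).
  apply: sub_int => // x /=; rewrite !in_itv/= => /andP[-> xq].
  by rewrite (le_trans xq).
apply: (@le_trans _ _ (\int[mu]_(x in `[p, q']) (h x)%:E + (B q' - B p)%:E + e%:E)%E).
  rewrite -addeA leeDl// -EFinD lee_fin.
  by move: Bq'; rewrite ler_norml => /andP[+ _]; lra.
rewrite leeD2r// (le_trans H)//.
apply: sub_int => // x /=; rewrite !in_itv/= => /andP[px xq'].
by apply: pD => //; exact: le_lt_trans q'x0.
Qed.

(* Integrate [phi'^2 rho >= 2 b phi^2 rho + (phi^2 rho / (x - x0))'], which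
   expands [(phi' - phi / (x - x0))^2 >= 0], on each side of [x0]. *)
Lemma poincare_dom :
  (\int[mu]_(x in dom a) (2 * b * (f x - f rho_top) ^+ 2 * rho a b x)%:E <=
   \int[mu]_(x in dom a) (f' x ^+ 2 * rho a b x)%:E)%E.
Proof.
pose L : set R := [set x | dom a x /\ x < x0].
have mL : measurable L.
  rewrite (_ : L = dom a `&` `]-oo, x0[%classic); last first.
    by apply/seteqP; split=> x /=; rewrite in_itv.
  by apply: measurableI => //; exact: measurable_dom.
have domE : dom a = L `|` `[x0, +oo[%classic.
  apply/seteqP; split=> x /=; rewrite in_itv/= andbT.
    by move=> ax; have [|] := leP x0 x; [right|left].
  by move=> [[]//|x0x a1]; exact: lt_le_trans (rho_top_dom a1) x0x.
have dj : [disjoint L & `[x0, +oo[%classic].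
  apply/disj_set2P; rewrite -subset0 => x [[_ /= xx0]].
  by rewrite /= in_itv/= andbT leNgt xx0.
rewrite domE !ge0_integral_setU//; last 4 first.
- exact: measurable_funTS mg.
- by move=> x _; exact: g0.
- exact: measurable_funTS mh.
- by move=> x _; exact: h0.
apply: leeD; last first.
  rewrite -[leLHS]integral_itv_obnd_cbnd; last exact: measurable_funTS mh.
  rewrite -[leRHS]integral_itv_obnd_cbnd; last exact: measurable_funTS mg.
  exact: poincare_right.
move: (a0); rewrite le_eqVlt => /predU1P[a00|a1].
  have LE : L = `]-oo, x0[%classic.
    apply/seteqP; split=> x /=; rewrite in_itv/=; first by case.
    by split=> //; rewrite /dom/= -a00 ltxx.
  rewrite [in leLHS]LE.
  apply: le_integral_lt => [|x _|p q pq qx0]; [exact: mh|exact: h0|].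
  apply: poincare_left => //.
    by rewrite /dom/= -a00 ltxx.
  by move=> x _ xx0; rewrite LE/= in_itv.
have LE : L = `]0, x0[%classic.
  apply/seteqP; split=> x /=; rewrite in_itv/=; first by move=> [/(_ a1) -> ->].
  by move=> /andP[x1 xx0]; split.
rewrite [in leLHS]LE.
apply: le_integral_oo => [||x _ _|p q p0 pq qx0]; [exact: rho_top_dom|exact: mh|exact: h0|].
 apply: poincare_left => //.
by move=> x px xx0; rewrite LE/= in_itv/= xx0 (lt_le_trans p0).
Qed.

End poincare.

End weights.

(** * Integration by parts against the weight, in both directions *)

Section energy.
Context (R : realType).
Notation mu := (@lebesgue_measure R).
Implicit Types (a b x : R).

Lemma le_integral_dom a (h : R -> \bar R) (C : \bar R) : 0 <= a ->
  measurable_fun setT h -> (forall x, (0 <= h x)%E) ->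
  (forall p q, dom a p -> p < q -> (\int[mu]_(x in `[p, q]) h x <= C)%E) ->
  (\int[mu]_(x in dom a) h x <= C)%E.
Proof.
move=> a0 mh h0 hC; move: (a0); rewrite le_eqVlt => /predU1P[a00|a1].
  have -> : dom a = setT.
    by apply/seteqP; split=> x //= _; rewrite /dom/= -a00 ltxx.
  apply: le_integralT => // p q; apply: hC.
  by rewrite /dom/= -a00 ltxx.
have -> : dom a = `]0, +oo[%classic.
  apply/seteqP; split=> x /=; rewrite in_itv/= andbT; first exact.
  by move=> x0 _.
by apply: le_integral_gt => // p q p0; apply: hC.
Qed.

Section one_function.
Variables (a b : R) (v v' : R -> R).
Hypotheses (a0 : 0 <= a) (b0 : 0 < b).
Hypothesis dv : forall x, is_derive (x : R) (1 : R) v (v' x).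
Hypothesis cv' : continuous v'.

Let w x := x `^ a.
(** [v' + b x v] is $e^{-bx^2/2}$ times the derivative of $v e^{bx^2/2}$. The cross term of its
    square and the term in [b (1 + a)] add up to the derivative of [B], whose factor [x] makes it
    vanish on the face [x = 0]. *)
Let H x := ((v' x + b * x * v x) ^+ 2 + b * (1 + a) * v x ^+ 2) * w x.
Let G x := (v' x ^+ 2 + b ^+ 2 * x ^+ 2 * v x ^+ 2) * w x.
Let B x := b * x * w x * v x ^+ 2.
Let B' x := b * ((1 + a) * v x ^+ 2 + 2 * x * v x * v' x) * w x.

Let HGB x : H x = G x + B' x.
Proof. by rewrite /H /G /B'; ring. Qed.

Let cv : continuous v.
Proof. by move=> x; exact: is_derive_continuous (dv x). Qed.

Let cw x : dom a x -> {for x, continuous w}.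
Proof. by move=> ax; exact: is_derive_continuous (is_derive_powR_dom a0 ax). Qed.

Let dB x : dom a x -> is_derive (x : R) (1 : R) B (B' x).
Proof.
move=> ax; have d1 := is_derive_powR_dom a0 ax; have d2 := dv x.
rewrite /B; apply: is_derive_eq.
rewrite /B' /GRing.scale/= /w.
have xax : x * (a / x) = a.
  move: a0; rewrite le_eqVlt => /predU1P[<-|/dom_neq0/(_ ax) xn0].
    by rewrite mul0r mulr0.
  by rewrite mulrC divfK.
move: (x `^ a) xax => P xax; move: (a / x) xax => k <-; ring.
Qed.

Let csq (k : R -> R) : continuous k -> continuous (fun x => k x ^+ 2).
Proof. by move=> ck x; apply: (@cvg_comp _ _ _ k (fun x => x ^+ 2)); [exact: ck|exact: exprn_continuous]. Qed.

Let cid : continuous (fun x : R => x). Proof. by move=> x; exact: cvg_id. Qed.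

Let cG x : dom a x -> {for x, continuous G}.
Proof.
move=> ax; apply: cvgM; last exact: cw.
apply: cvgD; first exact: csq.
apply: cvgM; last exact: csq.
by apply: cvgM; [exact: cvg_cst|exact: csq].
Qed.

Let cB' x : dom a x -> {for x, continuous B'}.
Proof.
move=> ax; apply: cvgM; last exact: cw.
apply: cvgM; first exact: cvg_cst.
apply: cvgD; first by apply: cvgM; [exact: cvg_cst|exact: csq].
apply: cvgM; last exact: cv'.
by apply: cvgM; [apply: cvgM; [exact: cvg_cst|exact: cvg_id]|exact: cv].
Qed.

Let cH x : dom a x -> {for x, continuous H}.
Proof.
move=> ax; rewrite (_ : H = G \+ B'); last by apply/funext => y; exact: HGB.
by apply: cvgD; [exact: cG|exact: cB'].
Qed.

Let seg1 p q : p < q -> dom a p ->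
  (\int[mu]_(x in `[p, q]) (H x)%:E + (B p - B q)%:E <=
   \int[mu]_(x in `[p, q]) (G x)%:E)%E.
Proof.
move=> pq ap.
have D x : x \in `[p, q] -> dom a x by exact: dom_itv.
rewrite (_ : B p - B q = - B q - - B p); last by ring.
apply: (@ftc_le R G H (fun x => - B x) (fun x => - B' x) p q pq).
- move=> x /D ax; apply: (@is_deriveN _ _ _ B); exact: dB.
- by move=> x /D ax; apply: cvgN; exact: cB'.
- by move=> x /D; exact: cG.
- by move=> x /D; exact: cH.
- by move=> x _; rewrite HGB addrK.
Qed.

Let seg2 p q : p < q -> dom a p ->
  (\int[mu]_(x in `[p, q]) (G x)%:E + (B q - B p)%:E <=
   \int[mu]_(x in `[p, q]) (H x)%:E)%E.
Proof.
move=> pq ap.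
have D x : x \in `[p, q] -> dom a x by exact: dom_itv.
apply: (@ftc_le R H G B B' p q pq).
- by move=> x /D ax; exact: dB.
- by move=> x /D; exact: cB'.
- by move=> x /D; exact: cH.
- by move=> x /D; exact: cG.
- by move=> x _; rewrite HGB.
Qed.

Let H0 x : (0 <= (H x)%:E)%E.
Proof.
rewrite lee_fin; apply: mulr_ge0; last exact: powR_ge0.
by rewrite addr_ge0 ?sqr_ge0// mulr_ge0 ?sqr_ge0// mulr_ge0 ?addr_ge0// ltW.
Qed.

Let G0 x : (0 <= (G x)%:E)%E.
Proof.
rewrite lee_fin; apply: mulr_ge0; last exact: powR_ge0.
by rewrite addr_ge0 ?sqr_ge0// mulr_ge0 ?sqr_ge0// mulr_ge0 ?sqr_ge0.
Qed.

Let mv : measurable_fun setT v. Proof. exact: continuous_measurable_fun. Qed.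
Let mv' : measurable_fun setT v'. Proof. exact: continuous_measurable_fun. Qed.

Let mG : measurable_fun setT (fun x => (G x)%:E).
Proof.
apply/measurable_EFinP; apply: measurable_funM; last exact: measurable_powR.
apply: measurable_funD; first exact: measurable_funX.
apply: measurable_funM; last exact: measurable_funX.
by apply: measurable_funM => //; exact: measurable_funX.
Qed.

Let mH : measurable_fun setT (fun x => (H x)%:E).
Proof.
apply/measurable_EFinP; apply: measurable_funM; last exact: measurable_powR.
apply: measurable_funD; last first.
  by apply: measurable_funM => //; exact: measurable_funX.
apply: measurable_funX; apply: measurable_funD => //.
by apply: measurable_funM => //; exact: measurable_funM.
Qed.

Let sub_int (k : R -> R) (D E : set R) : measurable D -> measurable E ->
  measurable_fun setT (fun x => (k x)%:E) -> (forall x, (0 <= (k x)%:E)%E) ->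
  D `<=` E -> (\int[mu]_(x in D) (k x)%:E <= \int[mu]_(x in E) (k x)%:E)%E.
Proof. by move=> mD mE mk k0 DE; apply: ge0_subset_integral => //; exact: measurable_funTS. Qed.

Let itv_le (p q p' q' : R) : p' <= p -> q <= q' -> `[p, q]%classic `<=` `[p', q']%classic.
Proof.
move=> pp qq x /=; rewrite !in_itv/= => /andP[px xq].
by rewrite (le_trans pp px) (le_trans xq qq).
Qed.

Let itv_dom p q : dom a p -> `[p, q]%classic `<=` dom a.
Proof. by move=> ap x /=; exact: dom_itv. Qed.

(** The upper end is pushed beyond the support, where [B] vanishes. At the lower end [B] vanishes
    for the same reason on the whole line, and is nonnegative on the half-line, which is the right
    sign. *)
Lemma energy_le (T : R) : (forall x, T <= `|x| -> v x = 0) ->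
  (\int[mu]_(x in dom a) (((v' x + b * x * v x) ^+ 2
      + b * (1 + a) * v x ^+ 2) * x `^ a)%:E <=
   \int[mu]_(x in dom a) ((v' x ^+ 2
      + b ^+ 2 * x ^+ 2 * v x ^+ 2) * x `^ a)%:E)%E.
Proof.
move=> vT; apply: le_integral_dom => // p q ap pq.
pose q' := Num.max q T.
have qq' : q <= q' by rewrite le_max lexx.
have Bq' : B q' = 0.
  rewrite /B vT ?expr0n/= ?mulr0// (le_trans _ (ler_norm _))//.
  by rewrite le_max lexx orbT.
have [p' p'p [ap' Bp']] : exists2 p', p' <= p & dom a p' /\ 0 <= B p'.
  move: (a0); rewrite le_eqVlt => /predU1P[a00|a1]; last first.
    exists p => //; split=> //; rewrite /B; apply: mulr_ge0; last exact: sqr_ge0.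
    apply: mulr_ge0; last exact: powR_ge0.
    by apply: mulr_ge0; [exact: ltW|rewrite ltW// ap].
  exists (Num.min p (- T)); first by rewrite ge_min lexx.
  split; first by rewrite /dom/= -a00 ltxx.
  rewrite /B vT ?expr0n/= ?mulr0// -normrN (le_trans _ (ler_norm _))//.
  by rewrite lerNr ge_min lexx orbT.
have p'q' : p' < q' by apply: le_lt_trans p'p _; exact: lt_le_trans qq'.
apply: (@le_trans _ _ (\int[mu]_(x in `[p', q']) (H x)%:E)%E).
  by apply: sub_int => //; exact: itv_le.
apply: (@le_trans _ _ (\int[mu]_(x in `[p', q']) (H x)%:E + (B p' - B q')%:E)%E).
  by rewrite leeDl// Bq' subr0 lee_fin.
apply: le_trans (seg1 p'q' ap') _.
by apply: sub_int => //; [exact: measurable_dom|exact: itv_dom].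
Qed.

(** No support condition: [B] has the sign of [x], so that both boundary terms help on the whole
    line. On the half-line the lower one does not, but it tends to [0] with [x]. *)
Lemma energy_ge :
  (\int[mu]_(x in dom a) ((v' x ^+ 2
      + b ^+ 2 * x ^+ 2 * v x ^+ 2) * x `^ a)%:E <=
   \int[mu]_(x in dom a) (((v' x + b * x * v x) ^+ 2
      + b * (1 + a) * v x ^+ 2) * x `^ a)%:E)%E.
Proof.
apply: le_integral_dom => // p q ap pq.
apply/lee_addgt0Pr => e e0.
pose q' := Num.max q 0.
have qq' : q <= q' by rewrite le_max lexx.
have Bq' : 0 <= B q'.
  rewrite /B; apply: mulr_ge0; last exact: sqr_ge0.
  apply: mulr_ge0; last exact: powR_ge0.
  by apply: mulr_ge0; [exact: ltW|rewrite le_max lexx orbT].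
have [p' p'p [ap' Bp']] : exists2 p', p' <= p & dom a p' /\ B p' <= e.
  move: (a0); rewrite le_eqVlt => /predU1P[a00|a1].
    exists (Num.min p 0); first by rewrite ge_min lexx.
    split; first by rewrite /dom/= -a00 ltxx.
    rewrite (le_trans _ (ltW e0))// /B.
    apply: mulr_le0_ge0; last exact: sqr_ge0.
    apply: mulr_le0_ge0; last exact: powR_ge0.
    apply: mulr_ge0_le0; first exact: ltW.
    by rewrite ge_min lexx orbT.
  have p0 : 0 < p by exact: ap.
  have /cvgrPdist_lt/(_ 1 ltr01)[/= d d0 vd] : (fun x => v x ^+ 2) @ (0 : R) --> v 0 ^+ 2.
    exact: csq.
  pose K := v 0 ^+ 2 + 1.
  have K0 : 0 < K by rewrite ltr_wpDl ?sqr_ge0.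
  (* The bound [1] gives [w p' <= 1], [d / 2] gives [v p' ^+ 2 <= K], and [e / (b * K)] then gives
     [B p' <= e]. *)
  pose p' := Num.min p (Num.min 1 (Num.min (d / 2) (e / (b * K)))).
  have p'0 : 0 < p' by rewrite !lt_min p0 ltr01 !divr_gt0// mulr_gt0.
  exists p'; first by rewrite ge_min lexx.
  split; first by move=> _.
  have p'1 : p' <= 1 by rewrite !ge_min lexx !orbT.
  have p'd : p' <= d / 2 by rewrite !ge_min lexx !orbT.
  have p'e : p' <= e / (b * K) by rewrite !ge_min lexx !orbT.
  have vK : v p' ^+ 2 <= K.
    have := vd p'; rewrite /= sub0r normrN gtr0_norm// => /(_ _)/ltW.
    rewrite ler_distlC => /(_ _)/andP[|//].
    by rewrite (le_lt_trans p'd)// ltr_pdivrMr// ltr_pMr// ltr1n.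
  have wp' : w p' <= 1.
    have := @ge0_ler_powR _ a a0 p' 1; rewrite powR1; apply => //.
    - by rewrite nnegrE ltW.
    - by rewrite nnegrE ler01.
  rewrite /B -mulrA -mulrA.
  rewrite (@le_trans _ _ (b * (e / (b * K) * K)))//.
    rewrite ler_pM2l//; apply: ler_pM => //; first exact: ltW.
      by rewrite mulr_ge0 ?sqr_ge0 ?powR_ge0.
    rewrite (le_trans _ vK)// ler_piMl ?sqr_ge0//.
  by rewrite le_eqVlt; apply/orP; left; apply/eqP; field; rewrite !gt_eqF.
have p'q' : p' < q' by apply: le_lt_trans p'p _; exact: lt_le_trans qq'.
apply: (@le_trans _ _ (\int[mu]_(x in `[p', q']) (G x)%:E)%E).
  by apply: sub_int => //; exact: itv_le.
apply: (@le_trans _ _ (\int[mu]_(x in `[p', q']) (G x)%:E + (B q' - B p')%:E + e%:E)%E).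
  rewrite -addeA leeDl// -EFinD lee_fin; lra.
rewrite leeD2r// (le_trans (seg2 p'q' ap'))//.
by apply: sub_int => //; [exact: measurable_dom|exact: itv_dom].
Qed.

End one_function.
End energy.

(** * The normalized density as a probability *)

Section weighted_probability.
Context (R : realType).
Notation mu := (@lebesgue_measure R).
Implicit Types (a b x : R).

Lemma integral_gauss_lty b : 0 < b -> (\int[mu]_x (gauss b x)%:E < +oo)%E.
Proof.
(* [gauss b] is a multiple of the centred normal density of variance [1 / (2 b)]. *)
move=> b0; pose s := Num.sqrt (2 * b)^-1.
have s2 : s ^+ 2 = (2 * b)^-1.
  by rewrite sqr_sqrtr// invr_ge0 mulr_ge0// ltW.
have s0 : s != 0.
  by rewrite gt_eqF// sqrtr_gt0 invr_gt0 mulr_gt0.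
have pk0 := normal_peak_gt0 s0.
have E x : gauss b x = (normal_peak s)^-1 * normal_pdf 0 s x.
  rewrite normal_pdfE// mulKf ?gt_eqF// /normal_fun /gauss subr0 s2; congr expR.
  by rewrite -mulr_natr; field; rewrite gt_eqF.
under eq_integral do rewrite E EFinM.
rewrite ge0_integralZl//; last 3 first.
- by apply/measurable_EFinP; exact: measurable_normal_pdf.
- by move=> x _; rewrite lee_fin normal_pdf_ge0.
- by rewrite lee_fin invr_ge0 ltW.
by rewrite integral_normal_pdf mule1 ltry.
Qed.

(** First $x^a \le e^{ax}$, as $\ln x \le x$; then half of the Gaussian absorbs $e^{ax}$ by
    completing the square, which produces [a ^+ 2 / (2 * b)]. *)
Lemma rho_le_gauss a b x : 0 <= a -> 0 < b -> dom a x ->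
  rho a b x <= expR (a ^+ 2 / (2 * b)) * gauss (b / 2) x.
Proof.
move=> a0 b0 ax; rewrite /rho /gauss -expRD.
have -> : x `^ a * expR (- (b * x ^+ 2)) =
    x `^ a * expR (- (a * x)) * expR (a * x - b * x ^+ 2).
  by rewrite -mulrA -expRD; congr (_ * expR _); ring.
rewrite -[leRHS]mul1r; apply: ler_pM => //.
- by rewrite mulr_ge0 ?powR_ge0 ?expR_ge0.
- move: a0; rewrite le_eqVlt => /predU1P[<-|a1].
    by rewrite powRr0 mul0r oppr0 expR0 mulr1.
  have x0 : 0 < x by exact: ax.
  rewrite expRN ler_pdivrMr ?expR_gt0// mul1r /powR gt_eqF// ler_expR.
  by rewrite ler_pM2l// (ltW (ln_sublinear _)).
- rewrite ler_expR -subr_ge0.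
  have -> : a ^+ 2 / (2 * b) - b / 2 * x ^+ 2 - (a * x - b * x ^+ 2) =
    (a - b * x) ^+ 2 / (2 * b) by field; rewrite gt_eqF.
  by rewrite divr_ge0 ?sqr_ge0// mulr_ge0// ltW.
Qed.

Lemma integral_rho_lty a b : 0 <= a -> 0 < b ->
  (\int[mu]_(x in dom a) (rho a b x)%:E < +oo)%E.
Proof.
move=> a0 b0; set K := expR (a ^+ 2 / (2 * b)).
have mg : measurable_fun setT (fun x => (gauss (b / 2) x)%:E).
  apply/measurable_EFinP; apply: continuous_measurable_fun => x.
  exact: is_derive_continuous (is_derive_gauss _ x).
have g0 x : (0 <= (gauss (b / 2) x)%:E)%E by rewrite lee_fin ltW// gauss_gt0.
apply: (@le_lt_trans _ _ (\int[mu]_(x in dom a) (K%:E * (gauss (b / 2) x)%:E))%E).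
  apply: ge0_le_integral => //.
  - exact: measurable_dom.
  - by move=> x _; rewrite lee_fin rho_ge0.
  - by apply: measurable_funTS; apply/measurable_EFinP; exact: measurable_rho.
  - by apply: measurable_funTS; exact: measurable_funeM.
  - by move=> x ax; rewrite -EFinM lee_fin rho_le_gauss.
rewrite ge0_integralZl//; last 3 first.
- exact: measurable_dom.
- exact: measurable_funTS.
- by rewrite lee_fin expR_ge0.
rewrite lte_mul_pinfty// ?lee_fin ?expR_ge0//.
apply: le_lt_trans (integral_gauss_lty (_ : 0 < b / 2)); last by rewrite divr_gt0.
by apply: ge0_subset_integral => //; exact: measurable_dom.
Qed.

Lemma integral_rho_gt0 a b : 0 <= a ->
  (0 < \int[mu]_(x in dom a) (rho a b x)%:E)%E.
Proof.
move=> a0; rewrite lt0e; apply/andP; split; last first.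
  by apply: integral_ge0 => x _; rewrite lee_fin rho_ge0.
apply/eqP => I0.
have mr : measurable_fun (dom a) (fun x => (rho a b x)%:E).
  by apply: measurable_funTS; apply/measurable_EFinP; exact: measurable_rho.
have md := @measurable_dom R a.
have /(ae_eq_integral_abs mu md mr) : (\int[mu]_(x in dom a) `|(rho a b x)%:E| = 0)%E.
  by rewrite -[RHS]I0; apply: eq_integral => x _; rewrite gee0_abs// lee_fin rho_ge0.
move=> [N [mN N0 sub]].
(* The segment [[1, 2]] lies in [dom a] for every [a], has measure [1], and the density is positive
   on it. *)
have : (mu `[1%R, 2%R]%classic <= mu N)%E.
  apply: le_measure; rewrite ?inE//.
  move=> x /=; rewrite in_itv/= => /andP[x1 _]; apply: sub => /=.
  have ax : dom a x by move=> _; exact: lt_le_trans x1.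
  by move=> /(_ ax) [] /eqP; rewrite gt_eqF// rho_gt0.
by rewrite [mu N]N0 lebesgue_measure_itv/= lte_fin ltr1n/= -EFinB lee_fin; lra.
Qed.

Definition rhoZ a b : R := fine (\int[mu]_(x in dom a) (rho a b x)%:E)%E.

Lemma rhoZE a b : 0 <= a -> 0 < b ->
  (\int[mu]_(x in dom a) (rho a b x)%:E = (rhoZ a b)%:E)%E.
Proof.
move=> a0 b0; rewrite /rhoZ fineK// ge0_fin_numE ?integral_rho_lty//.
by rewrite ltW// integral_rho_gt0.
Qed.

Lemma rhoZ_gt0 a b : 0 <= a -> 0 < b -> 0 < rhoZ a b.
Proof. by move=> a0 b0; rewrite -lte_fin -rhoZE// integral_rho_gt0. Qed.

Definition rho1 a b x : R := \1_(dom a) x * rho a b x / rhoZ a b.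

Lemma rho1_ge0 a b x : 0 <= a -> 0 < b -> 0 <= rho1 a b x.
Proof.
move=> a0 b0; apply: mulr_ge0; last by rewrite invr_ge0 ltW// rhoZ_gt0.
by rewrite mulr_ge0 ?rho_ge0.
Qed.

Lemma measurable_rho1 a b : measurable_fun setT (rho1 a b).
Proof.
apply: measurable_funM => //; apply: measurable_funM; last exact: measurable_rho.
exact: measurable_indic (measurable_dom a).
Qed.

(* [R] and [measurableTypeR R], which carries [lebesgue_measure], have the same
   measurable sets but different displays, whence the image by the identity. *)
Lemma rho1_probability a b : 0 <= a -> 0 < b ->
  exists P : probability R R,
    forall g : R -> \bar R, measurable_fun setT g -> (forall x, (0 <= g x)%E) ->
    (\int[P]_x g x = \int[mu]_x (g x * (rho1 a b x)%:E))%E.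
Proof.
move=> a0 b0.
have [P PE] : exists P : probability (measurableTypeR R) R,
    forall g : R -> \bar R, measurable_fun setT g -> (forall x, (0 <= g x)%E) ->
    (\int[P]_x g x = \int[mu]_x (g x * (rho1 a b x)%:E))%E; last first.
  have mi : measurable_fun [set: measurableTypeR R] (fun x => x : R) by [].
  pose i : {mfun measurableTypeR R >-> R} :=
    HB.pack (fun x : measurableTypeR R => x : R) (isMeasurableFun.Build _ _ _ _ _ mi).
  exists (distribution P i) => g mg g0.
  rewrite /distribution ge0_integral_pushforward// preimage_setT.
  exact: PE.
apply: density_probability.

- by move=> x; exact: rho1_ge0.
- exact: measurable_rho1.
- have Z0 := rhoZ_gt0 a0 b0.
  transitivity (\int[mu]_(x in dom a) ((rhoZ a b)^-1%:E * (rho a b x)%:E))%E.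
    rewrite [RHS]integral_mkcond; apply: eq_integral => x _.
    rewrite patchE /rho1 indicE; case: ifPn => _; rewrite ?mul0r//.
    by rewrite mul1r -EFinM mulrC.
  rewrite ge0_integralZl//.
  + by rewrite rhoZE// -EFinM mulVf// gt_eqF.
  + exact: measurable_dom.
  + by apply: measurable_funTS; apply/measurable_EFinP; exact: measurable_rho.
  + by move=> x _; rewrite lee_fin rho_ge0.
  + by rewrite lee_fin invr_ge0 ltW.
Qed.

Lemma integral_rho1_dom a b (f : R -> R) : 0 <= a -> 0 < b ->
  measurable_fun setT f -> (forall x, 0 <= f x) ->
  (\int[mu]_x ((f x)%:E * (rho1 a b x)%:E) =
   ((rhoZ a b)^-1)%:E * \int[mu]_(x in dom a) (f x * rho a b x)%:E)%E.
Proof.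
move=> a0 b0 mf f0; rewrite -ge0_integralZl//.
- rewrite [RHS]integral_mkcond; apply: eq_integral => x _.
  rewrite patchE /rho1 indicE; case: ifPn => _; rewrite ?mul0r ?mule0//.
  by rewrite mul1r -!EFinM; congr EFin; ring.
- exact: measurable_dom.
- apply: measurable_funTS; apply/measurable_EFinP; apply: measurable_funM => //.
  exact: measurable_rho.
- by move=> x _; rewrite lee_fin mulr_ge0 ?rho_ge0.
- by rewrite lee_fin invr_ge0 ltW// rhoZ_gt0.
Qed.

(** The normalizing constant cancels, and replacing the mean by the value at the mode only increases
    the left-hand side; what remains is [poincare_dom]. *)
Lemma rho1_poincare a b (P : probability R R) : 0 <= a -> 0 < b ->
  (forall g : R -> \bar R, measurable_fun setT g -> (forall x, (0 <= g x)%E) ->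
    (\int[P]_x g x = \int[mu]_x (g x * (rho1 a b x)%:E))%E) ->
  poincare1 P (2 * b)^-1.
Proof.
move=> a0 b0 PE f f' M fM df cf'.
have b20 : 0 < 2 * b by rewrite mulr_gt0.
have mf : measurable_fun setT f.
  by apply: continuous_measurable_fun => x; exact: is_derive_continuous (df x).
have mf' : measurable_fun setT f' by exact: continuous_measurable_fun.
have mB : measurable_fun setT (fun x => (f x - f (rho_top a b)) ^+ 2).
  by apply: measurable_funX; exact: measurable_funB.
have m2 : measurable_fun setT (fun x => f' x ^+ 2) by exact: measurable_funX.
apply: le_trans (le_variance P (f (rho_top a b)) mf fM) _.
rewrite !PE//; last 4 first.
- exact/measurable_EFinP.
- by move=> x; rewrite lee_fin sqr_ge0.
- exact/measurable_EFinP.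
- by move=> x; rewrite lee_fin sqr_ge0.
rewrite (integral_rho1_dom a0 b0 mB); last by move=> x; exact: sqr_ge0.
rewrite (integral_rho1_dom a0 b0 m2); last by move=> x; exact: sqr_ge0.
rewrite muleCA; apply: lee_wpmul2l.
  by rewrite lee_fin invr_ge0 ltW// rhoZ_gt0.
have := poincare_dom a0 b0 df cf'.
under eq_integral do rewrite -mulrA EFinM.
rewrite ge0_integralZl//.
- by rewrite -lee_pdivlMl// .
- exact: measurable_dom.
- apply: measurable_funTS; apply/measurable_EFinP; apply: measurable_funM => //.
  exact: measurable_rho.
- by move=> x _; rewrite lee_fin mulr_ge0 ?sqr_ge0 ?rho_ge0.
- by rewrite lee_fin ltW.
Qed.

End weighted_probability.

(** * The weighted integral *)

Section row_functions.
Context (R : realType) (n : nat).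
Implicit Types (v : 'rV[R]_n -> R) (x y : 'rV[R]_n).

Lemma row_of_tupleE (t : n.-tuple R) j : row_of_tuple t 0 j = tnth t j.
Proof. by rewrite mxE. Qed.

Lemma nbhs_rowP x (A : set 'rV[R]_n) :
  nbhs x A <-> exists2 e : R, 0 < e & forall y, (forall i, `|x 0 i - y 0 i| < e) -> A y.
Proof.
split=> [/nbhs_ballP[e /= e0 eA]|[e e0 eA]].
  exists e => // y xy; apply: eA; split=> // i j; rewrite ord1; exact: xy.
apply/nbhs_ballP; exists e => // y [_ xy]; apply: eA => i; exact: xy.
Qed.

Let grid (k : nat) (r : R) : R := (Num.floor (k.+1%:R * r))%:~R / k.+1%:R.

Let grid_close k r : `|r - grid k r| < 2 / k.+1%:R.
Proof.
have k0 : 0 < k.+1%:R :> R by rewrite ltr0n.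
rewrite -(ltr_pM2r k0) divfK ?gt_eqF// -[X in _ * X < _](gtr0_norm k0) -normrM.
rewrite mulrBl divfK ?gt_eqF// mulrC.
have := floorD1_gt (k.+1%:R * r); have := floor_le_tmp (k.+1%:R * r).
rewrite intrD => H1 H2; rewrite ltr_norml; apply/andP; split; lra.
Qed.

(* [v] is the pointwise limit of its values at the points of finer and finer
   grids, which take countably many values on boxes. *)
Lemma continuous_measurableN v : continuous v -> measurableN v.
Proof.
move=> cv; rewrite /measurableN.
pose g k (t : n.-tuple R) : n.-tuple R := map_tuple (grid k) t.
apply: (@measurable_fun_cvg _ _ _ _ (fun k t => v (row_of_tuple (g k t)))).
  move=> k _ B mB; rewrite setTI.
  have k0 : 0 < k.+1%:R :> R by rewrite ltr0n.
  pose pt (z : n.-tuple int) : 'rV[R]_n := \row_i ((tnth z i)%:~R / k.+1%:R).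
  pose E (z : n.-tuple int) : set (n.-tuple R) :=
    \bigcap_(i in [set: 'I_n]) [set t | Num.floor (k.+1%:R * tnth t i) = tnth z i].
  have mE z : measurable (E z).
    apply: fin_bigcap_measurable => // i _.
    rewrite (_ : [set _ | _] = (fun t : n.-tuple R => tnth t i) @^-1`
      `[(tnth z i)%:~R / k.+1%:R, (tnth z i + 1)%:~R / k.+1%:R[%classic).
      by rewrite -[X in measurable X]setTI; apply: measurable_tnth.
    apply/seteqP; split=> t /=; rewrite in_itv/=.
      move=> tE; rewrite ler_pdivrMr// ltr_pdivlMr// ![tnth t i * _]mulrC -tE.
      by rewrite floor_le_tmp floorD1_gt.
    rewrite ler_pdivrMr// ltr_pdivlMr// ![tnth t i * _]mulrC => tz.
    exact: floor_def.
  (* On each cell [E z] the rounded function is constant. The preimage is the union of the cells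
     whose value lies in [B], counted through [unpickle]. *)
  rewrite (_ : _ @^-1` B = \bigcup_m
    (if unpickle m is Some z then if v (pt z) \in B then E z else set0 else set0)).
    apply: bigcupT_measurable => m; case: unpickle => // z.
    by case: ifPn.
  have gE z t : E z t -> row_of_tuple (g k t) = pt z.
    move=> Ezt; apply/rowP => i; rewrite !mxE tnth_map /grid.
    by rewrite (Ezt i).
  apply/seteqP; split=> t /=.
    move=> vB.
    pose z : n.-tuple int := map_tuple (fun r => Num.floor (k.+1%:R * r)) t.
    have Ezt : E z t by move=> i _ /=; rewrite tnth_map.
    exists (pickle z) => //; rewrite pickleK -(gE _ _ Ezt) ifT//.
    exact/mem_set.
  move=> [m _]; case: unpickle => // z; case: ifPn => // zB Ezt.
  by rewrite (gE _ _ Ezt); exact/set_mem.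
move=> t _; apply: (@cvg_comp _ _ _ (fun k => row_of_tuple (g k t)) v); last exact: cv.
move=> A /nbhs_rowP [e e0 eA].
have : (fun k : nat => k.+1%:R^-1 : R) @ \oo --> (0 : R) by exact: cvg_harmonic.
move=> /cvgrPdist_lt /(_ (e / 2)); rewrite divr_gt0// => /(_ isT) [m _ mP].
exists m => // k /= mk; apply: eA => i.
rewrite !mxE tnth_map (lt_trans (grid_close _ _))//.
have := mP k mk; rewrite /= sub0r normrN gtr0_norm ?invr_gt0 ?ltr0n//.
by rewrite ltr_pdivlMr// mulrC.
Qed.

Definition rset x (j : 'I_n) (s : R) : 'rV[R]_n :=
  \row_i (if i == j then s else x 0 i).

Lemma row_of_tset (t : n.-tuple R) j s :
  row_of_tuple (tset t j s) = rset (row_of_tuple t) j s.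
Proof. by apply/rowP => i; rewrite !mxE tnth_mktuple; case: ifP. Qed.

Lemma rset_id x j : rset x j (x 0 j) = x.
Proof. by apply/rowP => i; rewrite mxE; case: eqP => // ->. Qed.

Lemma rsetE x j s : rset x j s 0 j = s.
Proof. by rewrite mxE eqxx. Qed.

Lemma rset_shift x j s h : h *: ej R j + rset x j s = rset x j (h + s).
Proof.
apply/rowP => i; rewrite !mxE /=; case: eqP => _; rewrite ?mulr1//.
by rewrite mulr0 add0r.
Qed.

Lemma measurable_slice v x j : measurableN v ->
  measurable_fun setT (fun s => v (rset x j s)).
Proof.
move=> mv; pose t : n.-tuple R := [tuple x 0 i | i < n].
have -> : (fun s => v (rset x j s)) = (fun s => v (row_of_tuple (tset t j s))).
  apply/funext => s; congr v; apply/rowP => i; rewrite !mxE !tnth_mktuple.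
  by case: ifP.
apply: (measurableT_comp (f := fun t => v (row_of_tuple t))) => //.
apply/measurable_fun_tnthP => i.
rewrite (_ : _ \o _ = if i == j then id else cst (tnth t i)); first by case: ifP.
by apply/funext => s /=; rewrite tnth_mktuple; case: ifP.
Qed.

Lemma continuous_rset x j : continuous (rset x j).
Proof.
move=> s A /nbhs_rowP [e e0 eA].
apply/nbhs_ballP; exists e => //= r; rewrite /ball/= => sr.
apply: eA => i; rewrite !mxE; case: ifP => // _.
by rewrite subrr normr0.
Qed.

Lemma is_derive_slice v x j : (forall y, derivable v y (ej R j)) ->
  forall s : R, is_derive (s : R) (1 : R) (fun s => v (rset x j s))
    ('D_(ej R j) v (rset x j s)).
Proof.
move=> dv s.
have E : (fun h : R => h^-1 *: (((fun s => v (rset x j s)) \o shift s) (h *: (1 : R))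
      - v (rset x j s))) =
    (fun h : R => h^-1 *: ((v \o shift (rset x j s)) (h *: ej R j) - v (rset x j s))).
  apply/funext => h /=; rewrite rset_shift.
  by rewrite /GRing.scale/= mulr1.
have dvs := dv (rset x j s).
by split; rewrite /derivable /derive E.
Qed.

End row_functions.

Section weighted_integral.
Context (R : realType) (N : nat) (alpha : 'I_N -> R).
Hypothesis alpha0 : forall i, 0 <= alpha i.
Notation mu := (@lebesgue_measure R).
Notation W := (wint alpha).
Implicit Types (f g : 'rV[R]_N -> R) (x : 'rV[R]_N).

Lemma continuous_sqn : continuous (@sqn R N).
Proof.
move=> x; rewrite /sqn; apply: cvg_big; [exact: add_continuous|exact: nbhs_filter|].
move=> i _; apply: (@cvg_comp _ _ _ (fun x : 'rV[R]_N => x 0 i) (fun r : R => r ^+ 2)).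
  exact: coord_continuous.
exact: exprn_continuous.
Qed.

Lemma sqn_ge0 x : 0 <= sqn x.
Proof. by apply: sumr_ge0 => i _; exact: sqr_ge0. Qed.

Lemma measurable_sqn : measurableN (@sqn R N).
Proof. exact: continuous_measurableN continuous_sqn. Qed.

Definition gprob (b : R) (b0 : 0 < b) (i : 'I_N) : probability R R :=
  sval (cid (rho1_probability (alpha0 i) b0)).

Lemma gprobE (b : R) (b0 : 0 < b) i (g : R -> \bar R) :
  measurable_fun setT g -> (forall y, (0 <= g y)%E) ->
  (\int[gprob b0 i]_x g x = \int[mu]_x (g x * (rho1 (alpha i) b x)%:E))%E.
Proof. exact: (svalP (cid (rho1_probability (alpha0 i) b0))). Qed.

Definition ZN (b : R) : R := \prod_i rhoZ (alpha i) b.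

Lemma ZN_gt0 b : 0 < b -> 0 < ZN b.
Proof. by move=> b0; apply: prodr_gt0 => i _; exact: rhoZ_gt0. Qed.

Definition PN (b : R) (b0 : 0 < b) : probability (N.-tuple R) R :=
  tprod (gprob b0).

Lemma indic_Rstar x : \1_(Rstar alpha) x = \prod_i \1_(dom (alpha i)) (x 0 i) :> R.
Proof.
rewrite indicE; case: (boolP (x \in _)) => [|/negP] xR.
  rewrite big1// => i _; rewrite indicE mem_set//.
  by move: xR => /[!inE]; apply.
have /existsNP[i /not_implyP[ai xi]] : ~ Rstar alpha x by move/mem_set.
rewrite (bigD1 i)//= indicE memNset ?mul0r//.
by move=> /(_ ai).
Qed.

Lemma prod_rho1 b (t : N.-tuple R) : 0 < b ->
  \prod_i rho1 (alpha i) b (tnth t i) =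
  \1_(Rstar alpha) (row_of_tuple t) * wA alpha (row_of_tuple t)
    * expR (- (b * sqn (row_of_tuple t))) / ZN b.
Proof.
move=> b0; rewrite /rho1 /rho /gauss 2!big_split/= big_split/= prodfV.
rewrite indic_Rstar /wA /sqn mulr_sumr -sumrN expR_sum -!mulrA.
congr (_ * (_ * (_ * _))).
- by apply: eq_bigr => i _; rewrite row_of_tupleE.
- by apply: eq_bigr => i _; rewrite row_of_tupleE.
- by apply: eq_bigr => i _; rewrite row_of_tupleE.
Qed.

Lemma measurableN_M f g : measurableN f -> measurableN g ->
  measurableN (fun x => f x * g x).
Proof. exact: measurable_funM. Qed.

Lemma measurableN_D f g : measurableN f -> measurableN g ->
  measurableN (fun x => f x + g x).
Proof. exact: measurable_funD. Qed.

Lemma measurableN_B f g : measurableN f -> measurableN g ->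
  measurableN (fun x => f x - g x).
Proof. exact: measurable_funB. Qed.

Lemma measurableN_X f n : measurableN f -> measurableN (fun x => f x ^+ n).
Proof. exact: measurable_funX. Qed.

Lemma measurableN_cst (c : R) : measurableN (fun _ : 'rV[R]_N => c).
Proof. exact: measurable_cst. Qed.

Lemma measurableN_sum (I : Type) (s : seq I) (F : I -> 'rV[R]_N -> R) :
  (forall i, measurableN (F i)) -> measurableN (fun x => \sum_(i <- s) F i x).
Proof. by move=> mF; apply: measurable_sum => i; exact: mF. Qed.

Lemma measurableN_expsqn b : measurableN (fun x => expR (b * sqn x)).
Proof.
rewrite /measurableN; apply: (measurableT_comp (@measurable_expR R)).
by apply: measurable_funM; [exact: measurable_cst|exact: measurable_sqn].
Qed.

(** The factor $e^{b|x|^2}$ undoes the Gaussian density, whatever [b] is. The value [b = 1]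
    transfers the integral calculus to [wint]; a general [b] transfers the Poincaré inequality. *)
Lemma wintE b (b0 : 0 < b) f : measurableN f -> (forall x, 0 <= f x) ->
  (W f = \int[PN b0]_t
    (ZN b * (f (row_of_tuple t) * expR (b * sqn (row_of_tuple t))))%:E)%E.
Proof.
move=> mf f0.
have Z0 := ZN_gt0 b0.
rewrite (integral_tprod (r := fun i => rho1 (alpha i) b)).
- rewrite /wint /intN; congr iint; apply/funext => t.
  rewrite -EFinM prod_rho1// expRN; congr EFin.
  by field; rewrite !gt_eqF ?expR_gt0.
- by move=> i x; exact: rho1_ge0.
- by move=> i g mg g0; exact: gprobE.
- apply/measurable_EFinP; apply: measurable_funM => //.
  apply: measurable_funM => //; exact: measurableN_expsqn.
- by move=> t; rewrite lee_fin !mulr_ge0 ?expR_ge0// ltW.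
Qed.

Let mW f : measurableN f -> measurable_fun setT (fun t : N.-tuple R =>
  (ZN 1 * (f (row_of_tuple t) * expR (1 * sqn (row_of_tuple t))))%:E).
Proof.
move=> mf; apply/measurable_EFinP; apply: measurable_funM => //.
apply: measurable_funM => //; exact: measurableN_expsqn.
Qed.

Let W0 f : (forall x, 0 <= f x) -> forall t : N.-tuple R,
  (0 <= (ZN 1 * (f (row_of_tuple t) * expR (1 * sqn (row_of_tuple t))))%:E)%E.
Proof. by move=> f0 t; rewrite lee_fin !mulr_ge0 ?expR_ge0// ltW// ZN_gt0. Qed.

Lemma wint_ge0 f : measurableN f -> (forall x, 0 <= f x) -> (0 <= W f)%E.
Proof.
move=> mf f0; rewrite (wintE ltr01)//; apply: integral_ge0 => t _.
exact: W0.
Qed.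

Lemma le_wint f g : measurableN f -> (forall x, 0 <= f x) ->
  measurableN g -> (forall x, f x <= g x) -> (W f <= W g)%E.
Proof.
move=> mf f0 mg fg; have g0 x : 0 <= g x by exact: le_trans (fg x).
rewrite !(wintE ltr01)//; apply: ge0_le_integral => //.
- by move=> t _; exact: W0.
- exact: mW.
- exact: mW.
- by move=> t _; rewrite lee_fin ler_pM2l ?ZN_gt0// ler_pM2r ?expR_gt0.
Qed.

Lemma wintD f g : measurableN f -> (forall x, 0 <= f x) ->
  measurableN g -> (forall x, 0 <= g x) -> (W (fun x => f x + g x)%R = W f + W g)%E.
Proof.
move=> mf f0 mg g0; rewrite !(wintE ltr01)//; last 2 first.
- exact: measurableN_D.
- by move=> x; rewrite addr_ge0.
rewrite -ge0_integralD//.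
- by apply: eq_integral => t _; rewrite -EFinD; congr EFin; ring.
- by move=> t _; exact: W0.
- exact: mW.
- by move=> t _; exact: W0.
- exact: mW.
Qed.

Lemma wintZ (k : R) f : 0 <= k -> measurableN f -> (forall x, 0 <= f x) ->
  (W (fun x => k * f x)%R = k%:E * W f)%E.
Proof.
move=> k0 mf f0; rewrite !(wintE ltr01)//; last 2 first.
- by apply: measurableN_M => //; exact: measurableN_cst.
- by move=> x; rewrite mulr_ge0.
rewrite -ge0_integralZl//.
- by apply: eq_integral => t _; rewrite -EFinM; congr EFin; ring.
- exact: mW.
- by move=> t _; exact: W0.
Qed.

Lemma wint_sum (F : 'I_N -> 'rV[R]_N -> R) : (forall i, measurableN (F i)) ->
  (forall i x, 0 <= F i x) -> (W (fun x => \sum_i F i x)%R = \sum_i W (F i))%E.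
Proof.
move=> mF F0; rewrite (wintE ltr01); last 2 first.
- exact: measurableN_sum.
- by move=> x; exact: sumr_ge0.
under [RHS]eq_bigr do rewrite (wintE ltr01)//.
rewrite -ge0_integral_sum//.
- apply: eq_integral => t _; rewrite sumEFin; congr EFin.
  by rewrite mulr_suml mulr_sumr.
- by move=> i; exact: mW.
- by move=> i t _; exact: W0.
Qed.

Lemma wint_gauss b : 0 < b -> (W (fun x => expR (- (b * sqn x))) = (ZN b)%:E)%E.
Proof.
move=> b0; rewrite (wintE b0).
- under eq_integral do rewrite -expRD addNr expR0 mulr1.
  rewrite integral_cst// -[RHS]mule1; congr (_ * _)%E.
  exact: probability_setT.
- have := measurableN_expsqn (- b); rewrite /measurableN.
  by under eq_fun do rewrite mulNr.
- by move=> x; exact: expR_ge0.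
Qed.

(** Along a line parallel to the axis [j], the contribution of the other coordinates is a constant,
    and $e^{s^2}$ cancels the Gaussian factor of the density. Only the one-variable weight
    remains. *)
Lemma le_wint_slice (j : 'I_N) f g : measurableN f -> (forall x, 0 <= f x) ->
  measurableN g -> (forall x, 0 <= g x) ->
  (forall x, \int[mu]_(s in dom (alpha j)) (f (rset x j s) * s `^ alpha j)%:E <=
     \int[mu]_(s in dom (alpha j)) (g (rset x j s) * s `^ alpha j)%:E)%E ->
  (W f <= W g)%E.
Proof.
move=> mf f0 mg g0 fg; rewrite !(wintE ltr01)//.
apply: (@le_tprod_slice _ _ _ j); [exact: mW|exact: W0|exact: mW|exact: W0|].
move=> t.
pose K := ZN 1 * expR (\sum_(i < N | i != j) tnth t i ^+ 2).
have K0 : 0 <= K by rewrite mulr_ge0 ?expR_ge0// ltW// ZN_gt0.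
have aj := alpha0 j.
have E (k : 'rV[R]_N -> R) : measurableN k -> (forall x, 0 <= k x) ->
    (\int[gprob ltr01 j]_s (ZN 1 * (k (row_of_tuple (tset t j s))
       * expR (1 * sqn (row_of_tuple (tset t j s)))))%:E =
    (K / rhoZ (alpha j) 1)%:E * \int[mu]_(s in dom (alpha j))
       (k (rset (row_of_tuple t) j s) * s `^ alpha j)%:E)%E.
  move=> mk k0; have mks := measurable_slice (row_of_tuple t) j mk.
  have sq s : sqn (row_of_tuple (tset t j s)) =
      s ^+ 2 + \sum_(i < N | i != j) tnth t i ^+ 2.
    rewrite /sqn (bigD1 j)//= row_of_tset rsetE; congr (_ + _).
    by apply: eq_bigr => i ij; rewrite !mxE (negbTE ij).
  pose F s := K * (k (rset (row_of_tuple t) j s) * expR (s ^+ 2)).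
  under eq_integral => s _.
    rewrite (_ : _ * _ = F s); last first.
      by rewrite /F /K sq mul1r expRD row_of_tset; ring.
    over.
  have mexp : measurable_fun setT (fun s : R => expR (s ^+ 2)).
    by apply: (measurableT_comp (@measurable_expR R)); exact: measurable_funX.
  have mF : measurable_fun setT F.
    by apply: measurable_funM => //; exact: measurable_funM.
  have F0 s : 0 <= F s.
    by apply: mulr_ge0 => //; apply: mulr_ge0 => //; exact: expR_ge0.
  rewrite gprobE//; last exact/measurable_EFinP.
  rewrite integral_rho1_dom// [K / _]mulrC EFinM -muleA; congr (_ * _)%E.
  rewrite -[in RHS]ge0_integralZl//; last 3 first.
  - exact: measurable_dom.
  - apply: measurable_funTS; apply/measurable_EFinP; apply: measurable_funM => //.
  - by move=> s _; rewrite lee_fin mulr_ge0 ?powR_ge0.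
  apply: eq_integral => s _.
  rewrite -EFinM /F /rho /gauss mul1r expRN; congr EFin.
  by field; rewrite gt_eqF ?expR_gt0.
rewrite !E//; apply: lee_wpmul2l; last exact: fg.
by rewrite lee_fin divr_ge0// ltW// rhoZ_gt0.
Qed.

End weighted_integral.

Section continuity.
Context (R : realType) (N : nat).
Implicit Types (u v : 'rV[R]_N -> R).

Lemma contD u v : continuous u -> continuous v -> continuous (fun x => u x + v x).
Proof. by move=> cu cv x; apply: cvgD; [exact: nbhs_filter|exact: cu|exact: cv]. Qed.

Lemma contB u v : continuous u -> continuous v -> continuous (fun x => u x - v x).
Proof. by move=> cu cv x; apply: cvgB; [exact: nbhs_filter|exact: cu|exact: cv]. Qed.

Lemma contM u v : continuous u -> continuous v -> continuous (fun x => u x * v x).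
Proof. by move=> cu cv x; apply: cvgM; [exact: nbhs_filter|exact: cu|exact: cv]. Qed.

Lemma cont_cst (c : R) : continuous (fun _ : 'rV[R]_N => c).
Proof. exact: cst_continuous. Qed.

Lemma cont_comp u (f : R -> R) : continuous f -> continuous u ->
  continuous (fun x => f (u x)).
Proof. by move=> cf cu x; apply: (@cvg_comp _ _ _ u f); [exact: cu|exact: cf]. Qed.

Lemma contX u n : continuous u -> continuous (fun x => u x ^+ n).
Proof. by apply: (cont_comp (f := fun r => r ^+ n)); exact: exprn_continuous. Qed.

Lemma cont_coord i : continuous (fun x : 'rV[R]_N => x 0 i).
Proof. by move=> x; exact: coord_continuous. Qed.

Lemma cont_expsqn (b : R) : continuous (fun x : 'rV[R]_N => expR (b * sqn x)).
Proof.
apply: cont_comp; first exact: continuous_expR.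
by apply: contM; [exact: cont_cst|exact: continuous_sqn].
Qed.

Lemma cont_expNsqn (b : R) : continuous (fun x : 'rV[R]_N => expR (- (b * sqn x))).
Proof.
by have := @cont_expsqn (- b); under eq_fun do rewrite mulNr.
Qed.

End continuity.

(** * Functions of class $C^1$ and compact supports *)

Section compact_support.
Context (R : realType) (N : nat).
Implicit Types (u v h k : 'rV[R]_N -> R) (x : 'rV[R]_N).

(** The regularity required of slices along the axes. It is stable under differences and shared by
    the functions of $N_*$ and by the extremal function. *)
Definition C1 v : Prop := [/\ continuous v,
  forall i, continuous ('D_(ej R i) v) & forall i x, derivable v x (ej R i)].

(** Vanishing off a box: a single large coordinate suffices, so the property restricts directly to
    lines parallel to an axis. *)
Definition supported (T : R) h : Prop :=
  forall x i, T <= `|x 0 i| -> h x = 0.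

Lemma C1_sub u v : C1 u -> C1 v -> C1 (fun x => u x - v x).
Proof.
move=> [cu cdu du] [cv cdv dv]; split.
- exact: contB.
- move=> i; have -> : 'D_(ej R i) (fun x => u x - v x) =
      (fun x => 'D_(ej R i) u x - 'D_(ej R i) v x).
    by apply/funext => x; rewrite (@deriveB _ _ _ u v).
  by apply: contB; [exact: cdu|exact: cdv].
- by move=> i x; apply: (@derivableB _ _ _ u v).
Qed.

Lemma derive_sub u v i x : C1 u -> C1 v ->
  'D_(ej R i) (fun x => u x - v x) x = 'D_(ej R i) u x - 'D_(ej R i) v x.
Proof. by move=> [_ _ du] [_ _ dv]; rewrite (@deriveB _ _ _ u v). Qed.

Lemma supported_sub u v : (exists T, supported T u) -> (exists T, supported T v) ->
  exists T, supported T (fun x => u x - v x).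
Proof.
move=> [S Su] [T Tv]; exists (Num.max S T) => x i; rewrite ge_max => /andP[Sx Tx].
by rewrite (Su x i)// (Tv x i)// subrr.
Qed.

(** The margin [1] leaves around [x] a whole neighbourhood on which [v] vanishes. *)
Lemma supported_derive T v i : supported T v -> supported (T + 1) ('D_(ej R i) v).
Proof.
move=> Tv x j xj.
have -> : 'D_(ej R i) v x = 'D_(ej R i) (cst 0 : 'rV[R]_N -> R) x.
  apply: near_eq_derive; apply/nbhs_rowP; exists 1 => // y xy.
  rewrite (Tv y j)//; have := xy j.
  have := lerB_dist (x 0 j) (y 0 j); lra.
by rewrite derive_cst.
Qed.

Lemma supported_bounded T h : continuous h -> supported T h ->
  exists M, forall x, `|h x| <= M.
Proof.
move=> ch Th.
pose A : set 'rV[R]_N := [set x | forall i, `[- T, T]%classic (x 0 i)].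
have cA : compact A by apply: (@rV_compact R N (fun=> `[- T, T]%classic)) => i; exact: segment_compact.
have cfA : compact (h @` A).
  by apply: continuous_compact => //; exact: continuous_subspaceT.
have [M [_ HM]] := compact_bounded cfA.
exists (Num.max (M + 1) 0) => x; rewrite le_max.
have [|/existsNP[i xi]] := pselect (A x).
  by move=> Ax; rewrite (HM (M + 1))//= ?ltrDl//; exists x.
rewrite (Th x i) ?normr0 ?lexx ?orbT// leNgt; apply/negP => xT.
apply: xi; rewrite /= in_itv/= -ler_norml; exact: ltW.
Qed.

Lemma supportedM T h k : supported T h -> supported T (fun x => h x * k x).
Proof. by move=> Th x i /Th ->; rewrite mul0r. Qed.

Lemma Nstar_C1 (alpha : 'I_N -> R) v : Nstar alpha v ->
  C1 v /\ exists T, supported T v.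
Proof.
move=> [sv cpt _]; split.
  split.
  - by have [] := sv [::].
  - by move=> i; have [] := sv [:: i].
  - by move=> i x; have [_] := sv [::]; apply.
have [M [_ HM]] := compact_bounded cpt.
exists (M + 2) => x i Mx; apply/eqP; apply: contraT => vx.
have {}HM := HM (M + 1) (_ : M < M + 1); rewrite ltrDl ltr01 in HM.
have : closure [set x | v x != 0] x by exact: subset_closure.
move=> cx; have /= xM := HM isT _ cx.
have : `|x 0 i| <= `|x|.
  rewrite [leRHS]/Num.norm/= mx_normE.
  exact: (le_bigmax_cond _ (fun i : 'I_1 * 'I_N => `|x i.1 i.2|%:nng) (j := (ord0, i))).
by move=> H; have := le_trans H xM; lra.
Qed.

End compact_support.

(** * Energy identities and the gap inequality for compact supports *)

Section gap.
Context (R : realType) (N : nat) (alpha : 'I_N -> R).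
Hypothesis alpha0 : forall i, 0 <= alpha i.
Notation W := (wint alpha).
Implicit Types (u v h : 'rV[R]_N -> R) (x : 'rV[R]_N).

(** $h e^{|x|^2}$ is continuous with compact support, hence bounded, so that [h] lies below a
    multiple of a Gaussian of finite weighted mass. *)
Lemma wint_supported_lty h T : continuous h -> supported T h ->
  (forall x, 0 <= h x) -> (W h < +oo)%E.
Proof.
move=> ch Th h0.
have ck : continuous (fun x => h x * expR (1 * sqn x)).
  by apply: contM => //; exact: cont_expsqn.
have [M HM] := supported_bounded ck (supportedM _ Th).
have M0 : 0 <= M by apply: le_trans (HM 0).
have mE : measurableN (fun x : 'rV[R]_N => expR (- (1 * sqn x))).
  exact: continuous_measurableN (@cont_expNsqn R N 1).
apply: (@le_lt_trans _ _ (W (fun x => M * expR (- (1 * sqn x)))%R)).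
  apply: le_wint => //.
  - exact: continuous_measurableN.
  - by apply: measurableN_M => //; exact: measurableN_cst.
  - move=> x; rewrite expRN ler_pdivlMr ?expR_gt0//.
    by have := ler_normlW (HM x).
by rewrite wintZ// wint_gauss// -EFinM ltry.
Qed.

(** $e^{-b|x|^2/2}\,\partial_i (v e^{b|x|^2/2})$, the annihilation operator of the harmonic
    oscillator up to normalization. *)
Definition dgauss (b : R) v (i : 'I_N) x : R := 'D_(ej R i) v x + b * x 0 i * v x.

Lemma continuous_dgauss b v i : C1 v -> continuous (dgauss b v i).
Proof.
move=> [cv cdv _]; apply: contD; first exact: cdv.
apply: contM => //; apply: contM; [exact: cont_cst|exact: cont_coord].
Qed.

Let cH b v j : C1 v ->
  continuous (fun x => dgauss b v j x ^+ 2 + b * (1 + alpha j) * v x ^+ 2).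
Proof.
move=> C1v; have [cv cdv dv] := C1v; apply: contD.
  by apply: contX; exact: continuous_dgauss.
by apply: contM; [exact: cont_cst|exact: contX].
Qed.

Let cG b v j : C1 v ->
  continuous (fun x => 'D_(ej R j) v x ^+ 2 + b ^+ 2 * x 0 j ^+ 2 * v x ^+ 2).
Proof.
move=> [cv cdv dv]; apply: contD; first by apply: contX; exact: cdv.
apply: contM; last exact: contX.
by apply: contM; [exact: cont_cst|apply: contX; exact: cont_coord].
Qed.

Let H0 b v j x : 0 < b -> 0 <= dgauss b v j x ^+ 2 + b * (1 + alpha j) * v x ^+ 2.
Proof.
move=> b0; apply: addr_ge0; first exact: sqr_ge0.
by apply: mulr_ge0; [rewrite mulr_ge0 ?addr_ge0// ltW|exact: sqr_ge0].
Qed.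

Let G0 b v j x : 0 <= 'D_(ej R j) v x ^+ 2 + b ^+ 2 * x 0 j ^+ 2 * v x ^+ 2.
Proof.
apply: addr_ge0; first exact: sqr_ge0.
by apply: mulr_ge0; [apply: mulr_ge0; exact: sqr_ge0|exact: sqr_ge0].
Qed.

Lemma wint_energy_le b v j T : 0 < b -> C1 v -> supported T v ->
  (W (fun x => dgauss b v j x ^+ 2 + b * (1 + alpha j) * v x ^+ 2)%R <=
   W (fun x => 'D_(ej R j) v x ^+ 2 + b ^+ 2 * x 0 j ^+ 2 * v x ^+ 2)%R)%E.
Proof.
move=> b0 C1v Tv; apply: (le_wint_slice alpha0 (j := j)).
- apply: continuous_measurableN; exact: cH.
- by move=> x; exact: H0.
- apply: continuous_measurableN; exact: cG.
- by move=> x; exact: G0.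
- move=> x; have [cv cdv dv] := C1v.
  have csl (k : 'rV[R]_N -> R) : continuous k -> continuous (fun s => k (rset x j s)).
    move=> ck s; apply: (@cvg_comp _ _ _ (rset x j) k); last exact: ck.
    exact: continuous_rset.
  have vT s : T <= `|s| -> v (rset x j s) = 0.
    by move=> Ts; apply: (Tv _ j); rewrite rsetE.
  have := energy_le (alpha0 j) b0 (is_derive_slice x (dv j)) (csl _ (cdv j)) vT.
  congr (_ <= _)%E; apply: eq_integral => s _; congr EFin; congr (_ * _).
    by rewrite /dgauss rsetE.
  by rewrite rsetE.
Qed.

Lemma wint_energy_ge b v j : 0 < b -> C1 v ->
  (W (fun x => 'D_(ej R j) v x ^+ 2 + b ^+ 2 * x 0 j ^+ 2 * v x ^+ 2)%R <=
   W (fun x => dgauss b v j x ^+ 2 + b * (1 + alpha j) * v x ^+ 2)%R)%E.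
Proof.
move=> b0 C1v; apply: (le_wint_slice alpha0 (j := j)).
- apply: continuous_measurableN; exact: cG.
- by move=> x; exact: G0.
- apply: continuous_measurableN; exact: cH.
- by move=> x; exact: H0.
- move=> x; have [cv cdv dv] := C1v.
  have csl (k : 'rV[R]_N -> R) : continuous k -> continuous (fun s => k (rset x j s)).
    move=> ck s; apply: (@cvg_comp _ _ _ (rset x j) k); last exact: ck.
    exact: continuous_rset.
  have := energy_ge (alpha0 j) b0 (is_derive_slice x (dv j)) (csl _ (cdv j)).
  congr (_ <= _)%E; apply: eq_integral => s _; congr EFin; congr (_ * _).
    by rewrite rsetE.
  by rewrite /dgauss rsetE.
Qed.

(** The place where $D$ arises, as the sum of [1 + alpha i] over all coordinates. *)
Lemma energy_sum b v x :
  \sum_i (dgauss b v i x ^+ 2 + b * (1 + alpha i) * v x ^+ 2) =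
  \sum_i dgauss b v i x ^+ 2 + b * dimA alpha * v x ^+ 2.
Proof.
rewrite big_split/=; congr (_ + _); rewrite -mulr_suml -mulr_sumr; congr (_ * _ * _).
by rewrite big_split/= sumr_const card_ord.
Qed.

Lemma grad_sum b v x :
  \sum_i ('D_(ej R i) v x ^+ 2 + b ^+ 2 * x 0 i ^+ 2 * v x ^+ 2) =
  \sum_i 'D_(ej R i) v x ^+ 2 + b ^+ 2 * (v x ^+ 2 * sqn x).
Proof.
rewrite big_split/=; congr (_ + _); rewrite -mulr_suml -mulr_sumr -/(sqn x); ring.
Qed.

Lemma wint_gradient_le b v T : 0 < b -> C1 v -> supported T v ->
  (W (fun x => \sum_i dgauss b v i x ^+ 2 + b * dimA alpha * v x ^+ 2)%R <=
   W (fun x => \sum_i 'D_(ej R i) v x ^+ 2 + b ^+ 2 * (v x ^+ 2 * sqn x))%R)%E.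
Proof.
move=> b0 C1v Tv.
under [X in (W X <= _)%E]eq_fun do rewrite -energy_sum.
under [X in (_ <= W X)%E]eq_fun do rewrite -grad_sum.
rewrite !wint_sum//.
- by apply: lee_sum => i _; exact: wint_energy_le Tv.
- by move=> i; apply: continuous_measurableN; exact: cG.
- by move=> i; apply: continuous_measurableN; exact: cH.
- by move=> i x; exact: H0.
Qed.

Lemma wint_gradient_ge b v : 0 < b -> C1 v ->
  (W (fun x => \sum_i 'D_(ej R i) v x ^+ 2 + b ^+ 2 * (v x ^+ 2 * sqn x))%R <=
   W (fun x => \sum_i dgauss b v i x ^+ 2 + b * dimA alpha * v x ^+ 2)%R)%E.
Proof.
move=> b0 C1v.
under [X in (_ <= W X)%E]eq_fun do rewrite -energy_sum.
under [X in (W X <= _)%E]eq_fun do rewrite -grad_sum.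
rewrite !wint_sum//.
- by apply: lee_sum => i _; exact: wint_energy_ge.
- by move=> i; apply: continuous_measurableN; exact: cH.
- by move=> i x; exact: H0.
- by move=> i; apply: continuous_measurableN; exact: cG.
Qed.

(** The factor $e^{b|x|^2}$ of [wintE] is [E x ^+ 2]. Once distributed into the squares, it turns
    the left side into a variance and [dgauss] into a partial derivative of [F]. Compact support
    makes [F] bounded, as tensorization requires. *)
Lemma wint_poincare b v T : 0 < b -> C1 v -> supported T v ->
  exists c : R, (W (fun x => (v x - c * expR (- (b / 2 * sqn x))) ^+ 2)%R <=
    (2 * b)^-1%:E * W (fun x => \sum_i dgauss b v i x ^+ 2)%R)%E.
Proof.
move=> b0 C1v Tv; have [cv cdv dv] := C1v.
pose E x := expR (b / 2 * sqn x).
have cE : continuous E by exact: cont_expsqn.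
pose F x := v x * E x.
have cF : continuous F by exact: contM.
have [M HM] := supported_bounded cF (supportedM _ Tv).
pose df i x := dgauss b v i x * E x.
have cdf i : continuous (df i).
  by apply: contM => //; exact: continuous_dgauss.
have b20 : 0 < 2 * b by rewrite mulr_gt0.
have b20V : 0 <= (2 * b)^-1 by rewrite invr_ge0 ltW.
pose dv' i x := 'D_(ej R i) v x.
have E0 x : E x != 0 by rewrite gt_eqF// expR_gt0.
have dF j t s : is_derive (s : R) (1 : R) (fun s => F (row_of_tuple (tset t j s)))
    (df j (row_of_tuple (tset t j s))).
  have d1 := is_derive_slice (row_of_tuple t) (dv j) s.
  set rest := \sum_(i < N | i != j) tnth t i ^+ 2.
  have sq r : sqn (row_of_tuple (tset t j r)) = r ^+ 2 + rest.
    rewrite /sqn (bigD1 j)//= row_of_tset rsetE; congr (_ + _).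
    by apply: eq_bigr => i ij; rewrite !mxE (negbTE ij).
  have d2 : is_derive (s : R) (1 : R) (fun r : R => expR (b / 2 * (r ^+ 2 + rest)))
      (expR (b / 2 * (s ^+ 2 + rest)) * (b * s)).
    have h : is_derive (s : R) (1 : R) (fun r : R => b / 2 * (r ^+ 2 + rest)) (b * s).
      by apply: is_derive_eq; rewrite /GRing.scale/=; field.
    exact: (is_derive1_comp (is_derive_expR _) h).
  rewrite (_ : (fun s => _) = (fun r => v (rset (row_of_tuple t) j r) *
      expR (b / 2 * (r ^+ 2 + rest)))); last first.
    by apply/funext => r; rewrite /F /E sq row_of_tset.
  apply: is_derive_eq.
  rewrite /df /E /dgauss sq row_of_tset rsetE /GRing.scale/=; ring.
have cslice j (t : N.-tuple R) : continuous (fun s => df j (row_of_tuple (tset t j s))).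
  under eq_fun do rewrite row_of_tset.
  move=> s; apply: (@cvg_comp _ _ _ (rset (row_of_tuple t) j) (df j)); last exact: cdf.
  exact: continuous_rset.
have P1 := @tprod_poincare R N (gprob alpha0 b0) (2 * b)^-1 b20V
  (fun i => rho1_poincare (alpha0 i) b0 (@gprobE _ _ _ alpha0 b b0 i))
  (fun t => F (row_of_tuple t)) (fun i t => df i (row_of_tuple t)) M
  (continuous_measurableN cF) (fun t => HM _) (fun i => continuous_measurableN (cdf i))
  dF cslice.
set c := (\int[tprod (gprob alpha0 b0)]_t F (row_of_tuple t))%R in P1.
exists c.
have E2 x : E x ^+ 2 = expR (b * sqn x).
  by rewrite /E expr2 -expRD; congr expR; field.
have EN x : expR (- (b / 2 * sqn x)) = (E x)^-1 by rewrite expRN.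
have cV : continuous (fun x => (v x - c * expR (- (b / 2 * sqn x))) ^+ 2).
  apply: contX; apply: contB => //; apply: contM; first exact: cont_cst.
  exact: cont_expNsqn.
have Z0 := ZN_gt0 alpha0 b0.
rewrite (wintE alpha0 b0); last 2 first.
- exact: continuous_measurableN.
- by move=> x; exact: sqr_ge0.
rewrite (wintE alpha0 b0); last 2 first.
- apply: measurableN_sum => i; apply: measurableN_X.
  by apply: continuous_measurableN; exact: continuous_dgauss.
- by move=> x; apply: sumr_ge0 => i _; exact: sqr_ge0.
under eq_integral => t _.
  rewrite -E2 EN -exprMn mulrBl divfK// -/(F _) EFinM; over.
under [X in (_ <= _ * X)%E]eq_integral => t _.
  rewrite -E2 mulr_suml; under eq_bigr do rewrite -exprMn; rewrite EFinM; over.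
have mF2 : measurable_fun setT (fun t : N.-tuple R => ((F (row_of_tuple t) - c) ^+ 2)%:E).
  apply/measurable_EFinP; apply: measurable_funX; apply: measurable_funB => //.
  exact: (continuous_measurableN cF).
have md2 : measurable_fun setT (fun t : N.-tuple R => (\sum_i (dgauss b v i (row_of_tuple t) * E (row_of_tuple t)) ^+ 2)%:E).
  apply/measurable_EFinP; apply: measurable_sum => i; apply: measurable_funX.
  exact: (continuous_measurableN (cdf i)).
rewrite ge0_integralZl//; last 2 first.
- by move=> t _; rewrite lee_fin sqr_ge0.
- by rewrite lee_fin ltW.
rewrite ge0_integralZl//; last 2 first.
- by move=> t _; rewrite lee_fin sumr_ge0// => i _; exact: sqr_ge0.
- by rewrite lee_fin ltW.
by rewrite muleCA; apply: lee_wpmul2l => //; rewrite lee_fin ltW.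
Qed.

(* [b / 2] being [1 / (2 l^2)], the left-hand side involves the distance of [v]
   to the Gaussian of width [l]. *)
Lemma wint_gap b v T : 0 < b -> C1 v -> supported T v ->
  exists c : R, ((dimA alpha / 2)%:E * W (fun x => v x ^+ 2)%R
      + W (fun x => (v x - c * expR (- (b / 2 * sqn x))) ^+ 2)%R <=
    (2 * b)^-1%:E * W (fun x => \sum_i 'D_(ej R i) v x ^+ 2)%R +
    (b / 2)%:E * W (fun x => v x ^+ 2 * sqn x)%R)%E.
Proof.
move=> b0 C1v Tv; have [cv cdv dv] := C1v.
have [c cP] := wint_poincare b0 C1v Tv; exists c.
have D0 : 0 <= dimA alpha by rewrite addr_ge0// sumr_ge0.
have b20V : 0 <= (2 * b)^-1 by rewrite invr_ge0 mulr_ge0// ltW.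
have mv2 : measurableN (fun x => v x ^+ 2).
  by apply: measurableN_X; exact: continuous_measurableN.
have mds : measurableN (fun x => \sum_i dgauss b v i x ^+ 2).
  apply: measurableN_sum => i; apply: measurableN_X.
  by apply: continuous_measurableN; exact: continuous_dgauss.
have mgs : measurableN (fun x => \sum_i 'D_(ej R i) v x ^+ 2).
  apply: measurableN_sum => i; apply: measurableN_X.
  by apply: continuous_measurableN; exact: cdv.
have mvs : measurableN (fun x => v x ^+ 2 * sqn x).
  by apply: measurableN_M => //; exact: measurable_sqn.
have s0 (F : 'I_N -> 'rV[R]_N -> R) x : 0 <= \sum_i F i x ^+ 2.
  by apply: sumr_ge0 => i _; exact: sqr_ge0.
have vs0 x : 0 <= v x ^+ 2 * sqn x by rewrite mulr_ge0 ?sqr_ge0 ?sqn_ge0.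
have v20 x : 0 <= v x ^+ 2 by exact: sqr_ge0.
apply: (@le_trans _ _ ((2 * b)^-1%:E *
    W (fun x => \sum_i dgauss b v i x ^+ 2 + b * dimA alpha * v x ^+ 2)%R)%E).
  rewrite wintD//; last 2 first.
  - by apply: measurableN_M => //; exact: measurableN_cst.
  - by move=> x; apply: mulr_ge0 => //; rewrite mulr_ge0// ltW.
  rewrite ge0_muleDr; last 2 first.
  - by apply: wint_ge0.
  - apply: wint_ge0 => //; first by apply: measurableN_M => //; exact: measurableN_cst.
    by move=> x; apply: mulr_ge0 => //; rewrite mulr_ge0// ltW.
  rewrite wintZ//; last by rewrite mulr_ge0// ltW.
  rewrite muleA -EFinM (_ : (2 * b)^-1 * (b * dimA alpha) = dimA alpha / 2).
    by rewrite addeC leeD2r.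
  by field; rewrite gt_eqF.
apply: (@le_trans _ _ ((2 * b)^-1%:E *
    W (fun x => \sum_i 'D_(ej R i) v x ^+ 2 + b ^+ 2 * (v x ^+ 2 * sqn x))%R)%E).
  by apply: lee_wpmul2l; [rewrite lee_fin|exact: wint_gradient_le Tv].
have b2 : 0 <= b ^+ 2 by exact: sqr_ge0.
rewrite wintD//; last 2 first.
- by apply: measurableN_M => //; exact: measurableN_cst.
- by move=> x; exact: mulr_ge0.
rewrite ge0_muleDr; last 2 first.
- by apply: wint_ge0 => // x; exact: (s0 (fun i => 'D_(ej R i) v)).
- apply: wint_ge0 => //; first by apply: measurableN_M => //; exact: measurableN_cst.
  by move=> x; exact: mulr_ge0.
  rewrite wintZ// muleA -EFinM (_ : (2 * b)^-1 * b ^+ 2 = b / 2)//.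
  by field; rewrite gt_eqF.
by move=> x; exact: (s0 (fun i => 'D_(ej R i) v)).
Qed.

End gap.

(** * The inequality *)

Section real_inequalities.
Context (R : realType).
Implicit Types (x y a c e : R).

(** Young's inequality for [x = y + (x - y)], the defect being a perfect square. It perturbs squared
    norms without Minkowski's inequality. *)
Lemma sqrD_le x y e : 0 < e ->
  x ^+ 2 <= (1 + e) * y ^+ 2 + (1 + e^-1) * (x - y) ^+ 2.
Proof.
move=> e0; rewrite -subr_ge0.
have -> : (1 + e) * y ^+ 2 + (1 + e^-1) * (x - y) ^+ 2 - x ^+ 2 =
    e^-1 * (e * y - (x - y)) ^+ 2 by field; rewrite gt_eqF.
by rewrite mulr_ge0 ?sqr_ge0// invr_ge0 ltW.
Qed.

(* The right-hand side is minimal for [b = sqrt (a / c)]; the perturbation by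
   [e] takes care of the degenerate cases [a = 0] and [c = 0]. *)
Lemma le_sqrt_prod x a c : 0 <= a -> 0 <= c ->
  (forall b, 0 < b -> x <= (2 * b)^-1 * a + b / 2 * c) ->
  x <= Num.sqrt a * Num.sqrt c.
Proof.
move=> a0 c0 H; set p := Num.sqrt a; set q := Num.sqrt c.
have p0 : 0 <= p by exact: sqrtr_ge0.
have q0 : 0 <= q by exact: sqrtr_ge0.
have pE : a = p ^+ 2 by rewrite sqr_sqrtr.
have qE : c = q ^+ 2 by rewrite sqr_sqrtr.
apply/ler_addgt0Pr => e e0.
(* Moving both [p] and [q] by [d] costs at most [d (p + q) / 2], which is below [e]. *)
pose d := e / (p + q + 1).
have d0 : 0 < d by rewrite divr_gt0// ltr_wpDl// addr_ge0.
have dE : d * (p + q + 1) = e.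
  by rewrite divfK// gt_eqF// ltr_wpDl// addr_ge0.
have pd : 0 < p + d by rewrite ltr_wpDl.
have qd : 0 < q + d by rewrite ltr_wpDl.
have b0 : 0 < (p + d) / (q + d) by rewrite divr_gt0.
apply: le_trans (H _ b0) _.
have t1 : p / (p + d) <= 1 by rewrite ler_pdivrMr// mul1r lerDl ltW.
have t2 : q / (q + d) <= 1 by rewrite ler_pdivrMr// mul1r lerDl ltW.
have -> : (2 * ((p + d) / (q + d)))^-1 * a = p * (q + d) * (p / (p + d)) / 2.
  by rewrite pE; field; rewrite !gt_eqF.
have -> : (p + d) / (q + d) / 2 * c = q * (p + d) * (q / (q + d)) / 2.
  by rewrite qE; field; rewrite !gt_eqF.
have h1 : p * (q + d) * (p / (p + d)) <= p * (q + d).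
  by rewrite ler_piMr// mulr_ge0// ltW.
have h2 : q * (p + d) * (q / (q + d)) <= q * (p + d).
  by rewrite ler_piMr// mulr_ge0// ltW.
nra.
Qed.

(** The two limits are ordered: [d] tends to [0] at fixed [e], because [1 + e^-1] blows up, and [e]
    tends to [0] afterwards. *)
Lemma le_of_approx x y K : 0 <= y -> 0 <= K ->
  (forall e d, 0 < e -> 0 < d -> x <= (1 + e) ^+ 2 * y + (1 + e) * (1 + e^-1) * K * d) ->
  x <= y.
Proof.
move=> y0 K0 H.
have {}H e : 0 < e -> x <= (1 + e) ^+ 2 * y.
  move=> e0; apply/ler_addgt0Pr => d d0.
  set L := (1 + e) * (1 + e^-1) * K.
  have L0 : 0 <= L by rewrite !mulr_ge0// addr_ge0// ?invr_ge0 ltW.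
  have L1 : 0 < L + 1 by rewrite ltr_wpDl.
  apply: le_trans (H e (d / (L + 1)) e0 _) _; first by rewrite divr_gt0.
  rewrite lerD2l -/L mulrCA ler_piMr ?(ltW d0)//.
  by rewrite ler_pdivrMr// mul1r lerDl.
apply/ler_addgt0Pr => d d0.
(* For [e <= 1] one has [(1 + e) ^+ 2 <= 1 + 3 e], whence the denominator [3 * y + 1]. *)
pose e := Num.min 1 (d / (3 * y + 1)).
have y1 : 0 < 3 * y + 1 by rewrite ltr_wpDl// mulr_ge0.
have e0 : 0 < e by rewrite lt_min ltr01 divr_gt0.
have e1 : e <= 1 by rewrite ge_min lexx.
have ed : e * (3 * y + 1) <= d by rewrite -ler_pdivlMr// ge_min lexx orbT.
apply: le_trans (H e e0) _; nra.
Qed.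

End real_inequalities.

(** * Passage from $N_*$ to $S_A$ *)

Section limit.
Context (R : realType) (N : nat) (alpha : 'I_N -> R).
Hypothesis alpha0 : forall i, 0 <= alpha i.
Notation W := (wint alpha).
Implicit Types (u v f g h : 'rV[R]_N -> R) (x : 'rV[R]_N).

Lemma wint_fin f : measurableN f -> (forall x, 0 <= f x) -> (W f < +oo)%E ->
  exists2 r, 0 <= r & W f = r%:E.
Proof.
move=> mf f0 fy; have W0 := wint_ge0 alpha0 mf f0.
exists (fine (W f)); first by rewrite fine_ge0.
by rewrite fineK// ge0_fin_numE.
Qed.

Lemma wint_le_lin (a b : R) f g h : 0 <= a -> 0 <= b ->
  measurableN f -> measurableN g -> measurableN h ->
  (forall x, 0 <= f x) -> (forall x, 0 <= g x) -> (forall x, 0 <= h x) ->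
  (forall x, f x <= a * g x + b * h x) -> (W f <= a%:E * W g + b%:E * W h)%E.
Proof.
move=> a0 b0 mf mg mh f0 g0 h0 fgh.
rewrite -!wintZ// -wintD//; last 4 first.
- by apply: measurableN_M => //; exact: measurableN_cst.
- by move=> x; rewrite mulr_ge0.
- by apply: measurableN_M => //; exact: measurableN_cst.
- by move=> x; rewrite mulr_ge0.
apply: le_wint => //.
by apply: measurableN_D; apply: measurableN_M => //; exact: measurableN_cst.
Qed.

Lemma measurable_coord i : measurableN (fun x : 'rV[R]_N => x 0 i).
Proof. apply: continuous_measurableN; exact: cont_coord. Qed.

Lemma wint0 : W (fun=> 0) = 0%E.
Proof.
rewrite (wintE alpha0 ltr01)//; last exact: measurableN_cst.
by under eq_integral do rewrite mul0r mulr0; rewrite integral0.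
Qed.

Lemma measurable_indic_coord0 (j : 'I_N) :
  measurableN (fun x : 'rV[R]_N => \1_[set 0 : R] (x 0 j)).
Proof.
have m0 : measurable_fun setT (\1_[set 0 : R] : R -> R).
  by apply: measurable_indic; exact: measurable_set1.
exact: (measurableT_comp m0 (measurable_coord j)).
Qed.

(** Every line in the direction [j] meets the hyperplane in one point, which is null. *)
Lemma wint_hyperplane (j : 'I_N) f : measurableN f -> (forall x, 0 <= f x) ->
  W (fun x => f x * \1_[set 0 : R] (x 0 j)) = 0%E.
Proof.
move=> mf f0; have mfi := measurableN_M mf (measurable_indic_coord0 j).
have fi0 x : 0 <= f x * \1_[set 0 : R] (x 0 j) by rewrite mulr_ge0.
apply/eqP; rewrite eq_le wint_ge0// andbT -wint0.
apply: (le_wint_slice alpha0 (j := j)) => //; first exact: measurableN_cst.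
move=> x; under [leRHS]eq_integral do rewrite mul0r.
rewrite integral0 -(@integral_Sset1 _ (fun s => (f (rset x j s) *
  \1_[set 0] (rset x j s 0 j) * s `^ alpha j)%:E) (dom (alpha j) `&` [set 0]) 0)//.
rewrite integral_mkcond [leRHS]integral_mkcond le_eqVlt; apply/orP; left; apply/eqP.
apply: eq_integral => s _; rewrite !patchE in_setI; case: (s \in dom _) => //=.
by case: ifPn => // s0; rewrite rsetE indicE (negbTE s0) mulr0 mul0r.
Qed.

(* The truncations are bounded by multiples of [f x * sqn x]. *)
Lemma wint_le_trunc (j : 'I_N) f (C : \bar R) :
  measurableN f -> (forall x, 0 <= f x) ->
  (forall m : nat, (W (fun x => f x * Num.min 1 (m%:R * x 0 j ^+ 2))%R <= C)%E) ->
  (W f <= C)%E.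
Proof.
move=> mf f0 fC.
pose i0 x : R := \1_[set 0 : R] (x 0 j).
have mi := @measurable_indic_coord0 j.
have i01 x : 0 <= 1 - i0 x by rewrite subr_ge0 /i0 indicE; case: (_ \in _).
have mi1 : measurableN (fun x => 1 - i0 x).
  by apply: measurableN_B => //; exact: measurableN_cst.
have mfi1 := measurableN_M mf mi1.
have fi10 x : 0 <= f x * (1 - i0 x) by exact: mulr_ge0.
(* The truncation is [0] on the hyperplane [x 0 j = 0] for every [m], so the truncated functions
   increase to [f] only off it. The hyperplane is null and is removed beforehand. *)
have -> : W f = W (fun x => f x * (1 - i0 x)).
  transitivity (W (fun x => f x * i0 x + f x * (1 - i0 x))).
    by congr wint; apply/funext => x; ring.
  rewrite wintD//; first by rewrite wint_hyperplane// add0e.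
    by apply: measurableN_M.
  by move=> x; rewrite mulr_ge0.
pose F (m : nat) x : R := f x * Num.min 1 (m%:R * x 0 j ^+ 2).
have F0 m x : 0 <= F m x.
  by rewrite mulr_ge0// le_min ler01 mulr_ge0// sqr_ge0.
have mF m : measurableN (F m).
  apply: measurableN_M => //.
  apply: measurable_minr; first exact: measurable_cst.
  apply: measurable_funM => //; apply: measurable_funX.
  exact: (measurable_coord j).
pose G m (t : N.-tuple R) := (ZN alpha 1 * (F m (row_of_tuple t) *
  expR (1 * sqn (row_of_tuple t))))%:E.
have Z0 := ZN_gt0 alpha0 (@ltr01 R).
have mG m : measurable_fun setT (G m).
  apply/measurable_EFinP; apply: measurable_funM => //; apply: measurable_funM.
    exact: mF.
  exact: measurableN_expsqn.
have G0 m t : (0 <= G m t)%E.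
  rewrite lee_fin; apply: mulr_ge0; first exact: ltW.
  by apply: mulr_ge0; [exact: F0|exact: expR_ge0].
have Gnd t : nondecreasing_seq (G ^~ t).
  move=> m p mp; rewrite lee_fin ler_pM2l// ler_pM2r ?expR_gt0//.
  rewrite ler_wpM2l// le_min !ge_min lexx/=; apply/orP; right.
  by rewrite ler_wpM2r ?sqr_ge0// ler_nat.
have Gcvg t : G ^~ t @ \oo --> (ZN alpha 1 * (f (row_of_tuple t) *
    (1 - i0 (row_of_tuple t)) * expR (1 * sqn (row_of_tuple t))))%:E.
  apply: cvg_near_cst.
  set y := row_of_tuple t 0 j.
  have [y0|y0] := eqVneq y 0.
    near=> m; rewrite /G /F -/y y0 expr0n/= mulr0 min_r ?ler01//.
    by rewrite /i0 -/y y0 indicE mem_set// subrr.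
  have y2 : 0 < y ^+ 2 by rewrite exprn_even_gt0.
  exists (Num.truncn (y ^+ 2)^-1).+1 => // m /= ym.
  rewrite /G /F -/y min_l.
    by rewrite /i0 -/y indicE memNset ?subr0// => /eqP; rewrite (negbTE y0).
  rewrite -ler_pdivrMr// div1r (le_trans (ltW (truncnS_gt _)))// ler_nat//.
rewrite (wintE alpha0 ltr01)//.
have := @cvg_monotone_convergence _ _ _ (PN alpha0 ltr01) setT measurableT G mG
  (fun m t _ => G0 m t) (fun t _ => Gnd t).
under eq_integral do rewrite (cvg_lim _ (Gcvg _))//.
move=> cv; rewrite -(cvg_lim _ cv)//; apply: lime_le.
  by apply/cvg_ex; eexists; exact: cv.
near=> m; have := fC m; rewrite (wintE alpha0 ltr01)//; [exact: mF|exact: F0].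
Unshelve. all: by end_near. Qed.

Lemma cont_sum (F : 'I_N -> 'rV[R]_N -> R) : (forall i, continuous (F i)) ->
  continuous (fun x => \sum_i F i x).
Proof.
move=> cF x; apply: cvg_big; [exact: add_continuous|exact: nbhs_filter|].
by move=> i _; exact: cF.
Qed.

Lemma cvg0_le (w : nat -> \bar R) (e : R) : w @ \oo --> 0%E -> 0 < e ->
  \forall k \near \oo, (w k <= e%:E)%E.
Proof.
move=> /fine_cvgP [wfin /cvgrPdist_lt /(_ e)] + e0 => /(_ e0) we.
near=> k; have kfin : w k \is a fin_num by near: k.
rewrite -(fineK kfin) lee_fin (le_trans (ler_norm _))//.
rewrite -normrN -[X in `|X|]add0r ltW//; near: k; exact: we.
Unshelve. all: by end_near. Qed.

Lemma dA_ge0 u : (0 <= dA alpha u)%E.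
Proof.
by apply: le_ereal_inf_tmp => _ [c [l [_ ->]]]; exact: sqrte_ge0.
Qed.

Lemma dA_sqr_le u (b c : R) : 0 < b -> measurableN u ->
  (dA alpha u * dA alpha u <=
   W (fun x => (u x - c * expR (- (b / 2 * sqn x))) ^+ 2)%R)%E.
Proof.
move=> b0 mu; set w := W _.
have w0 : (0 <= w)%E.
  apply: wint_ge0 => //; last by move=> x; exact: sqr_ge0.
  apply: measurableN_X; apply: measurableN_B => //.
  apply: measurableN_M; first exact: measurableN_cst.
  by apply: continuous_measurableN; exact: cont_expNsqn.
have dw : (dA alpha u <= sqrte w)%E.
  (* The width [l] with [1 / (2 * l ^+ 2) = b / 2]. *)
  apply: ereal_inf_lbound; exists c, (Num.sqrt b^-1); split.
    by rewrite gt_eqF// sqrtr_gt0 invr_gt0.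
  rewrite /w; congr (sqrte (wint _ _)); apply/funext => x.
  rewrite sqr_sqrtr ?invr_ge0 ?ltW//.
  by congr ((_ - _ * expR (- _)) ^+ 2); field; rewrite gt_eqF.
rewrite -[leRHS]sqr_sqrte// expe2.
by apply: lee_pmul => //; exact: dA_ge0.
Qed.

Hypothesis N0 : (0 < N)%N.

Lemma dimA_gt0 : 0 < dimA alpha.
Proof.
by rewrite ltr_pwDl ?ltr0n// sumr_ge0.
Qed.

Section approximation.
Variables (u : 'rV[R]_N -> R) (g : 'I_N -> 'rV[R]_N -> R).
Variable v : nat -> 'rV[R]_N -> R.
Hypotheses (mu : measurableN u) (mg : forall i, measurableN (g i)).
Hypothesis C1v : forall k, C1 (v k).
Hypothesis supv : forall k, exists T, supported T (v k).

Let A k := W (fun x => \sum_i ('D_(ej R i) (v k) x - g i x) ^+ 2).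
Let B k := W (fun x => (v k x - u x) ^+ 2 * sqn x).

Hypothesis cvA : A @ \oo --> 0%E.
Hypothesis cvB : B @ \oo --> 0%E.

Let mv k : measurableN (v k).
Proof. by apply: continuous_measurableN; have [] := C1v k. Qed.

Let mdv k i : measurableN ('D_(ej R i) (v k)).
Proof. by apply: continuous_measurableN; have [_ cdv _] := C1v k; exact: cdv. Qed.

Let msum (F : 'I_N -> 'rV[R]_N -> R) : (forall i, measurableN (F i)) ->
  measurableN (fun x => \sum_i F i x ^+ 2).
Proof. by move=> mF; apply: measurableN_sum => i; exact: measurableN_X. Qed.

Let sum0 (F : 'I_N -> 'rV[R]_N -> R) x : 0 <= \sum_i F i x ^+ 2.
Proof. by apply: sumr_ge0 => i _; exact: sqr_ge0. Qed.

Let msq h : measurableN h -> measurableN (fun x => h x ^+ 2 * sqn x).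
Proof.
by move=> mh; apply: measurableN_M; [exact: measurableN_X|exact: measurable_sqn].
Qed.

Let sq0 h x : 0 <= h x ^+ 2 * sqn x.
Proof. by rewrite mulr_ge0 ?sqr_ge0 ?sqn_ge0. Qed.

Let D := dimA alpha.

(* The gap inequality bounds [|v_k - v_l|_2] by the norm of [S_A]. *)
Let L2_close (d : R) k : 0 < d -> (A k <= d%:E)%E -> (B k <= d%:E)%E ->
  (W (fun x => (v k x - u x) ^+ 2)%R <= ((16 / D + 2) * d)%:E)%E.
Proof.
move=> d0 Ak Bk; have D0 := dimA_gt0; rewrite -/D in D0.
pose j0 : 'I_N := Ordinal N0.
have mvu k' : measurableN (fun x => v k' x - u x) by exact: measurableN_B.
apply: (wint_le_trunc (j := j0)).
- exact: measurableN_X.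
- by move=> x; exact: sqr_ge0.
move=> m.
have d1 : 0 < d / m.+1%:R by rewrite divr_gt0.
(* The index [l] depends on [m]: the truncated distance from [v l] to [u] costs [2 m] times [B l],
   which [B l <= d / m.+1] keeps below [2 d] uniformly in [m]. *)
have [l [Al Bl Bl1]] : exists l, [/\ (A l <= d%:E)%E, (B l <= d%:E)%E &
    (B l <= (d / m.+1%:R)%:E)%E].
  have [l _ H] := filterI (cvg0_le cvA d0) (filterI (cvg0_le cvB d0) (cvg0_le cvB d1)).
  by exists l; have [? []] := H l (leqnn _).
pose z x := v k x - v l x.
have C1z : C1 z by exact: C1_sub.
have [T Tz] : exists T, supported T z by exact: supported_sub.
have cz : continuous z by case: C1z.
have mz : measurableN z by exact: continuous_measurableN.
have G1 : (W (fun x => \sum_i 'D_(ej R i) z x ^+ 2)%R <= (4 * d)%:E)%E.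
  apply: (@le_trans _ _ (2%:E * A k + 2%:E * A l)%E).
    apply: wint_le_lin => //.
    - by apply: msum => i; apply: continuous_measurableN; case: C1z.
    - by apply: (msum (F := fun i x => _)) => i; exact: measurableN_B.
    - by apply: (msum (F := fun i x => _)) => i; exact: measurableN_B.
    - by move=> x; exact: (sum0 (fun i => 'D_(ej R i) z)).
    - by move=> x; exact: (sum0 (fun i x => _)).
    - by move=> x; exact: (sum0 (fun i x => _)).
    - move=> x; rewrite !mulr_sumr -big_split/=; apply: ler_sum => i _.
      rewrite (derive_sub i x (C1v k) (C1v l)).
      set p := 'D_(ej R i) (v k) x; set q := 'D_(ej R i) (v l) x; set r := g i x.
      have -> : 2 * (p - r) ^+ 2 + 2 * (q - r) ^+ 2 =
        (p - q) ^+ 2 + (p + q - 2 * r) ^+ 2 by ring.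
      by rewrite lerDl sqr_ge0.
  rewrite (_ : 4 * d = 2 * d + 2 * d); last by ring.
  by rewrite [leRHS]EFinD !EFinM; apply: leeD; apply: lee_wpmul2l.
have G2 : (W (fun x => z x ^+ 2 * sqn x)%R <= (4 * d)%:E)%E.
  apply: (@le_trans _ _ (2%:E * B k + 2%:E * B l)%E).
    apply: wint_le_lin => //.
    - exact: msq.
    - exact: (msq (h := fun x => _)).
    - exact: (msq (h := fun x => _)).
    - by move=> x; exact: (sq0 (fun x => _)).
    - by move=> x; exact: (sq0 (fun x => _)).
    - move=> x; rewrite [leRHS](_ : _ = (2 * (v k x - u x) ^+ 2 +
        2 * (v l x - u x) ^+ 2) * sqn x); last by ring.
      rewrite ler_wpM2r ?sqn_ge0// /z; set p := v k x; set q := v l x; set r := u x.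
      have -> : 2 * (p - r) ^+ 2 + 2 * (q - r) ^+ 2 =
        (p - q) ^+ 2 + (p + q - 2 * r) ^+ 2 by ring.
      by rewrite lerDl sqr_ge0.
  rewrite (_ : 4 * d = 2 * d + 2 * d); last by ring.
  by rewrite [leRHS]EFinD !EFinM; apply: leeD; apply: lee_wpmul2l.
have G3 : (W (fun x => z x ^+ 2)%R <= (8 / D * d)%:E)%E.
  have [c] := wint_gap alpha0 (@ltr01 R) C1z Tz.
  set w1 := W (fun x => z x ^+ 2)%R; set w2 := W (fun x => (z x - _) ^+ 2)%R => gap.
  have w20 : (0 <= w2)%E.
    apply: wint_ge0 => //; last by move=> x; exact: sqr_ge0.
    apply: continuous_measurableN; apply: contX; apply: contB => //.
    by apply: contM; [exact: cont_cst|exact: cont_expNsqn].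
  have : ((D / 2)%:E * w1 <= (4 * d)%:E)%E.
    apply: le_trans (_ : _ <= (D / 2)%:E * w1 + w2)%E _; first by rewrite leeDl.
    apply: le_trans gap _.
    rewrite (_ : 4 * d = (2 * 1)^-1 * (4 * d) + 1 / 2 * (4 * d)); last by field.
    by rewrite [leRHS]EFinD !EFinM; apply: leeD; apply: lee_wpmul2l => //;
      rewrite lee_fin ?invr_ge0 ?mulr1.
  rewrite -lee_pdivlMl ?divr_gt0// => /le_trans; apply.
  by rewrite -EFinM lee_fin le_eqVlt; apply/orP; left; apply/eqP; field; rewrite gt_eqF.
have G4 : (W (fun x => (v k x - u x) ^+ 2 * Num.min 1 (m%:R * x 0 j0 ^+ 2))%R <=
    2%:E * W (fun x => z x ^+ 2)%R + (2 * m%:R)%:E * B l)%E.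
  apply: wint_le_lin => //.
  - apply: measurableN_M; first exact: measurableN_X.
    apply: measurable_minr; first exact: measurable_cst.
    apply: measurable_funM => //; apply: measurable_funX.
    exact: (measurable_coord j0).
  - exact: measurableN_X.
  - exact: (msq (h := fun x => _)).
  - move=> x; rewrite mulr_ge0 ?sqr_ge0// le_min ler01 mulr_ge0// sqr_ge0//.
  - by move=> x; exact: sqr_ge0.
  - by move=> x; exact: (sq0 (fun x => _)).
  move=> x; set t := Num.min _ _.
  have t1 : t <= 1 by rewrite ge_min lexx.
  have ts : t <= m%:R * sqn x.
    rewrite ge_min; apply/orP; right; rewrite ler_wpM2l//.
    by rewrite /sqn (bigD1 j0)//= lerDl sumr_ge0// => i _; exact: sqr_ge0.
  have t0 : 0 <= t by rewrite le_min ler01 mulr_ge0// sqr_ge0.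
  rewrite /z; set p := v k x; set q := v l x; set r := u x.
  have h1 : (p - r) ^+ 2 <= 2 * (p - q) ^+ 2 + 2 * (q - r) ^+ 2.
    have -> : 2 * (p - q) ^+ 2 + 2 * (q - r) ^+ 2 =
      (p - r) ^+ 2 + (p + r - 2 * q) ^+ 2 by ring.
    by rewrite lerDl sqr_ge0.
  apply: (@le_trans _ _ ((2 * (p - q) ^+ 2 + 2 * (q - r) ^+ 2) * t)).
    by rewrite ler_wpM2r.
  rewrite mulrDl; apply: lerD; first by rewrite ler_piMr// mulr_ge0 ?sqr_ge0.
  have -> : 2 * m%:R * ((q - r) ^+ 2 * sqn x) = 2 * (q - r) ^+ 2 * (m%:R * sqn x) by ring.
  by rewrite ler_wpM2l// mulr_ge0 ?sqr_ge0.
apply: le_trans G4 _.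
(* The gap inequality at [b = 1] bounds the squared norm of [v k - v l] by [8 d / D]; doubled, it
   gives [16 / D]. The summand [2] pays for the truncated remainder. *)
rewrite (_ : (16 / D + 2) * d = 2 * (8 / D * d) + 2 * d); last by field; rewrite gt_eqF.
rewrite [leRHS]EFinD; apply: leeD; first by rewrite [leRHS]EFinM; apply: lee_wpmul2l.
apply: (@le_trans _ _ ((2 * m%:R)%:E * (d / m.+1%:R)%:E)%E).
  by apply: lee_wpmul2l => //; rewrite lee_fin mulr_ge0.
rewrite -EFinM lee_fin -!mulrA ler_pM2l// mulrA ler_pdivrMr//.
by rewrite mulrC ler_pM2l// ler_nat.
Qed.

Let K : R := 16 / D + 2.

Let K0 : 0 <= K.
Proof. by rewrite addr_ge0// divr_ge0// ltW// dimA_gt0. Qed.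

Let approx_real (b : R) k : 0 < b ->
  exists P S V Q c, [/\ W (fun x => \sum_i 'D_(ej R i) (v k) x ^+ 2) = P%:E,
    W (fun x => v k x ^+ 2 * sqn x) = S%:E,
    W (fun x => v k x ^+ 2) = V%:E &
    W (fun x => (v k x - c * expR (- (b / 2 * sqn x))) ^+ 2) = Q%:E /\
    D / 2 * V + Q <= (2 * b)^-1 * P + b / 2 * S].
Proof.
move=> b0; have [T Tv] := supv k; have [cv cdv dv] := C1v k.
have [c] := wint_gap alpha0 b0 (C1v k) Tv.
have mQ : measurableN (fun x => (v k x - c * expR (- (b / 2 * sqn x))) ^+ 2).
  apply: continuous_measurableN; apply: contX; apply: contB => //.
  by apply: contM; [exact: cont_cst|exact: cont_expNsqn].
have [P P0 PE] : exists2 r, 0 <= r &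
    W (fun x => \sum_i 'D_(ej R i) (v k) x ^+ 2) = r%:E.
  apply: wint_fin; first exact: msum.
    by move=> x; exact: (sum0 (fun i => 'D_(ej R i) (v k))).
  apply: (@wint_supported_lty _ _ _ alpha0 _ (T + 1)).
  - by apply: cont_sum => i; apply: contX; exact: cdv.
  - move=> x i Tx; apply: big1 => j _.
    by rewrite (supported_derive j Tv Tx) expr0n.
  - by move=> x; exact: (sum0 (fun i => 'D_(ej R i) (v k))).
have [S S0 SE] : exists2 r, 0 <= r & W (fun x => v k x ^+ 2 * sqn x) = r%:E.
  apply: wint_fin => //; first exact: msq.
  apply: (@wint_supported_lty _ _ _ alpha0 _ T) => //.
  - by apply: contM; [exact: contX|exact: continuous_sqn].
  - by move=> x i Tx; rewrite (Tv x i Tx) expr0n/= mul0r.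
have [V V0 VE] : exists2 r, 0 <= r & W (fun x => v k x ^+ 2) = r%:E.
  apply: wint_fin; [exact: measurableN_X|by move=> x; exact: sqr_ge0|].
  apply: (@wint_supported_lty _ _ _ alpha0 _ T) => //.
  - exact: contX.
  - by move=> x i Tx; rewrite (Tv x i Tx) expr0n.
  - by move=> x; exact: sqr_ge0.
rewrite PE SE VE -!EFinM -EFinD.
(* The Gaussian is not compactly supported, so the finiteness of this integral is drawn from the gap
   inequality, whose right-hand side is already finite. *)
have [Q Q0 QE] : exists2 r, 0 <= r &
    W (fun x => (v k x - c * expR (- (b / 2 * sqn x))) ^+ 2) = r%:E \/
    W (fun x => (v k x - c * expR (- (b / 2 * sqn x))) ^+ 2) = +oo%E.
  have [H|H] := ltP (W (fun x => (v k x - c * expR (- (b / 2 * sqn x))) ^+ 2)) +oo%E.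
    have [|r r0 rE] := wint_fin mQ _ H; first by move=> x; exact: sqr_ge0.
    by exists r => //; left.
  by exists 0 => //; right; apply/eqP; rewrite eq_le leey.
case: QE => QE; rewrite QE; last by rewrite addey// leye_eq.
rewrite -EFinD lee_fin => H; exists P, S, V, Q, c; split=> //; split.
Qed.

(** All integrals being finite, the claim is about real numbers, and [le_sqrt_prod] reduces it to
    one inequality for each [b]. There [v k] replaces [u] at the price of [d] in the two integrals
    of the $S_A$ norm and of [K * d] in the two $L^2$ ones. *)
Lemma deltaA_approx_ge : (dA alpha u * dA alpha u <= deltaA alpha u g)%E.
Proof.
have D0 := dimA_gt0; rewrite -/D in D0.
have small d : 0 < d -> exists k, (A k <= d%:E)%E /\ (B k <= d%:E)%E.
  move=> d0; have [k _ H] := filterI (cvg0_le cvA d0) (cvg0_le cvB d0).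
  by exists k; exact: H k (leqnn _).
have mgs : measurableN (fun x => \sum_i g i x ^+ 2) by exact: msum.
have mus := msq mu.
have mu2 : measurableN (fun x => u x ^+ 2) by exact: measurableN_X.
have mA k : measurableN (fun x => \sum_i ('D_(ej R i) (v k) x - g i x) ^+ 2).
  by apply: (msum (F := fun i x => _)) => i; exact: measurableN_B.
have mB k : measurableN (fun x => (v k x - u x) ^+ 2 * sqn x).
  by apply: (msq (h := fun x => _)); exact: measurableN_B.
have mC k : measurableN (fun x => (v k x - u x) ^+ 2).
  by apply: measurableN_X; exact: measurableN_B.
have ltyD (x y : R) (z w : \bar R) : 0 <= x -> 0 <= y -> (z <= x%:E)%E -> (w <= y%:E)%E ->
    (2%:E * z + 2%:E * w < +oo)%E.
  move=> x0 y0 zx wy; apply: (@le_lt_trans _ _ (2%:E * x%:E + 2%:E * y%:E)%E).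
    by apply: leeD; apply: lee_wpmul2l.
  by rewrite -!EFinM -EFinD ltry.
(* A single approximant at distance at most [1] makes the integrals of [u] and [g] finite. *)
have [k1 [Ak1 Bk1]] := small 1 ltr01.
have Ck1 := L2_close ltr01 Ak1 Bk1.
have [P1 [S1 [V1 [Q1 [c1 [P1E S1E V1E _]]]]]] := approx_real k1 ltr01.
have two (x y : R) : x ^+ 2 <= 2 * y ^+ 2 + 2 * (y - x) ^+ 2.
  by have := sqrD_le x y (@ltr01 R); rewrite invr1 -(sqrrN (x - y)) opprB.
have [a a0 aE] : exists2 r, 0 <= r & W (fun x => \sum_i g i x ^+ 2) = r%:E.
  apply: wint_fin; [exact: mgs|by move=> x; exact: sum0|].
  apply: (@le_lt_trans _ _ (2%:E * W (fun x => \sum_i 'D_(ej R i) (v k1) x ^+ 2)%R + 2%:E * A k1)%E).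
    apply: wint_le_lin => //.
    - exact: msum.
    - by move=> x; exact: (sum0 (fun i => 'D_(ej R i) (v k1))).
    - by move=> x; exact: (sum0 (fun i x => _)).
    - by move=> x; rewrite !mulr_sumr -big_split/=; apply: ler_sum => i _.
  apply: (ltyD P1 1) => //; last by rewrite P1E.
  rewrite -lee_fin -P1E; apply: wint_ge0 => //; first exact: msum.
  by move=> x; exact: (sum0 (fun i => 'D_(ej R i) (v k1))).
have [s s0 sE] : exists2 r, 0 <= r & W (fun x => u x ^+ 2 * sqn x) = r%:E.
  apply: wint_fin; [exact: mus|exact: sq0|].
  apply: (@le_lt_trans _ _ (2%:E * W (fun x => v k1 x ^+ 2 * sqn x)%R + 2%:E * B k1)%E).
    apply: wint_le_lin => //.
    - exact: msq.
    - by move=> x; exact: (sq0 (fun x => _)).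
    - move=> x; rewrite [leRHS](_ : _ = (2 * v k1 x ^+ 2 +
        2 * (v k1 x - u x) ^+ 2) * sqn x); last by ring.
      by rewrite ler_wpM2r ?sqn_ge0.
  apply: (ltyD S1 1) => //; last by rewrite S1E.
  by rewrite -lee_fin -S1E; apply: wint_ge0 => //; exact: msq.
have [U U0 UE] : exists2 r, 0 <= r & W (fun x => u x ^+ 2) = r%:E.
  apply: wint_fin; [exact: mu2|by move=> x; exact: sqr_ge0|].
  apply: (@le_lt_trans _ _ (2%:E * W (fun x => v k1 x ^+ 2)%R +
      2%:E * W (fun x => (v k1 x - u x) ^+ 2)%R)%E).
    apply: wint_le_lin => //.
    - exact: measurableN_X.
    - by move=> x; exact: sqr_ge0.
    - by move=> x; exact: sqr_ge0.
    - by move=> x; exact: sqr_ge0.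
  apply: (ltyD V1 K) => //; last 2 first.
  - by rewrite V1E.
  - by rewrite mulr1 in Ck1.
  rewrite -lee_fin -V1E; apply: wint_ge0 => //; first exact: measurableN_X.
  by move=> x; exact: sqr_ge0.
have eta (x y e : R) : 0 < e -> x ^+ 2 <= (1 + e) * y ^+ 2 + (1 + e^-1) * (y - x) ^+ 2.
  by move=> e0; have := sqrD_le x y e0; rewrite -(sqrrN (x - y)) opprB.
(* The competitor [c = 0] bounds the distance by the norm of [u]. *)
have [d2 d20 d2E] : exists2 r, 0 <= r & (dA alpha u * dA alpha u = r%:E)%E.
  have := dA_sqr_le 0 ltr01 mu.
  under [X in (_ <= W X)%E]eq_fun do rewrite mul0r subr0.
  rewrite UE => dU; have d0 : (0 <= dA alpha u * dA alpha u)%E.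
    by rewrite mule_ge0// dA_ge0.
  exists (fine (dA alpha u * dA alpha u)); first by rewrite fine_ge0.
  by rewrite fineK// ge0_fin_numE// (le_lt_trans dU)// ltry.
rewrite /deltaA d2E aE sE UE -!EFinM -EFinB lee_fin lerBrDr -/D.
apply: le_sqrt_prod => // b b0.
have Y0 : 0 <= (2 * b)^-1 * a + b / 2 * s.
  by rewrite addr_ge0// mulr_ge0// ?invr_ge0 ?divr_ge0 ?mulr_ge0// ltW.
have L0 : 0 <= (2 * b)^-1 + b / 2 + (D / 2 + 1) * K.
  by rewrite !addr_ge0 ?mulr_ge0 ?addr_ge0 ?divr_ge0 ?invr_ge0 ?mulr_ge0// ltW.
apply: (le_of_approx Y0 L0) => e d e0 d0.
have e1 : 0 <= 1 + e by rewrite addr_ge0// ltW.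
have e2 : 0 <= 1 + e^-1 by rewrite addr_ge0// invr_ge0 ltW.
have [k [Ak Bk]] := small d d0.
have Ck := L2_close d0 Ak Bk; rewrite -/K in Ck.
have [P [S [V [Q [c [PE SE VE [QE gap]]]]]]] := approx_real k b0.
have cG : continuous (fun x : 'rV[R]_N => c * expR (- (b / 2 * sqn x))).
  by apply: contM; [exact: cont_cst|exact: cont_expNsqn].
have mG := continuous_measurableN cG.
have iP : P <= (1 + e) * a + (1 + e^-1) * d.
  rewrite -lee_fin -PE [leRHS]EFinD !EFinM -aE.
  apply: (@le_trans _ _ ((1 + e)%:E * W (fun x => \sum_i g i x ^+ 2)%R + (1 + e^-1)%:E * A k)%E).
    apply: wint_le_lin => //.
    - exact: msum.
    - by move=> x; exact: (sum0 (fun i => 'D_(ej R i) (v k))).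
    - by move=> x; exact: (sum0 (fun i x => _)).
    - move=> x; rewrite !mulr_sumr -big_split/=; apply: ler_sum => i _.
      exact: sqrD_le.
  by apply: leeD => //; apply: lee_wpmul2l; rewrite ?lee_fin.
have iS : S <= (1 + e) * s + (1 + e^-1) * d.
  rewrite -lee_fin -SE [leRHS]EFinD !EFinM -sE.
  apply: (@le_trans _ _ ((1 + e)%:E * W (fun x => u x ^+ 2 * sqn x)%R + (1 + e^-1)%:E * B k)%E).
    apply: wint_le_lin => //.
    - exact: msq.
    - by move=> x; exact: (sq0 (fun x => _)).
    - move=> x; rewrite [leRHS](_ : _ = ((1 + e) * u x ^+ 2 +
        (1 + e^-1) * (v k x - u x) ^+ 2) * sqn x); last by ring.
      by rewrite ler_wpM2r ?sqn_ge0// sqrD_le.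
  by apply: leeD => //; apply: lee_wpmul2l; rewrite ?lee_fin.
have iU : U <= (1 + e) * V + (1 + e^-1) * (K * d).
  rewrite -lee_fin -UE [leRHS]EFinD !EFinM -VE.
  apply: (@le_trans _ _ ((1 + e)%:E * W (fun x => v k x ^+ 2)%R +
      (1 + e^-1)%:E * W (fun x => (v k x - u x) ^+ 2)%R)%E).
    apply: wint_le_lin => //.
    - exact: measurableN_X.
    - by move=> x; exact: sqr_ge0.
    - by move=> x; exact: sqr_ge0.
    - by move=> x; exact: sqr_ge0.
    - by move=> x; exact: eta.
  by apply: leeD => //; apply: lee_wpmul2l; rewrite ?lee_fin// -EFinM.
have iQ : d2 <= (1 + e) * Q + (1 + e^-1) * (K * d).
  rewrite -lee_fin -d2E [leRHS]EFinD !EFinM -QE.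
  apply: le_trans (dA_sqr_le c b0 mu) _.
  apply: (@le_trans _ _ ((1 + e)%:E * W (fun x => (v k x - c * expR (- (b / 2 * sqn x))) ^+ 2)%R +
      (1 + e^-1)%:E * W (fun x => (v k x - u x) ^+ 2)%R)%E).
    apply: wint_le_lin => //.
    - by apply: measurableN_X; exact: measurableN_B.
    - by apply: measurableN_X; exact: measurableN_B.
    - by move=> x; exact: sqr_ge0.
    - by move=> x; exact: sqr_ge0.
    - by move=> x; exact: sqr_ge0.
    - move=> x; set G := c * _.
      by rewrite (_ : v k x - u x = (v k x - G) - (u x - G)) ?eta//; ring.
  by apply: leeD => //; apply: lee_wpmul2l; rewrite ?lee_fin// -EFinM.
set p := (2 * b)^-1 in gap Y0 L0 *; set q := b / 2 in gap Y0 L0 *.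
have p0 : 0 <= p by rewrite invr_ge0 mulr_ge0// ltW.
have q0 : 0 <= q by rewrite divr_ge0// ltW.
have D2 : 0 <= D / 2 by rewrite divr_ge0// ltW.
apply: (@le_trans _ _ ((1 + e) * (D / 2 * V + Q) + (1 + e^-1) * ((D / 2 + 1) * K * d))).
  have := ler_wpM2l D2 iU; lra.
apply: (@le_trans _ _ ((1 + e) * (p * ((1 + e) * a + (1 + e^-1) * d)
   + q * ((1 + e) * s + (1 + e^-1) * d)) + (1 + e^-1) * ((D / 2 + 1) * K * d))).
  rewrite lerD2r; apply: ler_wpM2l => //; apply: le_trans gap _.
  by apply: lerD; apply: ler_wpM2l.
(* The target carries [1 + e] on every error term, while the $L^2$ error comes here without it; the
   excess is this nonnegative quantity. *)
have h : 0 <= e * ((1 + e^-1) * ((D / 2 + 1) * K * d)).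
  apply: mulr_ge0; first exact: ltW.
  apply: mulr_ge0 => //; apply: mulr_ge0; last exact: ltW.
  by apply: mulr_ge0 => //; rewrite addr_ge0.
rewrite -subr_ge0; set z := (X in 0 <= X).
by rewrite (_ : z = e * ((1 + e^-1) * ((D / 2 + 1) * K * d)))// /z; ring.
Qed.

End approximation.

End limit.

(** * The extremal function *)

Section flat_function.
Context (R : realType).
Implicit Types (t y : R) (n : nat).

Lemma expr_le_expR y n : 0 <= y -> y ^+ n <= n`!%:R * expR y.
Proof.
move=> y0; case: n => [|n].
  by rewrite expr0 fact0 mul1r -expR0 ler_expR.
rewrite -ler_pdivrMl ?ltr0n ?fact_gt0// mulrC.
by apply: le_trans (expR_ge1Dxn n y0); rewrite lerDr.
Qed.

(* For [n = 0] this is the standard smooth function which is positive exactly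
   on the positive half-line; the family is stable under derivation. *)
Definition flat n t : R := if 0 < t then t ^- n * expR (- t^-1) else 0.

Lemma flat_ge0 n t : 0 <= flat n t.
Proof.
rewrite /flat; case: ifP => // t0.
by rewrite mulr_ge0 ?expR_ge0// invr_ge0 exprn_ge0// ltW.
Qed.

(** With [y = 1 / t], this is $y^{n+1} \le (n+1)!\,e^y$. A bound linear in [t] is what makes the
    difference quotients at [0] converge. *)
Lemma flat_le n t : flat n t <= n.+1`!%:R * `|t|.
Proof.
rewrite /flat; case: ifPn => t0; last by rewrite mulr_ge0.
rewrite expRN ler_pdivrMr ?expR_gt0// gtr0_norm// -mulrA mulrCA.
rewrite -ler_pdivrMl// -exprVn -exprS.
by apply: expr_le_expR; rewrite invr_ge0 ltW.
Qed.

Lemma flat0E n t : t <= 0 -> flat n t = 0.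
Proof. by rewrite /flat leNgt => /negbTE ->. Qed.

Lemma is_derive_flat n t :
  is_derive (t : R) (1 : R) (flat n) (- n%:R * flat n.+1 t + flat n.+2 t).
Proof.
have [t0|t0|->] := ltgtP t 0.
- rewrite !flat0E ?ltW// mulr0 addr0.
  apply: (near_eq_is_derive (f := cst 0)).
    near=> s; rewrite flat0E// ltW//; near: s.
    by apply: open_nbhs_nbhs; split; [exact: open_lt|].
- pose p y : R := y ^+ n * expR (- y).
  have dp y : is_derive (y : R) (1 : R) p (n%:R * y ^+ n.-1 * expR (- y) - p y).
    have d1 : is_derive (y : R) (1 : R) (fun y : R => expR (- y)) (- expR (- y)).
      by have := is_derive1_comp (is_derive_expR _) (is_deriveNid y 1); rewrite mulrN1.
    have d2 : is_derive (y : R) (1 : R) (fun y : R => y ^+ n) (n%:R * y ^+ n.-1).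
      elim: n {p} => [|k IH].
        by rewrite mul0r; under eq_fun do rewrite expr0; exact: is_derive_cst.
      under eq_fun do rewrite exprS; apply: is_derive_eq.
      rewrite /GRing.scale/= mulr1; case: k {IH} => [|k] /=; rewrite ?exprS; ring.
    rewrite /p; apply: is_derive_eq; rewrite /GRing.scale/=; ring.
  have dV : is_derive (t : R) (1 : R) (fun s : R => s^-1) (- t ^- 2).
    have := @is_deriveV _ (fun s : R => s) t 1 1 (lt0r_neq0 t0) (is_derive_id t 1).
    by rewrite /GRing.scale/= mulr1.
  apply: (near_eq_is_derive (f := p \o (fun s => s^-1))).
    near=> s; have s0 : 0 < s by near: s; apply: open_nbhs_nbhs; split; [exact: open_gt|].
    by rewrite /flat s0 /p/= exprVn.
  apply: is_derive_eq (is_derive1_comp (dp _) dV) _.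
  rewrite /flat t0 /p -!exprVn; case: n {p dp} => [|n] /=; last by rewrite !exprS; ring.
  by rewrite mul0r mul0r oppr0 !add0r !expr0; ring.
- rewrite !flat0E// mulr0 addr0.
  have cv : (fun h : R => h^-1 *: ((flat n \o shift 0) (h *: (1 : R)) - flat n 0)) @ 0^' --> (0 : R).
    have F0 : 0 < n.+2`!%:R :> R by rewrite ltr0n fact_gt0.
    apply/cvgrPdist_le => e e0; exists (e / n.+2`!%:R) => /=; first by rewrite divr_gt0.
    move=> h /=; rewrite !sub0r !normrN => he h0.
    rewrite /GRing.scale/= mulr1 addr0 (flat0E n (lexx 0)) subr0.
    (* The difference quotient of [flat n] at [0] is [flat n.+1], to which the linear bound
       applies. *)
    apply: (@le_trans _ _ (flat n.+1 h)).
      rewrite /flat; case: ifPn => hp; last by rewrite mulr0 normr0.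
      rewrite mulrA -!exprVn -exprS ger0_norm// mulr_ge0 ?expR_ge0//.
      by rewrite exprn_ge0// invr_ge0 ltW.
    apply: le_trans (flat_le _ _) _.
    by rewrite mulrC -ler_pdivlMr// ltW.
  split; first by apply/cvg_ex; exists 0.
  by apply: cvg_lim.
Unshelve. all: by end_near. Qed.

(** For [t = K - s > 0], both [t (1 - exp (- 1 / t)) <= 1] and [s (1 - exp (- 1 / t)) <= s] hold;
    adding them gives the bound. The error of the cutoff is of order [1 / K], with a polynomial
    weight that a Gaussian absorbs. *)
Lemma one_sub_flat_le (s K : R) : 0 <= s -> 0 < K ->
  0 <= 1 - flat 0 (K - s) <= (1 + s) / K.
Proof.
move=> s0 K0; apply/andP; split.
  rewrite subr_ge0 /flat; case: ifP => // t0.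
  by rewrite expr0 invr1 mul1r -expR0 ler_expR oppr_le0 invr_ge0 ltW.
rewrite ler_pdivlMr// /flat; case: ifPn => [t0|]; last first.
  by rewrite -leNgt subr_le0 subr0 mul1r => Ks; rewrite (le_trans Ks)// lerDr.
rewrite expr0 invr1 mul1r; set t := K - s in t0 *.
have KE : K = t + s by rewrite subrK.
have e0 := expR_ge0 (- t^-1).
have e1 : 1 - expR (- t^-1) <= t^-1.
  by have := expR_ge1Dx (- t^-1); lra.
have e2 : 1 - expR (- t^-1) <= 1 by rewrite gerBl.
have tV : t * t^-1 = 1 by rewrite divff// gt_eqF.
have ti0 : 0 < t^-1 by rewrite invr_gt0.
rewrite KE; have [t1|t1] := leP t 1; nra.
Qed.

(** [flat 2] is the derivative of [flat 0], so this controls the gradient of the cutoff. With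
    [y = 1 / t], use $y^2 e^{-y} \le y$ for the factor [t] of [K = t + s] and $y^2 e^{-y} \le 2$ for
    the factor [s]. *)
Lemma flat2_le (s K : R) : 0 <= s -> 0 < K ->
  0 <= flat 2 (K - s) <= 2 * ((1 + s) / K).
Proof.
move=> s0 K0; rewrite flat_ge0/= mulrA ler_pdivlMr// /flat.
case: ifPn => [t0|]; last by rewrite mul0r mulr_ge0// addr_ge0.
set t := K - s in t0 *.
have KE : K = t + s by rewrite subrK.
have tV : t * t^-1 = 1 by rewrite divff// gt_eqF.
have ti0 : 0 < t^-1 by rewrite invr_gt0.
have E0 := expR_gt0 t^-1.
have e1 : t ^- 2 * expR (- t^-1) <= 2.
  rewrite expRN ler_pdivrMr// -exprVn.
  by have := expr_le_expR 2 (ltW ti0); rewrite (_ : 2`! = 2)%N.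
have e2 : t ^- 2 * expR (- t^-1) <= t^-1.
  rewrite expRN ler_pdivrMr// -exprVn expr2 ler_pM2l//.
  by have := expR_ge1Dx t^-1; lra.
have e3 : 0 <= t ^- 2 * expR (- t^-1).
  by rewrite mulr_ge0 ?expR_ge0// -exprVn sqr_ge0.
set z := t ^- 2 * _ in e1 e2 e3 *.
rewrite KE; have [t1|t1] := leP t 1; nra.
Qed.

End flat_function.

(** * An algebra of smooth functions stable under partial derivatives *)

Section nice_functions.
Context (R : realType) (N : nat).
Implicit Types (f g : 'rV[R]_N -> R) (x : 'rV[R]_N).

Lemma slice_is_derive f x i d :
  is_derive (x 0 i : R) (1 : R) (fun s => f (rset x i s)) d ->
  is_derive x (ej R i) f d.
Proof.
move=> [H1 H2].
have E : (fun h : R => h^-1 *: ((f \o shift x) (h *: ej R i) - f x)) =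
   (fun h : R => h^-1 *: (((fun s => f (rset x i s)) \o shift (x 0 i)) (h *: (1 : R))
      - f (rset x i (x 0 i)))).
  apply/funext => h /=; rewrite -[in LHS](rset_id x i) rset_shift.
  by rewrite /GRing.scale/= mulr1.
by split; rewrite /derivable /derive E.
Qed.

Lemma sqn_rset x i s : sqn (rset x i s) = s ^+ 2 + (sqn x - x 0 i ^+ 2).
Proof.
rewrite /sqn (bigD1 i)//= rsetE [in RHS](bigD1 i)//= [x 0 i ^+ 2 + _]addrC addrK.
by congr (_ + _); apply: eq_bigr => j ji; rewrite mxE (negbTE ji).
Qed.

Lemma is_derive_coord x i j :
  is_derive x (ej R i) (fun y : 'rV[R]_N => y 0 j) (j == i)%:R.
Proof.
apply: slice_is_derive.
have -> : (fun s => rset x i s 0 j) = if j == i then id else cst (x 0 j).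
  by apply/funext => s; rewrite mxE; case: ifP.
by case: ifP => _; [exact: is_derive_id|exact: is_derive_cst].
Qed.

Lemma is_derive_radial (p p' : R -> R) x i :
  (forall t, is_derive (t : R) (1 : R) p (p' t)) ->
  is_derive x (ej R i) (fun y : 'rV[R]_N => p (sqn y)) (2 * x 0 i * p' (sqn x)).
Proof.
move=> dp; apply: slice_is_derive.
under eq_fun do rewrite sqn_rset.
have h : is_derive (x 0 i : R) (1 : R)
    (fun s : R => s ^+ 2 + (sqn x - x 0 i ^+ 2)) (2 * x 0 i).
  by apply: is_derive_eq; rewrite /GRing.scale/=; ring.
have := is_derive1_comp (dp _) h.
by rewrite [_ + (_ - _)]addrC subrK mulrC.
Qed.

(** Closed under partial derivatives, with continuous members; derivatives of all orders are then
    handled by structural induction. The index [n] of [nice_flat] is free because differentiation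
    raises it. *)
Inductive nice : ('rV[R]_N -> R) -> Prop :=
| nice_cst c : nice (fun=> c)
| nice_coord i : nice (fun x => x 0 i)
| nice_add f g : nice f -> nice g -> nice (fun x => f x + g x)
| nice_mul f g : nice f -> nice g -> nice (fun x => f x * g x)
| nice_exp : nice (fun x => expR (- (sqn x / 2)))
| nice_flat n K : nice (fun x => flat n (K - sqn x)).

Lemma is_derive_expNhalf (t : R) :
  is_derive (t : R) (1 : R) (fun s : R => expR (- (s / 2))) (- 2^-1 * expR (- (t / 2))).
Proof.
have h : is_derive (t : R) (1 : R) (fun s : R => - (s / 2)) (- 2^-1).
  by apply: is_derive_eq; rewrite /GRing.scale/=; ring.
by have := is_derive1_comp (is_derive_expR _) h; rewrite mulrC.
Qed.

Lemma is_derive_flat_sub n (K t : R) :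
  is_derive (t : R) (1 : R) (fun s : R => flat n (K - s))
    (n%:R * flat n.+1 (K - t) - flat n.+2 (K - t)).
Proof.
have h : is_derive (t : R) (1 : R) (fun s : R => K - s) (-1).
  by apply: is_derive_eq; ring.
have := is_derive1_comp (g := fun s : R => K - s) (is_derive_flat n (K - t)) h.
by rewrite mulrN1 mulNr opprD opprK.
Qed.

Lemma nice_derive f i : nice f ->
  exists2 df, nice df & forall x, is_derive x (ej R i) f (df x).
Proof.
elim=> [c|j|{}f g _ [df ndf fE] _ [dg ndg gE]|{}f g nf [df ndf fE] ng [dg ndg gE]||n K].
- by exists (fun=> 0); [exact: nice_cst|move=> x; exact: is_derive_cst].
- by exists (fun=> (j == i)%:R); [exact: nice_cst|move=> x; exact: is_derive_coord].
- exists (fun x => df x + dg x); first exact: nice_add.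
  by move=> x; exact: is_deriveD.
- exists (fun x => f x * dg x + g x * df x).
    by apply: nice_add; exact: nice_mul.
  by move=> x; exact: is_deriveM.
- exists (fun x => 2 * x 0 i * (- 2^-1 * expR (- (sqn x / 2)))).
    do 2 (apply: nice_mul; last by [exact: nice_exp|exact: nice_coord|
      apply: nice_mul; [exact: nice_cst|exact: nice_exp]]).
    exact: nice_cst.
  move=> x; exact: (is_derive_radial _ _ is_derive_expNhalf).
- exists (fun x => 2 * x 0 i * (n%:R * flat n.+1 (K - sqn x) + -1 * flat n.+2 (K - sqn x))).
    apply: nice_mul; first by apply: nice_mul; [exact: nice_cst|exact: nice_coord].
    by apply: nice_add; apply: nice_mul; [exact: nice_cst|exact: nice_flat|
      exact: nice_cst|exact: nice_flat].
  move=> x; have := is_derive_radial x i (is_derive_flat_sub n K).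
  by rewrite mulN1r.
Qed.

Lemma nice_continuous f : nice f -> continuous f.
Proof.
elim=> [c|j|{}f g _ cf _ cg|{}f g _ cf _ cg||n K].
- exact: cont_cst.
- exact: cont_coord.
- exact: contD.
- exact: contM.
- apply: (cont_comp (f := fun s => expR (- (s / 2)))); last exact: continuous_sqn.
  by move=> t; exact: is_derive_continuous (is_derive_expNhalf t).
- apply: (cont_comp (f := fun s => flat n (K - s))); last exact: continuous_sqn.
  by move=> t; exact: is_derive_continuous (is_derive_flat_sub n K t).
Qed.

Lemma nice_dpart s f : nice f -> nice (dpart s f).
Proof.
move=> nf; elim: s => //= i s /(nice_derive i) [df ndf dE].
rewrite (_ : 'D_(ej R i) (dpart s f) = df)//.
by apply/funext => x; have [] := dE x.
Qed.

Lemma nice_smooth f : nice f -> smooth f.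
Proof.
move=> nf s; have ns := nice_dpart s nf; split; first exact: nice_continuous.
by move=> x i; have [df _ dE] := nice_derive i ns; have [] := dE x.
Qed.

Lemma nice_C1 f : nice f -> C1 f.
Proof.
move=> /nice_smooth sf; split.
- by have [] := sf [::].
- by move=> i; have [] := sf [:: i].
- by move=> i x; have [_] := sf [::]; apply.
Qed.

End nice_functions.

(** * The extremal function belongs to $S_A$ *)

Section extremal.
Context (R : realType) (N : nat) (alpha : 'I_N -> R).
Hypothesis alpha0 : forall i, 0 <= alpha i.
Notation W := (wint alpha).
Variable j0 : 'I_N.
Hypothesis aj0 : alpha j0 = 0.
Implicit Types (x : 'rV[R]_N) (k : nat).

Definition hermite x : R := x 0 j0 * expR (- (sqn x / 2)).

(** The cutoff tends to [1] pointwise without being equal to [1] on balls. Being radial, it keeps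
    every normal derivative proportional to the normal coordinate. *)
Definition cutoff k x : R := hermite x * flat 0 (k.+1%:R - sqn x).

Lemma hermite_nice : nice hermite.
Proof. by apply: nice_mul; [exact: nice_coord|exact: nice_exp]. Qed.

Lemma cutoff_nice k : nice (cutoff k).
Proof. by apply: nice_mul; [exact: hermite_nice|exact: nice_flat]. Qed.

Lemma is_derive_hermite x j : is_derive x (ej R j) hermite
  (((j0 == j)%:R - x 0 j0 * x 0 j) * expR (- (sqn x / 2))).
Proof.
have d1 := is_derive_coord x j j0.
have d2 := is_derive_radial x j (@is_derive_expNhalf R).
rewrite /hermite; apply: is_derive_eq; rewrite /GRing.scale/=.
by set e := expR _; field.
Qed.

Lemma is_derive_cutoff x j k : is_derive x (ej R j) (cutoff k)
  (((j0 == j)%:R - x 0 j0 * x 0 j) * expR (- (sqn x / 2)) * flat 0 (k.+1%:R - sqn x)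
   - 2 * x 0 j * hermite x * flat 2 (k.+1%:R - sqn x)).
Proof.
have d1 := is_derive_hermite x j.
have d2 := is_derive_radial x j (@is_derive_flat_sub R 0 k.+1%:R).
rewrite /cutoff; apply: is_derive_eq; rewrite /GRing.scale/=; ring.
Qed.

Lemma derive_hermite j x : 'D_(ej R j) hermite x =
  ((j0 == j)%:R - x 0 j0 * x 0 j) * expR (- (sqn x / 2)).
Proof. by have [_ ->] := is_derive_hermite x j. Qed.

Lemma derive_cutoff j k x : 'D_(ej R j) (cutoff k) x =
  ((j0 == j)%:R - x 0 j0 * x 0 j) * expR (- (sqn x / 2)) * flat 0 (k.+1%:R - sqn x)
   - 2 * x 0 j * hermite x * flat 2 (k.+1%:R - sqn x).
Proof. by have [_ ->] := is_derive_cutoff x j k. Qed.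

Lemma sqr_coord_le x j : x 0 j ^+ 2 <= sqn x.
Proof.
by rewrite /sqn (bigD1 j)//= lerDl sumr_ge0// => i _; exact: sqr_ge0.
Qed.

(** For [j] different from [j0], the partial derivative contains the factor [x 0 j], which vanishes
    on the face; and [j0] carries no face, since [alpha j0 = 0]. *)
Lemma cutoff_Nstar k : Nstar alpha (cutoff k).
Proof.
split.
- exact: nice_smooth (cutoff_nice k).
- pose A : set 'rV[R]_N := [set x | forall i, `[- k.+1%:R, k.+1%:R]%classic (x 0 i)].
  have cA : compact A.
    apply: (@rV_compact R N (fun=> `[- k.+1%:R, k.+1%:R]%classic)) => i.
    exact: segment_compact.
  have clA : closed A by apply: compact_closed => //; exact: norm_hausdorff.
  apply: (subclosed_compact _ cA); first exact: closed_closure.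
  rewrite (closure_id A).1//; apply: closure_subset => x /= vx i.
  rewrite /= in_itv/= -ler_norml leNgt; apply: contra vx => xk.
  rewrite /cutoff flat0E ?mulr0// subr_le0 (le_trans _ (sqr_coord_le x i))//.
  rewrite -real_normK ?num_real//.
  have k1 : 1 <= k.+1%:R :> R by rewrite ler1n.
  by rewrite (le_trans _ (_ : k.+1%:R ^+ 2 <= _))// ?expr2 ?ler_peMr// ler_pM// ltW.
- move=> j aj x _ xj0.
  have jj0 : j0 == j = false by apply/eqP => jj0; move: aj; rewrite -jj0 aj0 ltxx.
  by rewrite derive_cutoff xj0 jj0 !mulr0 subrr !mul0r subrr.
Qed.

(** [384 = 4! * 2 ^ 4], from $y^4 \le 4!\,e^y$ at $y = (1 + |x|^2)/2$, which also produces
    $e^{1/2}$. *)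
Let C0 : R := 384 * expR 2^-1.

Let poly_bound x : (1 + sqn x) ^+ 4 * expR (- sqn x) <= C0 * expR (- (2^-1 * sqn x)).
Proof.
have s0 := sqn_ge0 x; set s := sqn x in s0 *.
have := @expr_le_expR R ((1 + s) / 2) 4 _.
rewrite divr_ge0 ?addr_ge0// => /(_ isT) H.
have E1 : expR ((1 + s) / 2) = expR 2^-1 * expR (- (2^-1 * s)) * expR s.
  by rewrite -!expRD; congr expR; field.
rewrite E1 in H.
rewrite expRN ler_pdivrMr ?expR_gt0// /C0.
move: H; rewrite expr_div_n ler_pdivrMr// => /le_trans; apply.
rewrite le_eqVlt; apply/orP; left; apply/eqP.
by rewrite (_ : 4`! = 24)%N// -!mulrA; ring.
Qed.

Let C0_ge0 : 0 <= C0.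
Proof. by apply: mulr_ge0; [exact: ler0n|exact: expR_ge0]. Qed.

Let bound k x : R := 36 * C0 / k.+1%:R * expR (- (2^-1 * sqn x)).

(** The squared errors are of order [1 / k.+1 ^ 2]; one factor is given up, and half of the Gaussian
    absorbs the polynomial. *)
Let le_bound k x y : y <= 36 * ((1 + sqn x) / k.+1%:R) ^+ 2 * (1 + sqn x) ^+ 2 * expR (- sqn x) ->
  y <= bound k x.
Proof.
move=> /le_trans; apply.
have K1 : 1 <= k.+1%:R :> R by rewrite ler1n.
have s0 := sqn_ge0 x; set s := sqn x in s0 *; set K := k.+1%:R in K1 *.
have K0 : 0 < K by lra.
rewrite (_ : _ * _ = 36 * ((1 + s) ^+ 4 * expR (- s)) / K / K); last first.
  by field; rewrite gt_eqF.
rewrite ler_pdivrMr// /bound -/K -/s.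
have -> : 36 * C0 / K * expR (- (2^-1 * s)) * K = 36 * (C0 * expR (- (2^-1 * s))).
  by field; rewrite gt_eqF.
rewrite ler_pdivrMr// (le_trans (_ : _ <= 36 * (C0 * expR (- (2^-1 * s))))) //.
  by rewrite ler_pM2l// poly_bound.
have p0 : 0 <= 36 * (C0 * expR (- (2^-1 * s))).
  apply: mulr_ge0; [exact: ler0n|apply: mulr_ge0; [exact: C0_ge0|exact: expR_ge0]].
exact: ler_peMr.
Qed.

Lemma sqr_hermite x : hermite x ^+ 2 = x 0 j0 ^+ 2 * expR (- sqn x).
Proof.
by rewrite /hermite exprMn [expR _ ^+ 2]expr2 -expRD -opprD -splitr.
Qed.

Let cutoff_close k x : (cutoff k x - hermite x) ^+ 2 * sqn x <= bound k x.
Proof.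
apply: le_bound; rewrite /cutoff.
have s0 := sqn_ge0 x; have K0 : 0 < k.+1%:R :> R by rewrite ltr0n.
have xs := sqr_coord_le x j0.
have /andP[h0 h1] := one_sub_flat_le s0 K0.
have -> : (hermite x * flat 0 (k.+1%:R - sqn x) - hermite x) ^+ 2 =
    hermite x ^+ 2 * (1 - flat 0 (k.+1%:R - sqn x)) ^+ 2 by ring.
rewrite sqr_hermite.
set m := (1 + sqn x) / _ in h1 *; set h := 1 - _ in h0 h1 *.
set e := expR _; have e0 : 0 <= e by exact: expR_ge0.
have hm : h ^+ 2 <= m ^+ 2 by rewrite ler_pXn2r// nnegrE// (le_trans h0).
rewrite (_ : _ * sqn x = h ^+ 2 * (x 0 j0 ^+ 2 * sqn x) * e); last by ring.
rewrite ler_wpM2r//.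
rewrite (le_trans (_ : _ <= m ^+ 2 * (sqn x * sqn x)))//.
  apply: ler_pM => //; [exact: sqr_ge0|by rewrite mulr_ge0// sqr_ge0|].
  exact: ler_wpM2r.
have -> : 36 * m ^+ 2 * (1 + sqn x) ^+ 2 = m ^+ 2 * (36 * (1 + sqn x) ^+ 2) by ring.
apply: ler_wpM2l; first exact: sqr_ge0.
have := sqr_ge0 (sqn x); nra.
Qed.

Let derive_cutoff_close k x :
  \sum_j ('D_(ej R j) (cutoff k) x - 'D_(ej R j) hermite x) ^+ 2 <= bound k x.
Proof.
apply: le_bound.
have s0 := sqn_ge0 x; have K0 : 0 < k.+1%:R :> R by rewrite ltr0n.
have xs := sqr_coord_le x j0.
have /andP[h0 h1] := one_sub_flat_le s0 K0.
have /andP[f0 f1] := flat2_le s0 K0.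
set m := (1 + sqn x) / _ in h1 f1 *.
set h := 1 - _ in h0 h1; set f := flat 2 _ in f0 f1.
have m0 : 0 <= m := le_trans h0 h1.
have s10 : 0 <= 1 + sqn x by rewrite addr_ge0.
have hm : h ^+ 2 <= m ^+ 2 by rewrite ler_pXn2r.
have fm : f ^+ 2 <= 4 * m ^+ 2.
  have -> : 4 * m ^+ 2 = (2 * m) ^+ 2 by ring.
  by rewrite ler_pXn2r// nnegrE mulr_ge0.
set e := expR (- sqn x); have e0 : 0 <= e by exact: expR_ge0.
have ee : expR (- (sqn x / 2)) ^+ 2 = e by rewrite expr2 -expRD -opprD -splitr.
(* [36 = 4 + 32]: the first part comes from the gradient of [hermite] times the cutoff error, the
   second from the gradient of the cutoff. *)
apply: (le_trans (_ : _ <= \sum_j m ^+ 2 * e * (4 * (j0 == j)%:R + 36 * x 0 j0 ^+ 2 * x 0 j ^+ 2))).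
  apply: ler_sum => j _; rewrite derive_cutoff derive_hermite.
  set d := (j0 == j)%:R; have dd : d ^+ 2 = d by rewrite /d; case: eqP; rewrite ?expr1n ?expr0n.
  set g := (d - _) * _.
  have gg : g ^+ 2 <= e * (2 * d + 2 * x 0 j0 ^+ 2 * x 0 j ^+ 2).
    rewrite /g exprMn ee mulrC ler_wpM2l// -{2}dd.
    have := sqr_ge0 (d + x 0 j0 * x 0 j); nra.
  (* The error splits into the derivative of [hermite] times [1 - flat 0] and [hermite] times the
     derivative of the cutoff. *)
  have -> : (g * flat 0 (k.+1%:R - sqn x) - 2 * x 0 j * hermite x * f - g) =
    - (g * h) - 2 * x 0 j * hermite x * f by rewrite /h; ring.
  apply: (le_trans (_ : _ <= 2 * (g ^+ 2 * h ^+ 2) + 8 * (x 0 j ^+ 2 * hermite x ^+ 2) * f ^+ 2)).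
    have := sqr_ge0 (g * h - 2 * x 0 j * hermite x * f); nra.
  have m2 : 0 <= m ^+ 2 by exact: sqr_ge0.
  have H1 : g ^+ 2 * h ^+ 2 <= e * (2 * d + 2 * x 0 j0 ^+ 2 * x 0 j ^+ 2) * m ^+ 2.
    by rewrite ler_pM ?sqr_ge0.
  have H2 : x 0 j ^+ 2 * hermite x ^+ 2 * f ^+ 2 <= x 0 j ^+ 2 * (x 0 j0 ^+ 2 * e) * (4 * m ^+ 2).
    by rewrite sqr_hermite ler_wpM2l// mulr_ge0 ?sqr_ge0// mulr_ge0// sqr_ge0.
  nra.
rewrite -mulr_sumr big_split/= -!mulr_sumr.
rewrite (bigD1 j0)//= eqxx big1 ?addr0 => [|j jj0]; last by rewrite eq_sym (negbTE jj0).
rewrite -/(sqn x) (_ : 36 * m ^+ 2 * _ * e = m ^+ 2 * e * (36 * (1 + sqn x) ^+ 2)); last by ring.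
rewrite ler_wpM2l ?mulr_ge0 ?sqr_ge0//.
have : x 0 j0 ^+ 2 * sqn x <= sqn x * sqn x by exact: ler_wpM2r.
have : 0 <= sqn x * sqn x by exact: mulr_ge0.
by move=> /=; rewrite expr2; lra.
Qed.

Let wint_bound_cvg (f : nat -> 'rV[R]_N -> R) : (forall k, measurableN (f k)) ->
  (forall k x, 0 <= f k x) -> (forall k x, f k x <= bound k x) ->
  (fun k => W (f k)) @ \oo --> 0%E.
Proof.
move=> mf f0 fb.
have C00 : 0 <= 36 * C0 by apply: mulr_ge0; [exact: ler0n|exact: C0_ge0].
have mE : measurableN (fun x : 'rV[R]_N => expR (- (2^-1 * sqn x))).
  exact: continuous_measurableN (@cont_expNsqn R N _).
apply: (@squeeze_cvge _ _ _ _ (fun=> 0%E) _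
  (fun k => (36 * C0 * ZN alpha 2^-1 * k.+1%:R^-1)%:E)).
- near=> k; apply/andP; split; first exact: wint_ge0.
  apply: (le_trans (le_wint alpha0 (mf k) (f0 k) (g := bound k) _ (fb k))).
    by apply: measurableN_M => //; exact: measurableN_cst.
  have e0 x : 0 <= expR (- (2^-1 * sqn x)) by exact: expR_ge0.
  have Kk : 0 <= 36 * C0 / k.+1%:R by exact: divr_ge0.
  by rewrite /bound (wintZ alpha0 Kk mE e0) wint_gauss// -EFinM lee_fin mulrAC.
- exact: cvg_cst.
- apply: cvg_EFin; first by near=> k.
  have -> : 0 = 36 * C0 * ZN alpha 2^-1 * 0 :> R by rewrite mulr0.
  by apply: cvgMr; exact: cvg_harmonic.
Unshelve. all: by end_near. Qed.

Let hermite_C1 : C1 hermite.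
Proof. exact: nice_C1 hermite_nice. Qed.

Let cutoff_C1 k : C1 (cutoff k).
Proof. exact: nice_C1 (cutoff_nice k). Qed.

Let mh : measurableN hermite.
Proof. by apply: continuous_measurableN; case: hermite_C1. Qed.

Let mdh i : measurableN ('D_(ej R i) hermite).
Proof. by apply: continuous_measurableN; case: hermite_C1. Qed.

Lemma hermite_SA : SA alpha hermite (fun i => 'D_(ej R i) hermite).
Proof.
split => //; exists cutoff; split; first exact: cutoff_Nstar.
- apply: wint_bound_cvg derive_cutoff_close => [k|k x].
    apply: measurableN_sum => i; apply: measurableN_X; apply: measurableN_B => //.
    by apply: continuous_measurableN; case: (cutoff_C1 k).
  by apply: sumr_ge0 => i _; exact: sqr_ge0.
- apply: wint_bound_cvg cutoff_close => [k|k x].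
    apply: measurableN_M; last exact: measurable_sqn.
    apply: measurableN_X; apply: measurableN_B => //.
    by apply: continuous_measurableN; case: (cutoff_C1 k).
  by rewrite mulr_ge0 ?sqr_ge0 ?sqn_ge0.
Qed.

End extremal.

(** * Parity and Gaussian moments on the line *)

Section line.
Context (R : realType).
Notation mu := (@lebesgue_measure R).

(** [F] and its reflection have the same integral, so [G] need only be compared with the even part
    of [F], from which odd cross terms disappear. *)
Lemma le_integral_reflection (F G : R -> R) :
  measurable_fun setT F -> measurable_fun setT G ->
  (forall s, 0 <= F s) -> (forall s, 0 <= G s) ->
  (forall s, 2 * G s <= F s + F (- s)) ->
  (\int[mu]_s (G s)%:E <= \int[mu]_s (F s)%:E)%E.
Proof.
move=> mF mG F0 G0 GF.
have mFe : measurable_fun setT (EFin \o F) by exact/measurable_EFinP.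
have mFN : measurable_fun setT (fun s : R => F (- s)).
  by apply: measurableT_comp => //; exact: oppr_measurable.
have FN : (\int[mu]_s (F (- s))%:E = \int[mu]_s (F s)%:E)%E.
  transitivity (\int[pushforward mu (-%R : R -> measurableTypeR R)]_(s in setT) (F s)%:E)%E.
    by rewrite ge0_integral_pushforward//=; move=> s _; rewrite lee_fin.
  apply: eq_measure_integral => //= A mA _; exact: lebesgue_measureN.
have FF : (2%:E * \int[mu]_s (F s)%:E = \int[mu]_s (F s + F (- s))%:E)%E.
  under [RHS]eq_integral do rewrite EFinD.
  rewrite ge0_integralD//.
  - by rewrite FN -[2]/(1 + 1)%R EFinD ge0_muleDl ?mul1e// lee_fin.
  - by move=> s _; rewrite lee_fin.
  - by move=> s _; rewrite lee_fin.
  - exact/measurable_EFinP.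
rewrite -(@lee_pmul2l _ 2%:E)// FF.
rewrite -ge0_integralZl//; last first.
- by move=> s _; rewrite lee_fin.
- exact/measurable_EFinP.
apply: ge0_le_integral => //.
- by move=> s _; rewrite lee_fin mulr_ge0.
- by apply/measurable_EFinP; apply: measurable_funM.
- by apply/measurable_EFinP; apply: measurable_funD.
- by move=> s _; rewrite lee_fin.
Qed.

Let tail (T : R) : 0 < T -> T * gauss 1 T <= T^-1.
Proof.
move=> T0; rewrite /gauss mul1r expRN ler_pdivrMr ?expR_gt0//.
rewrite ler_pdivlMl// -expr2 (le_trans _ (expR_ge1Dx _))//.
by rewrite lerDr.
Qed.

(** $2 s^2 e^{-s^2} - e^{-s^2}$ is the derivative of $-s e^{-s^2}$, whose boundary terms vanish at
    infinity. *)
Lemma le_gauss_second_moment :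
  (\int[mu]_s (gauss 1 s)%:E <= \int[mu]_s (2 * s ^+ 2 * gauss 1 s)%:E)%E.
Proof.
have cg x : {for x, continuous (gauss 1 : R -> R)}.
  exact: is_derive_continuous (is_derive_gauss 1 x).
have mg : measurable_fun setT (gauss 1 : R -> R) by apply: continuous_measurable_fun => x; exact: cg.
have cG x : {for x, continuous (fun s : R => 2 * s ^+ 2 * gauss 1 s)}.
  apply: cvgM; last exact: cg.
  by apply: cvgM; [exact: cvg_cst|exact: exprn_continuous].
have G0 s : 0 <= 2 * s ^+ 2 * gauss 1 s 
  by apply: mulr_ge0; [rewrite mulr_ge0 ?sqr_ge0|exact: expR_ge0].
have mG : measurable_fun setT (fun s : R => 2 * s ^+ 2 * gauss 1 s).
  by apply: continuous_measurable_fun => x; exact: cG.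
apply: le_integralT.
- exact/measurable_EFinP.
- by move=> s; rewrite lee_fin expR_ge0.
move=> p q pq; apply/lee_addgt0Pr => e e0.
(* The two boundary terms sum to at most [2 / T] by [tail]; the other bounds make [[- T, T]] contain
   [[p, q]]. *)
pose T : R := Num.max (2 / e) (Num.max `|p| `|q|).
have T0 : 0 < T by rewrite lt_max divr_gt0.
have TT : - T < T by rewrite gtrN.
pose B (s : R) := - (s * gauss 1 s).
pose B' (s : R) := 2 * s ^+ 2 * gauss 1 s - gauss 1 s.
have := @ftc_le R (fun s => 2 * s ^+ 2 * gauss 1 s) (gauss 1) B B' (- T) T TT.
move=> /(_ _ _ _ _ _)H.
have S1 : (\int[mu]_(x in `[p, q]) (gauss 1 x)%:E <= \int[mu]_(x in `[(- T)%R, T]) (gauss 1 x)%:E)%E.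
  apply: ge0_subset_integral => //.
  - apply/measurable_EFinP; exact: measurable_funTS.
  - by move=> x _; rewrite lee_fin expR_ge0.
  - move=> x /=; rewrite !in_itv/= => /andP[px xq]; apply/andP; split.
      by rewrite (le_trans _ px)// lerNl !le_max -normrN ler_norm !orbT.
    by rewrite (le_trans xq)// !le_max ler_norm !orbT.
apply: (le_trans S1).
have S2 : (\int[mu]_(x in `[(- T)%R, T]) (gauss 1 x)%:E <=
    \int[mu]_(x in `[(- T)%R, T]) (gauss 1 x)%:E + (B T - B (- T))%:E + e%:E)%E.
  rewrite -addeA leeDl// -EFinD lee_fin /B /gauss sqrrN -/(gauss 1 T) mulNr opprK -opprD.
  rewrite addrC subr_ge0 -mulr2n -mulr_natl.
  apply: (le_trans (ler_wpM2l _ (tail T0))) => //.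
  by rewrite ler_pdivrMr// mulrC -ler_pdivrMr// le_max lexx.
apply: (le_trans S2); rewrite leeD2r//; apply: le_trans (H _ _ _ _ _) _.
- move=> x _; rewrite /B.
  have d1 := is_derive_gauss 1 x.
  apply: is_derive_eq; rewrite /B' /GRing.scale/=; ring.
- by move=> x _; apply: cvgB; [exact: cG|exact: cg].
- by move=> x _; exact: cG.
- by move=> x _; exact: cg.
- by move=> x _; rewrite /B' addrCA subrr addr0.
apply: ge0_subset_integral => //.
- exact/measurable_EFinP.
- by move=> x _; rewrite lee_fin; exact: G0.
Qed.

End line.

Section null.
Context (R : realType) (N : nat) (alpha : 'I_N -> R).
Hypothesis alpha0 : forall i, 0 <= alpha i.
Notation W := (wint alpha).

(* Dividing by the density turns the integral of the indicator with respect to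
   Lebesgue measure into one with respect to a probability equivalent to [x^A dx]. *)
Lemma ae_eq_star_wint u v : measurableN u -> measurableN v ->
  ae_eq_star alpha u v -> W (fun x => (u x - v x) ^+ 2) = 0%E.
Proof.
move=> mu mv; rewrite /ae_eq_star => uv.
pose S : set 'rV[R]_N := Rstar alpha `&` [set y | u y <> v y].
pose r (t : N.-tuple R) : R := \prod_i rho1 (alpha i) 1 (tnth t i).
have r0 t : Rstar alpha (row_of_tuple t) -> 0 < r t.
  move=> tR; apply: prodr_gt0 => i _.
  have ti : dom (alpha i) (tnth t i) by move=> /tR; rewrite row_of_tupleE.
  rewrite /rho1 indicE mem_set// mul1r divr_gt0 ?rhoZ_gt0//.
  exact: rho_gt0.
have rge0 t : 0 <= r t by apply: prodr_ge0 => i _; exact: rho1_ge0.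
have mr : measurable_fun setT r.
  apply: measurable_prod => i _.
  by apply: measurableT_comp; [exact: measurable_rho1|exact: measurable_tnth].
have mR : measurableN (\1_(Rstar alpha) : _ -> R).
  rewrite /measurableN; under eq_fun do rewrite indic_Rstar.
  apply: measurable_prod => i _; under eq_fun do rewrite row_of_tupleE.
  apply: measurableT_comp; last exact: measurable_tnth.
  apply: measurable_indic; exact: measurable_dom.
have mS : measurableN (\1_S : _ -> R).
  have -> : (\1_S : _ -> R) = fun x => \1_(Rstar alpha) x * \1_[set~ 0] (u x - v x).
    apply/funext => x; rewrite /S indicI/=; congr (_ * _).
    rewrite !indicE.
    have [uvx|uvx] := pselect (u x = v x); first by rewrite uvx subrr !memNset// => /(_ erefl).
    by rewrite !mem_set//= => /eqP; rewrite subr_eq0 => /eqP.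
  apply: measurableN_M => //; rewrite /measurableN.
  have m1 : measurable_fun setT (\1_[set~ (0 : R)] : R -> R).
    by apply: measurable_indic; exact: measurableC.
  exact: measurableT_comp m1 (measurable_funB mu mv).
(* The reciprocal matters only on [S], a subset of [Rstar], where [r] is positive. *)
pose f t := (\1_S (row_of_tuple t) * r t `^ (-1))%:E.
have mf : measurable_fun setT f.
  apply/measurable_EFinP; apply: measurable_funM => //.
  by apply: measurableT_comp (measurable_powR _) mr.
have f0 t : (0 <= f t)%E.
  by rewrite lee_fin mulr_ge0 ?powR_ge0// indicE.
have If : (\int[PN alpha0 ltr01]_t f t = 0)%E.
  rewrite (integral_tprod (r := fun i => rho1 (alpha i) 1))//.
  - rewrite -[RHS]uv /intN; congr iint; apply/funext => t.
    rewrite -EFinM; congr EFin; rewrite -/(r t).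
    rewrite -/S indicE; case: (boolP (_ \in _)) => [|_]; last by rewrite !mul0r.
    move=> /set_mem[/r0 rt _].
    by rewrite mul1r powR_inv1// mulVf// gt_eqF.
  - by move=> i x; exact: rho1_ge0.
  - by move=> i g mg g0; exact: gprobE.
have fae : ae_eq (PN alpha0 ltr01) setT f (cst 0%E).
  apply/ae_eq_integral_abs => //; rewrite -[RHS]If.
  by apply: eq_integral => t _; rewrite gee0_abs.
pose h x : R := \1_(Rstar alpha) x * (u x - v x) ^+ 2.
have mh : measurableN h by apply: measurableN_M => //; apply: measurableN_X; exact: measurableN_B.
have h0 x : 0 <= h x by rewrite mulr_ge0 ?sqr_ge0// indicE.
have -> : W (fun x => (u x - v x) ^+ 2) = W h.
  rewrite /wint; congr intN; apply/funext => x; congr EFin; rewrite /h indicE.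
  by case: (_ \in _); rewrite !(mul1r, mul0r).
rewrite (wintE alpha0 ltr01)//.
rewrite (ae_eq_integral (cst 0%E))//; first by rewrite integral0.
  apply/measurable_EFinP; apply: measurable_funM => //.
  by apply: measurable_funM => //; exact: measurableN_expsqn.
move: fae; apply: filterS => t /= /(_ Logic.I) [ft] _.
suff -> : h (row_of_tuple t) = 0 by rewrite mul0r mulr0.
rewrite /h indicE; case: (boolP (_ \in _)) => [/set_mem tR|_]; last by rewrite mul0r.
rewrite mul1r; apply/eqP; rewrite sqrf_eq0 subr_eq0; apply/negPn/negP => /eqP tuv.
move: ft; rewrite indicE mem_set; last by split.
by rewrite mul1r => /eqP; rewrite gt_eqF// powR_gt0// r0.
Qed.

End null.

(** * The equality case *)

Section equality.
Context (R : realType) (N : nat) (alpha : 'I_N -> R).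
Hypothesis alpha0 : forall i, 0 <= alpha i.
Notation mu := (@lebesgue_measure R).
Notation W := (wint alpha).
Variable j0 : 'I_N.
Hypothesis aj0 : alpha j0 = 0.
Notation h := (@hermite R N j0).
Implicit Types (f g : 'rV[R]_N -> R) (x : 'rV[R]_N).

Let hC1 : C1 h.
Proof. exact: nice_C1 (hermite_nice R j0). Qed.

Let mh : measurableN h.
Proof. by apply: continuous_measurableN; case: hC1. Qed.

Let mdh i : measurableN ('D_(ej R i) h).
Proof. by apply: continuous_measurableN; case: hC1. Qed.

Let mE b : measurableN (fun x : 'rV[R]_N => expR (- (b * sqn x))).
Proof. exact: continuous_measurableN (@cont_expNsqn R N b). Qed.

(** As [alpha j0 = 0], lines parallel to the axis [j0] are complete and unweighted, so one-variable
    facts on $\mathbb{R}$ apply to them. *)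
Let le_wint_free f g : measurableN f -> (forall x, 0 <= f x) ->
  measurableN g -> (forall x, 0 <= g x) ->
  (forall x, \int[mu]_s (f (rset x j0 s))%:E <= \int[mu]_s (g (rset x j0 s))%:E)%E ->
  (W f <= W g)%E.
Proof.
move=> mf f0 mg g0 fg; apply: (le_wint_slice alpha0 (j := j0)) => // x.
have -> : dom (alpha j0) = setT.
  by apply/seteqP; split=> s //= _; rewrite /dom/= aj0 ltxx.
by under eq_integral do rewrite aj0 powRr0 mulr1;
  under [in leRHS]eq_integral do rewrite aj0 powRr0 mulr1.
Qed.

Let sqr_h x : h x ^+ 2 = x 0 j0 ^+ 2 * expR (- (1 * sqn x)).
Proof. by rewrite mul1r sqr_hermite. Qed.

(** Along the axis [j0], the second moment of $e^{-s^2}$ is compared with half of its mass. Both the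
    positivity of the norm of [h] and the upper bound on its deficit rest on this. *)
Let le_ZN_hermite : ((ZN alpha 1)%:E <= 2%:E * W (fun x => h x ^+ 2)%R)%E.
Proof.
rewrite -wint_gauss// -wintZ//; last 2 first.
- exact: measurableN_X.
- by move=> x; exact: sqr_ge0.
apply: le_wint_free.
- exact: mE.
- by move=> x; exact: expR_ge0.
- by apply: measurableN_M; [exact: measurableN_cst|exact: measurableN_X].
- by move=> x; rewrite mulr_ge0 ?sqr_ge0.
move=> x; pose K := expR (- (sqn x - x 0 j0 ^+ 2)).
have E1 s : expR (- (1 * sqn (rset x j0 s))) = K * gauss 1 s.
  by rewrite /K /gauss -expRD sqn_rset; congr expR; ring.
under eq_integral do rewrite E1 EFinM.
under [in leRHS]eq_integral => s _.
  rewrite sqr_h E1 rsetE (_ : 2 * _ = K * (2 * s ^+ 2 * gauss 1 s)); last by ring.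
  rewrite EFinM; over.
have mg : measurable_fun setT (gauss 1 : R -> R).
  by apply: continuous_measurable_fun => s; exact: is_derive_continuous (is_derive_gauss 1 s).
have K0 : 0 <= K by exact: expR_ge0.
rewrite !ge0_integralZl//.
- by rewrite lee_wpmul2l ?lee_fin// le_gauss_second_moment.
- apply/measurable_EFinP; apply: measurable_funM => //.
  by apply: measurable_funM => //; exact: measurable_funX.
- move=> s _; rewrite lee_fin; apply: mulr_ge0; last exact: expR_ge0.
  by rewrite mulr_ge0 ?sqr_ge0.
- exact/measurable_EFinP.
- by move=> s _; rewrite lee_fin expR_ge0.
Qed.

(* [h] is odd in [x_{j0}] and the Gaussian is even, so they are orthogonal. *)
Lemma le_hermite_gauss c b :
  (W (fun x => h x ^+ 2)%R <= W (fun x => (h x - c * expR (- (b * sqn x))) ^+ 2)%R)%E.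
Proof.
have mhc : measurableN (fun x => (h x - c * expR (- (b * sqn x))) ^+ 2).
  apply: measurableN_X; apply: measurableN_B => //.
  by apply: measurableN_M => //; exact: measurableN_cst.
have mh2 : measurableN (fun x => h x ^+ 2) by exact: measurableN_X.
apply: le_wint_free => // [x|x|x]; [exact: sqr_ge0|exact: sqr_ge0|].
apply: le_integral_reflection.
- exact: (measurable_slice x j0 mhc).
- exact: (measurable_slice x j0 mh2).
- by move=> s; exact: sqr_ge0.
- by move=> s; exact: sqr_ge0.
move=> s; rewrite /hermite !rsetE !sqn_rset sqrrN.
set p := expR _; set q := expR _.
have := sqr_ge0 (c * q); nra.
Qed.

(** $|x|^2 e^{-|x|^2} \le 2 e^{-|x|^2/2}$, because $1 + |x|^2/2 \le e^{|x|^2/2}$. *)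
Let hermite_lty : (W (fun x => h x ^+ 2)%R < +oo)%E.
Proof.
apply: (@le_lt_trans _ _ (W (fun x => 2 * expR (- (2^-1 * sqn x)))%R)).
  apply: le_wint => //.
  - exact: measurableN_X.
  - by move=> x; exact: sqr_ge0.
  - by apply: measurableN_M => //; exact: measurableN_cst.
  move=> x; have s0 := sqn_ge0 x.
  have H := expR_ge1Dx (sqn x / 2).
  rewrite sqr_h (_ : - (1 * sqn x) = - (2^-1 * sqn x) + - (sqn x / 2)); last by field.
  rewrite expRD mulrCA mulrC ler_wpM2r ?expR_ge0// expRN ler_pdivrMr ?expR_gt0//.
  have := sqr_coord_le x j0; lra.
by rewrite wintZ// wint_gauss// -EFinM ltry.
Qed.

Let hermite_ge0 : (0 <= W (fun x => h x ^+ 2)%R)%E.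
Proof. by apply: wint_ge0 => //; [exact: measurableN_X|move=> x; exact: sqr_ge0]. Qed.

Lemma hermite_gt0 : (0 < W (fun x => h x ^+ 2)%R)%E.
Proof.
rewrite lt_neqAle hermite_ge0 andbT; apply/eqP => h0.
have := le_ZN_hermite; rewrite -h0 mule0 lee_fin leNgt => /negP; apply.
exact: ZN_gt0.
Qed.

(** The value [c = 0] is optimal for every width, by orthogonality, so the infimum is the norm of
    [h]. *)
Lemma dA_hermite : (dA alpha h * dA alpha h = W (fun x => h x ^+ 2)%R)%E.
Proof.
apply/eqP; rewrite eq_le; apply/andP; split.
  have := dA_sqr_le alpha0 0 ltr01 mh.
  by under [in X in (_ <= X)%E -> _]eq_fun do rewrite mul0r subr0.
have sd : (sqrte (W (fun x => h x ^+ 2)%R) <= dA alpha h)%E.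
  apply: le_ereal_inf_tmp => _ [c [l [_ ->]]].
  have -> : (fun x => (h x - c * expR (- (sqn x / (2 * l ^+ 2)))) ^+ 2) =
      (fun x => (h x - c * expR (- ((2 * l ^+ 2)^-1 * sqn x))) ^+ 2).
    by apply/funext => x; rewrite [_^-1 * _]mulrC.
  have le := le_hermite_gauss c (2 * l ^+ 2)^-1.
  by rewrite lee_sqrt// (le_trans hermite_ge0).
by rewrite -{1}(sqr_sqrte hermite_ge0) expe2 lee_pmul// sqrte_ge0.
Qed.

(** $h e^{|x|^2/2}$ is the linear function $x_{j_0}$, of constant gradient; linear functions give
    equality in the Poincaré inequality of a Gaussian factor. *)
Let dgauss_hermite i x : dgauss 1 h i x = (j0 == i)%:R * expR (- (sqn x / 2)).
Proof. rewrite /dgauss derive_hermite /hermite; ring. Qed.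

(** The reverse integration by parts at [b = 1] and [le_ZN_hermite] give $\int |\nabla h|^2 x^A dx +
    \int |h|^2|x|^2 x^A dx \le (D + 2) \int |h|^2 x^A dx$, and the product of square roots is at
    most half the sum. *)
Lemma deltaA_hermite_le :
  (deltaA alpha h (fun i => 'D_(ej R i) h) <= W (fun x => h x ^+ 2)%R)%E.
Proof.
have := wint_gradient_ge alpha0 ltr01 hC1.
have D0 := dimA_gt0 alpha0 (leq_ltn_trans (leq0n _) (ltn_ord j0)).
have mS : measurableN (fun x => \sum_i 'D_(ej R i) h x ^+ 2).
  by apply: measurableN_sum => i; exact: measurableN_X.
have S0 x : 0 <= \sum_i 'D_(ej R i) h x ^+ 2.
  by apply: sumr_ge0 => i _; exact: sqr_ge0.
have mM : measurableN (fun x => h x ^+ 2 * sqn x).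
  by apply: measurableN_M; [exact: measurableN_X|exact: measurable_sqn].
have M0 x : 0 <= h x ^+ 2 * sqn x by rewrite mulr_ge0 ?sqr_ge0 ?sqn_ge0.
have mH : measurableN (fun x => h x ^+ 2) by exact: measurableN_X.
have H0 x : 0 <= h x ^+ 2 by exact: sqr_ge0.
under eq_fun do rewrite expr1n mul1r.
rewrite wintD//.
have -> : (fun x => \sum_i dgauss 1 h i x ^+ 2 + 1 * dimA alpha * h x ^+ 2) =
    (fun x => expR (- (1 * sqn x)) + dimA alpha * h x ^+ 2).
  apply/funext => x; rewrite mul1r; congr (_ + _).
  rewrite (bigD1 j0)//= dgauss_hermite eqxx big1 => [|i ij0]; last first.
    by rewrite dgauss_hermite eq_sym (negbTE ij0) mul0r expr0n.
  by rewrite addr0 !mul1r [_ ^+ 2]expr2 -expRD -opprD -splitr.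
have E0 x : 0 <= expR (- (1 * sqn x)) by exact: expR_ge0.
have mD : measurableN (fun x => dimA alpha * h x ^+ 2).
  by apply: measurableN_M => //; exact: measurableN_cst.
have DH0 x : 0 <= dimA alpha * h x ^+ 2 by rewrite mulr_ge0// ltW.
rewrite (wintD alpha0 (mE 1) E0 mD DH0) (wintZ alpha0 (ltW D0))// wint_gauss//.
have [U U0 UE] := wint_fin alpha0 mH H0 hermite_lty.
have := le_ZN_hermite; rewrite /deltaA UE -!EFinM -EFinD lee_fin => ZU.
have Wlty f : (W f <= (ZN alpha 1 + dimA alpha * U)%:E)%E -> (W f < +oo)%E.
  by move=> /le_lt_trans; apply; rewrite ltry.
move=> H.
have [a a0 aE] : exists2 r, 0 <= r & W (fun x => \sum_i 'D_(ej R i) h x ^+ 2) = r%:E.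
  apply: wint_fin => //; apply: Wlty; apply: le_trans H; rewrite leeDl//.
  exact: wint_ge0.
have [s s0 sE] : exists2 r, 0 <= r & W (fun x => h x ^+ 2 * sqn x) = r%:E.
  apply: wint_fin => //; apply: Wlty; apply: le_trans H; rewrite leeDr//.
  exact: wint_ge0.
move: H; rewrite aE sE -EFinD lee_fin => H.
rewrite /= -EFinM -EFinB lee_fin.
have pa := sqr_sqrtr a0; have ps := sqr_sqrtr s0.
have := sqr_ge0 (Num.sqrt a - Num.sqrt s); rewrite sqrrB pa ps; lra.
Qed.

(** The lower bound is the general inequality, applied to [h] with its cutoffs as approximants. *)
Lemma deltaA_hermite : (0 < N)%N ->
  (deltaA alpha h (fun i => 'D_(ej R i) h) = dA alpha h * dA alpha h)%E.
Proof.
move=> N0; apply/eqP; rewrite eq_le dA_hermite deltaA_hermite_le -dA_hermite/=.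
have [_ _ [v [Nv cA cB]]] := hermite_SA alpha0 aj0.
apply: (deltaA_approx_ge alpha0 N0 mh mdh _ _ cA cB) => k.
  by have [] := Nstar_C1 (Nv k).
by have [] := Nstar_C1 (Nv k).
Qed.

(** Every such Gaussian stays at a distance from [h] at least the norm of [h], which is positive.
    The case [c = 0] says that [h] is nontrivial. *)
Lemma hermite_not_gauss c b : ~ ae_eq_star alpha h (fun x => c * expR (- (b * sqn x))).
Proof.
have mc : measurableN (fun x : 'rV[R]_N => c * expR (- (b * sqn x))).
  by apply: measurableN_M => //; exact: measurableN_cst.
move=> /(ae_eq_star_wint alpha0 mh mc) W0.
by have := lt_le_trans hermite_gt0 (le_hermite_gauss c b); rewrite W0 ltxx.
Qed.

End equality.

Theorem theorem1p10 (R : realType) (N : nat) (alpha : 'I_N -> R) :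
  (0 < N)%N ->
  (forall i, 0 <= alpha i) ->
  (forall (u : 'rV[R]_N -> R) (g : 'I_N -> 'rV[R]_N -> R),
      SA alpha u g -> (dA alpha u * dA alpha u <= deltaA alpha u g)%E) /\
  ((exists i, alpha i = 0) ->
   exists (u : 'rV[R]_N -> R) (g : 'I_N -> 'rV[R]_N -> R),
     [/\ SA alpha u g,
         ~ ae_eq_star alpha u (fun _ => 0),
         (forall a b : R, 0 < b ->
            ~ ae_eq_star alpha u (fun x => a * expR (- (b * sqn x)))) &
         deltaA alpha u g = (dA alpha u * dA alpha u)%E]).
Proof.
move=> N0 alpha0; split=> [u g [mu mg [v [Nv cA cB]]]|[j0 aj0]].
  apply: (deltaA_approx_ge alpha0 N0 mu mg _ _ cA cB) => k.
    by have [] := Nstar_C1 (Nv k).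
  by have [] := Nstar_C1 (Nv k).
exists (hermite j0), (fun i => 'D_(ej R i) (hermite j0)); split.
- exact: hermite_SA.
- have -> : (fun _ => 0) = (fun x : 'rV[R]_N => 0 * expR (- (0 * sqn x))).
    by apply/funext => x; rewrite mul0r.
  exact: hermite_not_gauss.
- by move=> a b _; exact: hermite_not_gauss.
- exact: deltaA_hermite.
Qed.
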